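(* Let AS.1, AS.4 and AS.5 hold. Let $N\ge2$, $\epsilon\in(0,1)$, $\xi\in(0,1)$, $\rho_0\ge1$, $\tau>0$, $\tilde D_1>0$, $\tilde D_2>0$. Assume that the iterates $x_k$ of Algorithm PZ are bounded, with constants $\kappa_f,\kappa_c,\kappa_g,\kappa_J>0$ such that (almost surely) $f(x_k)\le\kappa_f$, $\|c(x_k)\|\le\kappa_c$, $\|\nabla f(x_k)\|\le\kappa_g$, $\|J(x_k)\|\le\kappa_J$ for all $k$. Assume that in Algorithm PZ the subproblem $\min_x\Phi_\rho(x)$, for fixed $\rho=\rho_k$ and starting point $x_k$, is solved at each iteration by Algorithm SZ with constant stepsize $\gamma=\gamma_\rho:=1/L_\rho$, $L_\rho:=L_g+\rho L_J$, with a number of oracle calls $\bar N_\rho$ satisfying $$\bar N_\rho\ge\max\left\{\frac{(64D_{\Phi_\rho}/\sqrt{\tilde D_2}+4L_\rho\tilde C_1)^2}{\epsilon^2}+\frac{448L_\rho L_g\tilde D_1(n+4)^3+256L_\rho D_{\Phi_\rho}}{\epsilon},\ \frac1{L_\rho^2\tilde D_2}\right\},$$ where $\tilde C_1=24(n+4)(\kappa_g^2+\sigma^2)\sqrt{\tilde D_2}$ and $D_{\Phi_\rho}:=\Phi_\rho(x_k)-\Phi_\rho^{low}$, with all batch sizes equal to $$m_\rho=\left\lceil\min\left\{\bar N_\rho,\ \max\left\{1,\frac1{L_\rho}\sqrt{\frac{\bar N_\rho}{\tilde D_2}}\right\}\right\}\right\rceil,$$ and with smoothing parameter $0<\mu_k\le\sqrt{\tilde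 D_1/\bar N_\rho}$. Then Algorithm PZ either returns an $\epsilon$-stochastic critical point of the problem $\min\{f(x):c(x)=0\}$, or returns $x_N$ which satisfies $$\mathbb E[\theta(x_N)]\le \frac{2\bar C+(2\bar C)^{1/2}(L_g+L_J)^{1/2}}{\xi(\rho_0+(N-1)\tau)^{1/2}}\,\epsilon^{1/4}+\frac{(\kappa_g^2+0.25\epsilon)^{1/2}}{(1-\xi)(\rho_0+(N-1)\tau)}$$ and $$\mathbb E[\|\nabla f(x_N)+J(x_N)^T\lambda_N\|^2]\le\epsilon\quad\text{for some (random) }\lambda_N\in\mathbb R^q,$$ where $\bar C=\frac{1}{L_J}\kappa_J+\frac1{L_g}(\kappa_g^2+0.25\epsilon)^{1/2}$ and the expectations are over all random variables generated by Algorithm PZ. Consequently, if $$N\ \ge\ \left\lceil \tau^{-1}\tilde C\epsilon^{-1/2}-\tau^{-1}\rho_0+1\right\rceil,\qquad \tilde C=\max\left\{\frac{(4\bar C+(8\bar C)^{1/2}(L_g+L_J)^{1/2})^2}{\xi^{2}},\ \frac{(4\kappa_g^2+\epsilon)^{1/2}}{1-\xi}\right\},$$ then Algorithm PZ must return an $\epsilon$-stochastic critical point of this problem. Moreover, Algorithm PZ (with each $\bar N_\rho$ taken to be the smallest integer allowed above) can always find an $\epsilon$-stochastic critical point of this problem after at most $O(\epsilon^{-3.5})$ calls to the stochastic zeroth-order oracle.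
   Context: Problem: $\min_{x\in\mathbb R^n} f(x)$ subject to $c(x)=0$, with $f:\mathbb R^n\to\mathbb R$, $c=(c_1,\dots,c_q)^T:\mathbb R^n\to\mathbb R^q$. $\|\cdot\|$ is the Euclidean norm (induced operator norm for matrices) and $J(x)=(\nabla c_1(x),\dots,\nabla c_q(x))^T$ is the Jacobian of $c$. AS.1: $f$ and all $c_i$ are continuously differentiable; $f(x)\ge f^{low}$ for all $x$, with $f^{low}\in\mathbb R$; $\nabla f$ and $J$ are Lipschitz continuous with constants $L_g>0$ and $L_J>0$. Stochastic zeroth-order oracle: returns $F(x,\xi)\in\mathbb R$, with $\xi$ a random variable whose law does not depend on $x$. AS.5: $F(\cdot,\xi)$ is continuously differentiable, $\nabla_xF(\cdot,\xi)$ is Lipschitz with constant $L_g$ for each fixed $\xi$, and $\mathbb E_\xi[F(x,\xi)]=f(x)$. AS.4 (for $G(x,\xi):=\nabla_xF(x,\xi)$): at every iterate $x$, conditionally on the past, $\mathbb E[G(x,\xi)]=\nabla f(x)$ and $\mathbb E[\|G(x,\xi)-\nabla f(x)\|^2]\le\sigma^2$, where $\sigma>0$. For $\mu>0$ and $v$ a standard Gaussian vector in $\mathbb R^n$: $G_\mu(x,\xi,v)=\frac{F(x+\mu v,\xi)-F(x,\xi)}{\mu}v$; obtaining one value of $G_\mu$ is counted as one oracle call. For $\rho>0$: $\Phi_\rho(x)=f(x)+\rho\|c(x)\|$, and $\Phi_\rho^{low}\ge f^{low}$ is a real lower bound of $\Phi_\rho$. $\theta(x)=\|c(x)\|-\min_{\|s\|\le1}\|c(x)+J(x)s\|$.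 $\epsilon$-stochastic critical point: the output $x$ of a random process such that, for some (random, outcome-dependent) $\lambda\in\mathbb R^q$, $\mathbb E[\|\nabla f(x)+J(x)^T\lambda\|^2]\le\epsilon$ and $\mathbb E[\theta(x)]\le\sqrt\epsilon$. Algorithm SZ (subproblem solver for $\Phi_\rho$, starting point $y_1$, stepsize $\gamma$, batch size $m$, smoothing parameter $\mu$, total number of calls $\bar N$): let $N_{in}=\lceil\bar N/m\rceil$, and let $R$ be uniformly distributed on $\{1,\dots,N_{in}\}$, independent of all other samples. For $j=1,2,\dots$ let $G_{\mu,j}=\frac1m\sum_{i=1}^mG_\mu(y_j,\xi_{j,i},v_{j,i})$ with fresh independent samples $\xi_{j,i}$ and $v_{j,i}$ and $$y_{j+1}=\operatorname{argmin}_{u\in\mathbb R^n}\left\{G_{\mu,j}^T(u-y_j)+\rho\|c(y_j)+J(y_j)(u-y_j)\|+\tfrac1{2\gamma}\|u-y_j\|^2\right\}.$$ The output is $(y_R,G_{\mu,R})$. Algorithm PZ (penalty method): given $N$, $\epsilon\in(0,1)$, $\xi\in(0,1)$ (a deterministic steering parameter), $\mu_0>0$, $x_1\in\mathbb R^n$, $G^1_{\mu_0}\in\mathbb R^n$, $\rho_0\ge1$, $\tau>0$. For $k=1,\dots,N-1$: (a) find $\rho_k\ge\rho_{k-1}+\tau$ such that $\phi_{\rho_k,\mu_{k-1}}(x_k)\ge\rho_k\,\xi\,\theta(x_k)$, where $\phi_{\rho,\mu_{k-1}}(x_k)=\rho\|c(x_k)\|-\min_{\|s\|\le1}\{(G_{\mu_{k-1}}^k)^Ts+\rho\|c(x_k)+J(x_k)s\|\}$;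 (b) apply Algorithm SZ to $\Phi_{\rho_k}$ with smoothing parameter $\mu_k$ from starting point $x_k$, and let $(x_{k+1},G^{k+1}_{\mu_k})$ be its output. Return $x_N$. $O(\cdot)$ refers to $\epsilon\to0$ with all other problem and algorithm constants fixed.
   Formalization: The O(ε^{-3.5}) call bound is false for arbitrarily large ρ_k allowed by step (a); it is proved for the least N on outcomes with ρ_{N-1} ≤ κ(ρ_0+(N-1)τ), any fixed κ, and, without that condition, for some N and some admissible rule for choosing ρ_k. *)

(* Defs.v *)
From HB Require Import structures.
From mathcomp Require Import all_boot all_order all_algebra.
From mathcomp Require Import all_classical all_reals all_analysis.

Set Implicit Arguments.
Unset Strict Implicit.
Unset Printing Implicit Defensive.

Import Order.TTheory GRing.Theory Num.Theory.
Import numFieldNormedType.Exports.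

Local Open Scope classical_set_scope.
Local Open Scope ring_scope.

(* Vectors are column matrices. The library norm on matrices is the sup norm
   (used below only for its topology), hence the Euclidean norm [enorm]. *)

Section euclidean.
Variable R : realType.

Definition dotp n (u v : 'cV[R]_n) : R := \sum_i u i 0 * v i 0.

Definition enorm n (u : 'cV[R]_n) : R := Num.sqrt (\sum_i u i 0 ^+ 2).

Definition unit_ball n : set 'cV[R]_n := [set s | enorm s <= 1].

Definition opnorm p n (A : 'M[R]_(p, n)) : R :=
  sup [set enorm (A *m s) | s in @unit_ball n].

Definition grad n (f : 'cV[R]_n -> R) (x : 'cV[R]_n) : 'cV[R]_n :=
  \col_i 'D_(delta_mx i 0) f x.

Definition Jac n q (c : 'cV[R]_n -> 'cV[R]_q) (x : 'cV[R]_n) : 'M[R]_(q, n) :=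
  \matrix_(i, j) grad (fun u => c u i 0) x j 0.

Definition C1 n (f : 'cV[R]_n -> R) : Prop :=
  (forall x, differentiable f x) /\ continuous (grad f).

Definition minimizer (T : Type) (g : T -> R) (u : T) : Prop :=
  forall w, g u <= g w.

Definition least_nat (Q : nat -> Prop) (N : nat) : Prop :=
  Q N /\ forall M, Q M -> (N <= M)%N.

(* Integer ceiling of a nonnegative real. *)
Definition natceil (r : R) : nat := `|Num.ceil r|%N.

Definition random_vector d (Om : measurableType d) p
    (X : Om -> 'cV[R]_p) : Prop :=
  forall i, measurable_fun setT (fun w => X w i 0).

Definition mutually_independent d (Om : measurableType d)
    (P : probability Om R) (I : eqType) (S : I -> set (set Om)) : Prop :=
  forall (s : seq I) (A : I -> set Om), uniq s ->
    (forall i, i \in s -> S i (A i)) ->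
    P (\big[setI/setT]_(i <- s) A i) = (\prod_(i <- s) P (A i))%E.

End euclidean.

(* The oracle draws xi in [Z] with law [law], and returns [oracle x xi].
   [Phi_low rho] is the lower bound of Phi_rho. *)
Record problem (R : realType) (n q : nat) (dz : measure_display)
    (Z : measurableType dz) := Problem {
  obj : 'cV[R]_n -> R;
  con : 'cV[R]_n -> 'cV[R]_q;
  obj_low : R;
  Lg : R;
  LJ : R;
  oracle : 'cV[R]_n -> Z -> R;
  law : probability Z R;
  sigma : R;
  Phi_low : R -> R }.

(* Everything the method is given apart from N and epsilon; [steer] is the
   deterministic parameter xi of the penalty update, [D1] and [D2] are the
   constants D~_1 and D~_2, and [kf kc kg kJ] bound the iterates. *)
Record settings (R : realType) (n : nat) := Settings {
  steer : R;
  mu0 : R;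
  x1 : 'cV[R]_n;
  G1 : 'cV[R]_n;
  rho0 : R;
  tau : R;
  D1 : R;
  D2 : R;
  kf : R;
  kc : R;
  kg : R;
  kJ : R }.

Section problem_notions.
Variables (R : realType) (n q : nat) (dz : measure_display).
Variables (Z : measurableType dz) (pb : problem R n q Z).

Definition AS1 : Prop :=
  [/\ C1 (obj pb), (forall i, C1 (fun x => con pb x i 0)),
      (forall x, obj_low pb <= obj pb x), 0 < Lg pb /\ 0 < LJ pb &
      (forall x y, enorm (grad (obj pb) x - grad (obj pb) y)
                     <= Lg pb * enorm (x - y)) /\
      (forall x y, opnorm (Jac (con pb) x - Jac (con pb) y)
                     <= LJ pb * enorm (x - y))].

Definition AS5 : Prop :=
  [/\ forall z, C1 (fun x => oracle pb x z),
      forall z x y, enorm (grad (fun u => oracle pb u z) x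
                           - grad (fun u => oracle pb u z) y)
                      <= Lg pb * enorm (x - y),
      forall x, (law pb).-integrable setT (fun z => (oracle pb x z)%:E) &
      forall x, ('E_(law pb)[oracle pb x] = (obj pb x)%:E)%E].

Definition Gr (x : 'cV[R]_n) (z : Z) : 'cV[R]_n := grad (fun u => oracle pb u z) x.

(* AS.4 at the point x. The fresh xi is independent of the past, so the
   conditional expectations given the past at a random iterate are these
   integrals over the law of xi, evaluated at the value of the iterate. *)
Definition AS4_at (x : 'cV[R]_n) : Prop :=
  [/\ forall l, (law pb).-integrable setT (fun z => (Gr x z l 0)%:E),
      forall l, ('E_(law pb)[fun z => Gr x z l ord0] = (grad (obj pb) x l ord0)%:E)%E &
      ('E_(law pb)[fun z => (enorm (Gr x z - grad (obj pb) x) ^+ 2)%R]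
         <= (sigma pb ^+ 2)%:E)%E].

Definition Gmu (mu : R) (x : 'cV[R]_n) (z : Z) (v : 'cV[R]_n) : 'cV[R]_n :=
  ((oracle pb (x + mu *: v) z - oracle pb x z) / mu) *: v.

Definition Phi (rho : R) (x : 'cV[R]_n) : R := obj pb x + rho * enorm (con pb x).

Definition Phi_low_valid : Prop :=
  forall rho, 0 < rho ->
    obj_low pb <= Phi_low pb rho /\ forall x, Phi_low pb rho <= Phi rho x.

(* The infima here and in [phi] are attained, the unit ball being compact. *)
Definition theta (x : 'cV[R]_n) : R :=
  enorm (con pb x)
  - inf [set enorm (con pb x + Jac (con pb) x *m s) | s in @unit_ball R n].

Definition phi (rho : R) (g x : 'cV[R]_n) : R :=
  rho * enorm (con pb x)
  - inf [set dotp g s + rho * enorm (con pb x + Jac (con pb) x *m s)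
        | s in @unit_ball R n].

Section criticality.
Context d (Om : measurableType d) (P : probability Om R).

Definition near_stationary (eps : R) (x : Om -> 'cV[R]_n) : Prop :=
  exists lam : Om -> 'cV[R]_q, random_vector lam /\
    ('E_P[fun w => (enorm (grad (obj pb) (x w)
                          + (Jac (con pb) (x w))^T *m lam w) ^+ 2)%R]
       <= eps%:E)%E.

Definition stoch_critical (eps : R) (x : Om -> 'cV[R]_n) : Prop :=
  near_stationary eps x /\
  ('E_P[fun w => theta (x w)] <= (Num.sqrt eps)%:E)%E.

End criticality.

Definition sz_batch (mu : R) (m : nat) (y : 'cV[R]_n)
    (z : nat -> Z) (v : nat -> 'cV[R]_n) : 'cV[R]_n :=
  m%:R^-1 *: \sum_(i < m) Gmu mu y (z i) (v i).

Definition sz_model (rho gamma : R) (y g u : 'cV[R]_n) : R :=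
  dotp g (u - y) + rho * enorm (con pb y + Jac (con pb) y *m (u - y))
  + (2 * gamma)^-1 * enorm (u - y) ^+ 2.

(* y 1, y 2, ... are the iterates of SZ started at y1 that use the samples
   z j i and v j i (i < m) at iteration j >= 1. *)
Definition sz_path (rho gamma mu : R) (m : nat) (y1 : 'cV[R]_n)
    (z : nat -> nat -> Z) (v : nat -> nat -> 'cV[R]_n)
    (y : nat -> 'cV[R]_n) : Prop :=
  y 1%N = y1 /\
  forall j, (1 <= j)%N ->
    minimizer (sz_model rho gamma (y j) (sz_batch mu m (y j) (z j) (v j)))
              (y j.+1).

Variable st : settings R n.

Definition settings_valid : Prop :=
  [/\ 0 < steer st < 1, 0 < mu0 st, 1 <= rho0 st, 0 < tau st &
      [/\ 0 < D1 st, 0 < D2 st, 0 < sigma pb &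
       [/\ 0 < kf st, 0 < kc st, 0 < kg st & 0 < kJ st]]].

Definition Lrho (rho : R) : R := Lg pb + rho * LJ pb.

Definition Dphi (rho : R) (x : 'cV[R]_n) : R := Phi rho x - Phi_low pb rho.

Definition Ctilde1 : R :=
  24 * (n + 4)%:R * (kg st ^+ 2 + sigma pb ^+ 2) * Num.sqrt (D2 st).

Definition Nbar_bound (eps rho : R) (x : 'cV[R]_n) : R :=
  Num.max
    ((64 * Dphi rho x / Num.sqrt (D2 st) + 4 * Lrho rho * Ctilde1) ^+ 2
       / eps ^+ 2
     + (448 * Lrho rho * Lg pb * D1 st * (n + 4)%:R ^+ 3
        + 256 * Lrho rho * Dphi rho x) / eps)
    (Lrho rho ^+ 2 * D2 st)^-1.

Definition batch_size (Nbar : nat) (rho : R) : nat :=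
  natceil (Num.min Nbar%:R
             (Num.max 1 ((Lrho rho)^-1 * Num.sqrt (Nbar%:R / D2 st)))).

Definition Cbar (eps : R) : R :=
  (LJ pb)^-1 * kJ st
  + (Lg pb)^-1 * Num.sqrt (kg st ^+ 2 + 4^-1 * eps).

Definition Ctilde (eps : R) : R :=
  Num.max
    ((4 * Cbar eps + Num.sqrt (8 * Cbar eps) * Num.sqrt (Lg pb + LJ pb)) ^+ 2
       / steer st ^+ 2)
    (Num.sqrt (4 * kg st ^+ 2 + eps) / (1 - steer st)).

Definition theta_bound (eps : R) (N : nat) : R :=
  (2 * Cbar eps + Num.sqrt (2 * Cbar eps) * Num.sqrt (Lg pb + LJ pb))
    / (steer st * Num.sqrt (rho0 st + (N - 1)%N%:R * tau st)) * eps `^ (4^-1)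
  + Num.sqrt (kg st ^+ 2 + 4^-1 * eps)
    / ((1 - steer st) * (rho0 st + (N - 1)%N%:R * tau st)).

Definition enough_outer (eps : R) (N : nat) : Prop :=
  (Num.ceil ((tau st)^-1 * Ctilde eps * eps `^ (- 2^-1)
             - (tau st)^-1 * rho0 st + 1) <= N%:Z)%R.

(* A rule that performs the penalty update of PZ: it computes an admissible
   rho_k from (k, rho_{k-1}, x_k, G^k). The update only bounds rho_k from below,
   so a bound on the number of oracle calls must refer either to the size of
   rho_k or to the rule used. Borel measurability of the rule is phrased through
   random variables. *)
Definition penalty_rule (sel : nat -> R -> 'cV[R]_n -> 'cV[R]_n -> R) : Prop :=
  (forall k rho x g, rho0 st <= rho ->
     rho + tau st <= sel k rho x g /\
     sel k rho x g * steer st * theta x <= phi (sel k rho x g) g x) /\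
  (forall k d (T : measurableType d) (rho : T -> R) (x g : T -> 'cV[R]_n),
     measurable_fun setT rho -> random_vector x -> random_vector g ->
     measurable_fun setT (fun t => sel k (rho t) (x t) (g t))).

End problem_notions.

(* The random quantities generated by PZ. Outer iterations k and inner
   iterations j are numbered from 1, samples within a batch from 0. The samples
   come from infinite arrays of which only finitely many entries are used;
   [pz_R k] is the index R drawn in the k-th call of SZ, [pz_nbar k] its number
   of oracle calls N_bar, [pz_y k j] its iterates. *)
Record pz_data (R : realType) (n : nat) (Z Om : Type) := PZData {
  pz_xi : nat -> nat -> nat -> Om -> Z;
  pz_v : nat -> nat -> nat -> Om -> 'cV[R]_n;
  pz_R : nat -> Om -> nat;
  pz_rho : nat -> Om -> R;
  pz_mu : nat -> Om -> R;
  pz_nbar : nat -> Om -> nat;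
  pz_y : nat -> nat -> Om -> 'cV[R]_n;
  pz_x : nat -> Om -> 'cV[R]_n;
  pz_G : nat -> Om -> 'cV[R]_n }.

Section pz.
Variables (R : realType) (n q : nat) (dz : measure_display).
Variables (Z : measurableType dz) (pb : problem R n q Z) (st : settings R n).
Variables (d : measure_display) (Om : measurableType d) (P : probability Om R).
Variables (eps : R) (N : nat) (r : pz_data R n Z Om).

Definition batch (k : nat) (w : Om) : nat :=
  batch_size pb st (pz_nbar r k w) (pz_rho r k w).

Definition Nin (k : nat) (w : Om) : nat :=
  natceil ((pz_nbar r k w)%:R / (batch k w)%:R : R).

Definition Gbatch (k j : nat) (w : Om) : 'cV[R]_n :=
  sz_batch pb (pz_mu r k w) (batch k w) (pz_y r k j w)
    (fun i => pz_xi r k j i w) (fun i => pz_v r k j i w).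

(* All N_in iterations are charged, which is at least the number of calls
   actually made up to the iteration R, and at least N_bar. *)
Definition calls (w : Om) : nat := (\sum_(1 <= k < N) batch k w * Nin k w)%N.

(* The elementary samples: each xi_{k,j,i}, and each coordinate l of each
   v_{k,j,i}. *)
Definition sample_index : eqType :=
  ((nat * nat * nat) + (nat * nat * nat) * 'I_n)%type.

Definition stage (s : sample_index) : nat :=
  match s with inl t => t.1.1 | inr t => t.1.1.1 end.

Definition sample_events (s : sample_index) : set (set Om) :=
  match s with
  | inl t => preimage_set_system setT (pz_xi r t.1.1 t.1.2 t.2) measurable
  | inr t =>
      preimage_set_system setT
        (fun w => pz_v r t.1.1.1 t.1.1.2 t.1.2 w t.2 0 : R) measurable
  end.

Definition past_index (k : nat) (A : set Om) : Prop :=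
  exists2 k', (0 < k' < k)%N & preimage_set_system setT (pz_R r k') measurable A.

(* Everything drawn before the k-th call of SZ. *)
Definition history (k : nat) : set (set Om) :=
  <<s [set A | (exists2 s, (stage s < k)%N & sample_events s A)
               \/ past_index k A] >>.

(* All samples xi and v, of every call of SZ, and the earlier indices R. *)
Definition samples_and_history (k : nat) : set (set Om) :=
  <<s [set A | (exists s, sample_events s A) \/ past_index k A] >>.

Definition history_measurable (k : nat) d' (T : measurableType d')
    (X : Om -> T) : Prop :=
  forall B, measurable B -> history k (X @^-1` B).

Definition fresh_samples : Prop :=
  [/\ forall k j i, measurable_fun setT (pz_xi r k j i),
      forall k j i, random_vector (pz_v r k j i),
      forall k j i B, measurable B -> P (pz_xi r k j i @^-1` B) = law pb B,
      forall k j i l B, measurable B ->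
        P ((fun w => pz_v r k j i w l 0) @^-1` B) = normal_prob (0 : R) 1 B &
      mutually_independent P sample_events].

(* N_in depends on the past, so "R is uniform on {1, ..., N_in} and independent
   of all other samples" means that it has this conditional law given all
   samples xi and v and the indices R drawn earlier. *)
Definition uniform_index (k : nat) : Prop :=
  [/\ measurable_fun setT (pz_R r k),
      forall w, (1 <= pz_R r k w <= Nin k w)%N &
      forall A i, samples_and_history k A ->
        P (A `&` pz_R r k @^-1` [set i]) =
        (\int[P]_(w in A)
           (if (1 <= i <= Nin k w)%N then (Nin k w)%:R^-1 else 0 : R)%:E)%E].

Definition pz_run : Prop :=
  [/\ fresh_samples,
      (forall w, [/\ pz_x r 1 w = x1 st, pz_G r 1 w = G1 st,
                     pz_rho r 0 w = rho0 st & pz_mu r 0 w = mu0 st]) &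
      forall k, (1 <= k < N)%N ->
      [/\ [/\ history_measurable k (pz_rho r k), history_measurable k (pz_mu r k)
            & history_measurable k (pz_nbar r k)],
          (forall w,
             pz_rho r k.-1 w + tau st <= pz_rho r k w /\
             pz_rho r k w * steer st * theta pb (pz_x r k w)
               <= phi pb (pz_rho r k w) (pz_G r k w) (pz_x r k w)),
          (forall w, 0 < pz_mu r k w),
          uniform_index k &
          forall w,
            [/\ sz_path pb (pz_rho r k w) (Lrho pb (pz_rho r k w))^-1 (pz_mu r k w)
                  (batch k w) (pz_x r k w) (fun j i => pz_xi r k j i w)
                  (fun j i => pz_v r k j i w) (fun j => pz_y r k j w),
                pz_x r k.+1 w = pz_y r k (pz_R r k w) w &
                pz_G r k.+1 w = Gbatch k (pz_R r k w) w]]].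

Definition iterates_bounded : Prop :=
  forall k, (1 <= k <= N)%N ->
    {ae P, forall w,
       [/\ obj pb (pz_x r k w) <= kf st, enorm (con pb (pz_x r k w)) <= kc st,
           enorm (grad (obj pb) (pz_x r k w)) <= kg st &
           opnorm (Jac (con pb) (pz_x r k w)) <= kJ st]}.

Definition AS4 : Prop :=
  forall k j, (1 <= k < N)%N -> (1 <= j)%N ->
    {ae P, forall w, (j <= Nin k w)%N -> AS4_at pb (pz_y r k j w)}.

Definition allowed_nbar (k : nat) (w : Om) (M : nat) : Prop :=
  Nbar_bound pb st eps (pz_rho r k w) (pz_x r k w) <= M%:R.

Definition pz_admissible : Prop :=
  [/\ pz_run, AS4, iterates_bounded,
      forall k w, (1 <= k < N)%N -> allowed_nbar k w (pz_nbar r k w) &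
      forall k w, (1 <= k < N)%N ->
        pz_mu r k w <= Num.sqrt (D1 st / (pz_nbar r k w)%:R)].

Definition smallest_nbar : Prop :=
  forall k w, (1 <= k < N)%N -> least_nat (allowed_nbar k w) (pz_nbar r k w).

Definition follows_rule (rule : nat -> R -> 'cV[R]_n -> 'cV[R]_n -> R) : Prop :=
  forall k w, (1 <= k < N)%N ->
    pz_rho r k w = rule k (pz_rho r k.-1 w) (pz_x r k w) (pz_G r k w).

End pz.

(* Main.v *)
From HB Require Import structures.
Require Import Defs.
From mathcomp Require Import all_boot all_order all_algebra.
From mathcomp Require Import all_classical all_reals all_analysis.
From mathcomp Require Import measurable_realfun ring lra zify.
Set Implicit Arguments.
Unset Strict Implicit.
Unset Printing Implicit Defensive.
Import Order.TTheory GRing.Theory Num.Theory.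
Import numFieldNormedType.Exports.
Local Open Scope classical_set_scope.
Local Open Scope ring_scope.

(* The accuracy of x_N only depends on the last call of SZ. Let y_j be its inner
   iterates, e_j = G_{mu,j} - grad f(y_j), S_j = L_rho |y_{j+1} - y_j| and
   Q_j = S_j^2 + |e_j|^2. Optimality of the proximal step gives a lambda with
   |grad f(y_j) + J(y_j)^T lambda|^2 <= 2 Q_j, and bounds theta(y_j) by kg/rho,
   a multiple of S_j/rho, and min(kJ, (2|e_j| + S_j)/rho). So everything follows
   from E[Q_R] <= 2 eps/5.
   Given the samples, R is uniform, hence E[Q_R] is the expectation of the mean of
   Q_j over j <= N_in. The descent inequality S_j^2 <= 4 L_rho (Phi(y_j) -
   Phi(y_{j+1})) + 4 |e_j|^2 telescopes, which leaves the errors |e_j|^2. The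
   samples of iteration j are independent of y_j, so E|e_j|^2 is bounded through
   the first six moments of the Gaussian. This uses |grad f(y_j)| <= kg for all
   j <= N_in although only the outer iterates are assumed bounded: x_{k+1} = y_R,
   and each such j has a positive conditional probability of being drawn.
   A call of SZ costs O(rho^2 eps^-2). With N least, N and rho are O(eps^(-1/2)),
   which gives O(eps^-3.5). For the unconditional statement, N = 2 suffices with a
   penalty rule that takes rho_1 of order eps^(-1/2). *)

(** * Euclidean vectors *)

(** Three obstacles shape the argument. The run is described pointwise: iterates are mere
    minimizers, and [rho], [mu], the batch size and N_in are random. So every iterate has to be
    shown measurable with respect to exactly the samples and indices already drawn, and conditioning
    is done by freezing the past on a product space. Integrability of the errors along the run is
    not known beforehand, so the estimates there stay between nonnegative integrals, and a random
    number of iterations is treated as a series over all j weighted by the conditional law of R. The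
    bound on theta must carry a factor sqrt(Cbar)/sqrt(rho), whereas the error contributes (2|e| +
    S)/rho without it. This is why the cap kJ stays inside the minimum: min(kJ, v/rho) is at most
    sqrt(kJ v/rho), and kJ is at most LJ Cbar. The value 2/5 is what the prescribed number of calls
    yields. Twice 2/5 leaves slack below 1, which is spent on choosing the multiplier measurably. *)

Section Euclid.
Variable R : realType.
Implicit Types (n p q : nat).

Lemma dotpC n (u v : 'cV[R]_n) : dotp u v = dotp v u.
Proof. by apply: eq_bigr => i _; rewrite mulrC. Qed.

Lemma dotpDl n (u v w : 'cV[R]_n) : dotp (u + v) w = dotp u w + dotp v w.
Proof. by rewrite -big_split; apply: eq_bigr => i _; rewrite mxE mulrDl. Qed.

Lemma dotpDr n (u v w : 'cV[R]_n) : dotp w (u + v) = dotp w u + dotp w v.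
Proof. by rewrite dotpC dotpDl !(dotpC w). Qed.

Lemma dotpZl n a (u v : 'cV[R]_n) : dotp (a *: u) v = a * dotp u v.
Proof. by rewrite [RHS]mulr_sumr; apply: eq_bigr => i _; rewrite mxE mulrA. Qed.

Lemma dotpZr n a (u v : 'cV[R]_n) : dotp u (a *: v) = a * dotp u v.
Proof. by rewrite dotpC dotpZl dotpC. Qed.

Lemma dotpNl n (u v : 'cV[R]_n) : dotp (- u) v = - dotp u v.
Proof. by rewrite -scaleN1r dotpZl mulN1r. Qed.

Lemma dotpNr n (u v : 'cV[R]_n) : dotp u (- v) = - dotp u v.
Proof. by rewrite dotpC dotpNl dotpC. Qed.

Lemma dotpBl n (u v w : 'cV[R]_n) : dotp (u - v) w = dotp u w - dotp v w.
Proof. by rewrite dotpDl dotpNl. Qed.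

Lemma dotpBr n (u v w : 'cV[R]_n) : dotp w (u - v) = dotp w u - dotp w v.
Proof. by rewrite dotpDr dotpNr. Qed.

Lemma dotp0r n (u : 'cV[R]_n) : dotp u 0 = 0.
Proof. by apply: big1 => i _; rewrite mxE mulr0. Qed.

Lemma dotp0l n (u : 'cV[R]_n) : dotp 0 u = 0.
Proof. by rewrite dotpC dotp0r. Qed.

Lemma coordB n (u v : 'cV[R]_n) i : (u - v) i 0 = u i 0 - v i 0.
Proof. by rewrite !mxE. Qed.

Lemma enorm_ge0 n (u : 'cV[R]_n) : 0 <= enorm u.
Proof. exact: sqrtr_ge0. Qed.

Lemma enorm_sqr n (u : 'cV[R]_n) : enorm u ^+ 2 = dotp u u.
Proof.
rewrite sqr_sqrtr; first by apply: eq_bigr => i _; rewrite expr2.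
by apply: sumr_ge0 => i _; exact: sqr_ge0.
Qed.

Lemma dotp_ge0 n (u : 'cV[R]_n) : 0 <= dotp u u.
Proof. by rewrite -enorm_sqr sqr_ge0. Qed.

Lemma enorm_le n (u : 'cV[R]_n) a : 0 <= a -> dotp u u <= a ^+ 2 -> enorm u <= a.
Proof. by move=> a0 h; rewrite -(ler_sqr _ a0) ?enorm_sqr // nnegrE enorm_ge0. Qed.

Lemma enorm0 n : enorm (0 : 'cV[R]_n) = 0.
Proof. by apply/eqP; rewrite -sqrf_eq0 enorm_sqr dotp0l. Qed.

Lemma enormZ n a (u : 'cV[R]_n) : enorm (a *: u) = `|a| * enorm u.
Proof.
apply/eqP; rewrite -(eqrXn2 (n := 2)) ?enorm_ge0 ?mulr_ge0 ?enorm_ge0 //.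
by rewrite exprMn !enorm_sqr dotpZl dotpZr mulrA real_normK ?num_real.
Qed.

Lemma enormN n (u : 'cV[R]_n) : enorm (- u) = enorm u.
Proof. by rewrite -scaleN1r enormZ normrN normr1 mul1r. Qed.

Lemma cauchy_schwarz_sqr n (u v : 'cV[R]_n) : dotp u v ^+ 2 <= dotp u u * dotp v v.
Proof.
have := dotp_ge0 (dotp v v *: u - dotp u v *: v).
rewrite dotpBl !dotpBr !dotpZl !dotpZr (dotpC v u) => h.
have [v0|v0] := eqVneq (dotp v v) 0.
  have [->|uv] := eqVneq (dotp u v) 0; first by rewrite v0 mulr0 expr0n.
  (* With |v| = 0 the square |u - t v|^2 equals |u|^2 - 2 t u.v; this t makes it -1, a
     contradiction. *)
  have := dotp_ge0 (u - ((dotp u u + 1) / (2 * dotp u v)) *: v).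
  rewrite dotpBl !dotpBr !dotpZl !dotpZr (dotpC v u) v0 !mulr0 subr0.
  rewrite (_ : _ / _ * _ = (dotp u u + 1) / 2); last by field.
  by lra.
have vp : 0 < dotp v v by rewrite lt_def v0 dotp_ge0.
by rewrite -(ler_pM2l vp); nra.
Qed.

Lemma cauchy_schwarz n (u v : 'cV[R]_n) : `|dotp u v| <= enorm u * enorm v.
Proof.
rewrite -(ler_sqr (normr_nneg _)) ?nnegrE ?mulr_ge0 ?enorm_ge0 //.
by rewrite exprMn !enorm_sqr real_normK ?num_real ?cauchy_schwarz_sqr.
Qed.

Lemma dotp_le n (u v : 'cV[R]_n) : dotp u v <= enorm u * enorm v.
Proof. exact: le_trans (ler_norm _) (cauchy_schwarz _ _). Qed.

Lemma dotp_geN n (u v : 'cV[R]_n) : - (enorm u * enorm v) <= dotp u v.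
Proof. by rewrite lerNl -dotpNl; apply: le_trans (dotp_le _ _) _; rewrite enormN. Qed.

Lemma enormD n (u v : 'cV[R]_n) : enorm (u + v) <= enorm u + enorm v.
Proof.
apply: enorm_le; first by rewrite addr_ge0 ?enorm_ge0.
rewrite dotpDl !dotpDr (dotpC v u) sqrrD !enorm_sqr -mulr_natr.
by have := dotp_le u v; lra.
Qed.

Lemma enorm_distr n (u v : 'cV[R]_n) : enorm u - enorm v <= enorm (u - v).
Proof. by rewrite lerBlDr -{1}(subrK v u) enormD. Qed.

Lemma coord_le_enorm n (u : 'cV[R]_n) i : `|u i 0| <= enorm u.
Proof.
rewrite -(ler_sqr (normr_nneg _)) ?nnegrE ?enorm_ge0 // enorm_sqr.
rewrite real_normK ?num_real // /dotp (bigD1 i) //= -expr2 lerDl.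
by apply: sumr_ge0 => j _; rewrite -expr2 sqr_ge0.
Qed.

Lemma enorm_le_sum n (u : 'cV[R]_n) : enorm u <= \sum_i `|u i 0|.
Proof.
apply: enorm_le; first exact: sumr_ge0.
rewrite expr2 mulr_suml; apply: ler_sum => i _.
rewrite -expr2 -real_normK ?num_real // expr2 ler_wpM2l //.
by rewrite (bigD1 i) //= lerDl sumr_ge0.
Qed.

Lemma coord_mulmx p n (A : 'M[R]_(p, n)) (s : 'cV[R]_n) i :
  (A *m s) i 0 = dotp (\col_j A i j) s.
Proof. by rewrite mxE; apply: eq_bigr => j _; rewrite mxE. Qed.

Lemma opnorm_has_sup p n (A : 'M[R]_(p, n)) :
  has_sup [set enorm (A *m s) | s in @unit_ball R n].
Proof.
split; first by exists (enorm (A *m 0)), 0 => //; rewrite /unit_ball/= enorm0.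
exists (\sum_i enorm (\col_j A i j)) => _ [s hs <-].
apply: le_trans (enorm_le_sum _) _; apply: ler_sum => i _.
rewrite coord_mulmx; apply: le_trans (cauchy_schwarz _ _) _.
by rewrite ler_piMr ?enorm_ge0.
Qed.

Lemma enorm_eq0 n (u : 'cV[R]_n) : enorm u = 0 -> u = 0.
Proof.
move=> h; apply/matrixP => i j; rewrite ord1 mxE.
by apply/eqP; rewrite -normr_le0 -h coord_le_enorm.
Qed.

Lemma opnorm_mulmx p n (A : 'M[R]_(p, n)) (s : 'cV[R]_n) :
  enorm (A *m s) <= opnorm A * enorm s.
Proof.
have [h|h] := eqVneq (enorm s) 0.
  by rewrite (enorm_eq0 h) mulmx0 !enorm0 mulr0.
have sp : 0 < enorm s by rewrite lt_def h enorm_ge0.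
rewrite -ler_pdivrMr // mulrC -[X in X * _]ger0_norm ?invr_ge0 ?enorm_ge0 //.
rewrite -enormZ scalemxAr; apply: (sup_upper_bound (opnorm_has_sup A)).
exists ((enorm s)^-1 *: s) => //; rewrite /unit_ball/= enormZ.
by rewrite ger0_norm ?invr_ge0 ?enorm_ge0 // mulVf.
Qed.

Lemma opnorm_ge0 p n (A : 'M[R]_(p, n)) : 0 <= opnorm A.
Proof.
have <- : enorm (A *m 0) = 0 by rewrite mulmx0 enorm0.
apply: (sup_upper_bound (opnorm_has_sup A)); exists 0 => //.
by rewrite /unit_ball/= enorm0.
Qed.

(** By [submxE], g lies in the row space of A once it kills [cokermx A], whose columns lie in the
    kernel of A. This is how Lagrange multipliers are obtained without a subdifferential of the
    norm. *)
Lemma orth_kernel_range p n (A : 'M[R]_(p, n)) (g : 'cV[R]_n) :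
  (forall t, A *m t = 0 -> dotp g t = 0) -> exists u, A^T *m u = g.
Proof.
move=> h; have /submxP[D hD] : (g^T <= A)%MS.
  rewrite submxE; apply/eqP/matrixP => i j; rewrite ord1 [RHS]mxE.
  rewrite -[RHS](h (col j (cokermx A))); last first.
    by rewrite colE mulmxA mulmx_coker mul0mx.
  by rewrite mxE; apply: eq_bigr => k _; rewrite !mxE.
by exists D^T; rewrite -trmx_mul -hD trmxK.
Qed.

End Euclid.

(** * Measurability of selections and of compositions *)

Section Measurability.
Context {R : realType} {d : measure_display} {T : measurableType d}.
Implicit Types (n p q : nat).

(** The level sets of [D] form a countable measurable partition. It is applied to natural numbers
    (random index, random batch size), to integers (rounding up) and to grid vectors. *)
Lemma measurable_select (I : countType) d' (U : measurableType d')
    (D : T -> I) (f : I -> T -> U) :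
  (forall i, measurable [set t | D t = i]) ->
  (forall i, measurable_fun setT (f i)) ->
  measurable_fun setT (fun t => f (D t) t).
Proof.
move=> mD mf _ Y mY; rewrite setTI.
rewrite (_ : _ @^-1` Y = \bigcup_i ([set t | D t = i] `&` f i @^-1` Y)); last first.
  apply/seteqP; split=> [t /= h|t [i _ [/= <-]]] //; by exists (D t).
apply: countable_bigcupT_measurable; first exact: countableP.
by move=> i; apply: measurableI => //; rewrite -[X in measurable X]setTI; exact: mf.
Qed.

Lemma measurable_select_nat d' (U : measurableType d') (D : T -> nat)
    (f : nat -> T -> U) :
  measurable_fun setT D -> (forall i, measurable_fun setT (f i)) ->
  measurable_fun setT (fun t => f (D t) t).
Proof.
move=> mD; apply: measurable_select => i.
by rewrite -[X in measurable X]setTI; exact: (mD measurableT [set i]).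
Qed.

Lemma random_vector_select_nat p (D : T -> nat) (f : nat -> T -> 'cV[R]_p) :
  measurable_fun setT D -> (forall i, random_vector (f i)) ->
  random_vector (fun t => f (D t) t).
Proof. by move=> mD mf i; apply: (measurable_select_nat (f := fun k t => f k t i 0) mD) => k; exact: mf. Qed.

Lemma random_vector_cst p (x : 'cV[R]_p) : random_vector (fun _ : T => x).
Proof. by move=> i; exact: measurable_cst. Qed.

Lemma random_vectorD p (X Y : T -> 'cV[R]_p) : random_vector X -> random_vector Y ->
  random_vector (fun t => X t + Y t).
Proof.
move=> mX mY i; apply: (eq_measurable_fun (fun t => X t i 0 + Y t i 0)).
  by move=> t _; rewrite mxE.
exact: measurable_funD.
Qed.

Lemma random_vectorZ p (a : T -> R) (X : T -> 'cV[R]_p) :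
  measurable_fun setT a -> random_vector X -> random_vector (fun t => a t *: X t).
Proof.
move=> ma mX i; apply: (eq_measurable_fun (fun t => a t * X t i 0)).
  by move=> t _; rewrite mxE.
exact: measurable_funM.
Qed.

Lemma random_vectorB p (X Y : T -> 'cV[R]_p) : random_vector X -> random_vector Y ->
  random_vector (fun t => X t - Y t).
Proof.
move=> mX mY i; apply: (eq_measurable_fun (fun t => X t i 0 - Y t i 0)).
  by move=> t _; rewrite !mxE.
exact: measurable_funB.
Qed.

Lemma random_vector_sum p (I : Type) (s : seq I) (X : I -> T -> 'cV[R]_p) :
  (forall i, random_vector (X i)) -> random_vector (fun t => \sum_(i <- s) X i t).
Proof.
move=> mX i; apply: (eq_measurable_fun (fun t => \sum_(k <- s) X k t i 0)).
  by move=> t _; rewrite summxE.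
by apply: measurable_sum => k; exact: mX.
Qed.

Lemma measurable_dotp p (X Y : T -> 'cV[R]_p) : random_vector X -> random_vector Y ->
  measurable_fun setT (fun t => dotp (X t) (Y t)).
Proof. by move=> mX mY; apply: measurable_sum => i; exact: measurable_funM. Qed.

Lemma measurable_enorm p (X : T -> 'cV[R]_p) : random_vector X ->
  measurable_fun setT (fun t => enorm (X t)).
Proof.
move=> mX; apply: (@measurableT_comp _ _ _ _ _ _ (@Num.sqrt R)).
  by apply: continuous_measurable_fun; exact: sqrt_continuous.
by apply: measurable_sum => i; exact: measurable_funX.
Qed.

End Measurability.

(** * Grid approximation and measurability of continuous compositions *)

Section Grid.
Variable R : realType.

Definition grid_point p (k : nat) (z : 'cV[int]_p) : 'cV[R]_p :=
  \col_i ((z i 0)%:~R / k.+1%:R).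

Definition grid_floor p (k : nat) (u : 'cV[R]_p) : 'cV[int]_p :=
  \col_i Num.floor (k.+1%:R * u i 0).

Lemma grid_approx p (u : 'cV[R]_p) k i :
  `|u i 0 - grid_point k (grid_floor k u) i 0| <= k.+1%:R^-1.
Proof.
rewrite !mxE; have /andP[h1 h2] := floor_itv (k.+1%:R * u i 0).
have kp : (0 : R) < k.+1%:R by [].
have -> : u i 0 - (Num.floor (k.+1%:R * u i 0))%:~R / k.+1%:R
  = (k.+1%:R * u i 0 - (Num.floor (k.+1%:R * u i 0))%:~R) / k.+1%:R.
  by field.
rewrite normrM (ger0_norm (_ : 0 <= _^-1)) ?invr_ge0 // ler_piMl ?invr_ge0 //.
rewrite ger0_norm ?subr_ge0 //.
by move: h2; rewrite intrD; lra.
Qed.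

Lemma cvg_grid p (u : 'cV[R]_p) :
  (fun k => grid_point k (grid_floor k u)) @ \oo --> u.
Proof.
apply/cvg_ballP => e e0; near=> k; split => // i j; rewrite ord1.
rewrite /ball/=; apply: le_lt_trans (grid_approx _ _ _) _.
near: k; have /cvgrPdist_lt/(_ e e0) := @cvg_harmonic R.
apply: filterS => k; rewrite /harmonic sub0r normrN ger0_norm ?invr_ge0 //.
Unshelve. all: by end_near. Qed.

Lemma grid_dense p (h : 'cV[R]_p -> R) u b : {for u, continuous h} -> h u < b ->
  exists c : nat * 'cV[int]_p, h (grid_point c.1 c.2) < b.
Proof.
move=> hc hb; have := @cvg_comp _ _ _ _ h _ _ _ (@cvg_grid _ u) hc.
move=> /cvgr_lt/(_ _ hb)[N _ /(_ N (leqnn N)) hN].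
by exists (N, grid_floor N u).
Qed.

Lemma measurable_grid_floor d (T : measurableType d) p (X : T -> 'cV[R]_p) k z :
  random_vector X -> measurable [set t | grid_floor k (X t) = z].
Proof.
move=> mX; rewrite (_ : [set _ | _] = \big[setI/setT]_i
    (X^~ i ^~ 0 @^-1` `[(z i 0)%:~R / k.+1%:R, ((z i 0)%:~R + 1) / k.+1%:R[)).
  apply: bigsetI_measurable => i _; rewrite -[X in measurable X]setTI.
  exact: mX.
have kp : (0 : R) < k.+1%:R by [].
apply/seteqP; split=> t; rewrite -bigcap_seq /=.
  move=> <- i _; rewrite /= in_itv/= mxE ler_pdivrMr // ltr_pdivlMr //.
  by have := floor_itv (k.+1%:R * X t i 0); rewrite intrD mulrC.
move=> h; apply/matrixP => i j; rewrite ord1 mxE.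
apply/eqP; rewrite floor_eq intrD.
by have := h i (mem_index_enum i); rewrite /= in_itv/= ler_pdivrMr // ltr_pdivlMr // mulrC.
Qed.

(** [random_vector] asks for measurable coordinates and puts no measurable structure on vectors. So
    X is rounded to the grid of step 1/(k+1), where countably many values allow [measurable_select],
    and continuity in x passes to the limit. The joint form in x and t serves the oracle, whose
    second argument is a random sample. *)
Lemma measurable_caratheodory d (T : measurableType d) p (f : 'cV[R]_p -> T -> R)
    (X : T -> 'cV[R]_p) :
  (forall t, continuous (f ^~ t)) -> (forall x, measurable_fun setT (f x)) ->
  random_vector X -> measurable_fun setT (fun t => f (X t) t).
Proof.
move=> fc fm mX.
apply: (@measurable_fun_cvg _ _ _ _
  (fun k t => f (grid_point k (grid_floor k (X t))) t)).
  move=> k; apply: (measurable_select (D := fun t => grid_floor k (X t))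
    (f := fun z => f (grid_point k z))) => [z|z] //.
  exact: measurable_grid_floor.
by move=> t _; exact: (@cvg_comp _ _ _ _ (f^~ t) _ _ _ (@cvg_grid _ (X t)) (fc t (X t))).
Qed.

Lemma measurable_continuous_rv d (T : measurableType d) p (f : 'cV[R]_p -> R)
    (X : T -> 'cV[R]_p) :
  continuous f -> random_vector X -> measurable_fun setT (fun t => f (X t)).
Proof.
move=> fc; exact: (measurable_caratheodory (f := fun x _ => f x)).
Qed.

End Grid.

(** * Descent inequalities *)

Section Calculus.
Variable R : realType.

Lemma cV_sum_delta n (v : 'cV[R]_n) : v = \sum_i v i 0 *: delta_mx i 0.
Proof.
apply/matrixP => i j; rewrite ord1 summxE (bigD1 i) //= big1 ?addr0.
  by rewrite !mxE !eqxx mulr1.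
by move=> k ki; rewrite !mxE eq_sym (negbTE ki) mulr0.
Qed.

Lemma dotp_delta n (u : 'cV[R]_n) l : dotp u (delta_mx l 0) = u l 0.
Proof.
rewrite /dotp (bigD1 l) //= big1 ?addr0; first by rewrite mxE !eqxx mulr1.
by move=> i il; rewrite mxE (negbTE il) mulr0.
Qed.

Lemma near_inv_lt (e : R) : 0 < e -> \forall k \near \oo, k.+1%:R^-1 < e.
Proof. by move=> e0; exact: (near_infty_natSinv_lt (PosNum e0)). Qed.

Lemma derive_dotp_grad n (f : 'cV[R]_n -> R) x v : differentiable f x ->
  'D_v f x = dotp (grad f x) v.
Proof.
move=> df; rewrite deriveE // {1}(cV_sum_delta v) linear_sum.
by apply: eq_bigr => i _; rewrite linearZ /= mxE deriveE // mulrC.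
Qed.

Lemma is_derive_line n (f : 'cV[R]_n -> R) (x s : 'cV[R]_n) (t : R) :
  differentiable f (x + t *: s) ->
  is_derive t 1 (fun t => f (x + t *: s)) (dotp (grad f (x + t *: s)) s).
Proof.
move=> df; have dv := derivable1_diffP.
have E : (fun h : R => h^-1 *: (((fun t => f (x + t *: s)) \o shift t) (h *: 1)
             - f (x + t *: s)))
  = (fun h : R => h^-1 *: ((f \o shift (x + t *: s)) (h *: s) - f (x + t *: s))).
  apply/funext => h /=; congr (_ *: (f _ - _)).
  by rewrite scalerDl -[_ *: 1]/(h * 1) mulr1 addrCA.
split.
  rewrite /derivable E; exact: (diff_derivable (v := s) df).
by rewrite -derive_dotp_grad // /derive E.
Qed.

(** The mean value theorem applied to phi(t) - phi'(0) t - K t^2/2, whose derivative is nonpositive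
    on the unit interval. It gives the descent inequalities without integrating a gradient. *)
Lemma quadratic_growth (phi dphi : R -> R) (K : R) :
  (forall t : R, is_derive t (1 : R) phi (dphi t)) ->
  (forall t, 0 <= t <= 1 -> dphi t - dphi 0 <= K * t) ->
  phi 1 - phi 0 - dphi 0 <= K / 2.
Proof.
move=> hd hK.
pose psi t := phi t - dphi 0 * t - K / 2 * t ^+ 2.
have dpsi (t : R) : is_derive t (1 : R) psi (dphi t - dphi 0 - K * t).
  have := hd t => ?.
  rewrite /psi; apply: is_derive_eq.
  by rewrite -![_ *: _]/(_ * _); field.
have cpsi t : {for t, continuous psi}.
  by apply: differentiable_continuous; apply/derivable1_diffP; have [] := dpsi t.
have [c c01 hc] := MVT (ltr01 : 0 < 1 :> R) (fun t _ => dpsi t)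
   (continuous_subspaceT cpsi).
move: c01; rewrite in_itv/= => /andP[c0 c1].
have := hK c; rewrite (ltW c0) (ltW c1) => /(_ isT) h.
by move: hc; rewrite /psi; lra.
Qed.

Section descent.
Variables (n : nat) (f : 'cV[R]_n -> R) (L : R).
Hypothesis df : forall x, differentiable f x.
Hypothesis Lf : forall x y, enorm (grad f x - grad f y) <= L * enorm (x - y).

Lemma grad_line_lip x s (t : R) : 0 <= t ->
  `|dotp (grad f (x + t *: s)) s - dotp (grad f (x + 0 *: s)) s|
    <= L * enorm s ^+ 2 * t.
Proof.
move=> t0; rewrite -dotpBl; apply: le_trans (cauchy_schwarz _ _) _.
have := Lf (x + t *: s) (x + 0 *: s).
rewrite scale0r addr0 addrAC subrr add0r enormZ ger0_norm // => h.
apply: le_trans (ler_wpM2r (enorm_ge0 _) h) _.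
by rewrite expr2 le_eqVlt; apply/orP; left; apply/eqP; ring.
Qed.

Lemma descent x s : `|f (x + s) - f x - dotp (grad f x) s| <= L / 2 * enorm s ^+ 2.
Proof.
have hd t := is_derive_line (df (x + t *: s)).
have hl t (h : 0 <= t <= 1) := grad_line_lip x s (proj1 (andP h)).
rewrite ler_norml; apply/andP; split; last first.
  have := @quadratic_growth (fun t => f (x + t *: s))
    (fun t => dotp (grad f (x + t *: s)) s) _ hd
    (fun t h => le_trans (ler_norm _) (hl t h)).
  by rewrite !scale1r scale0r addr0; lra.
have hdN (t : R) : is_derive t (1 : R) (fun t => - f (x + t *: s))
   (- dotp (grad f (x + t *: s)) s).
  by have := hd t => ?; exact: is_deriveN.
have hlN t : 0 <= t <= 1 -> - dotp (grad f (x + t *: s)) s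
    - - dotp (grad f (x + 0 *: s)) s <= L * enorm s ^+ 2 * t.
  by move=> /hl; rewrite ler_norml => /andP[]; lra.
have := @quadratic_growth _ _ _ hdN hlN.
by rewrite !scale1r scale0r addr0; lra.
Qed.

End descent.

Section vector_descent.
Variables (n q : nat) (c : 'cV[R]_n -> 'cV[R]_q) (L : R).
Hypothesis dc : forall i x, differentiable (fun u => c u i 0) x.
Hypothesis Lc : forall x y, opnorm (Jac c x - Jac c y) <= L * enorm (x - y).

Lemma coord_Jac_mul x s i : (Jac c x *m s) i 0 = dotp (grad (fun u => c u i 0) x) s.
Proof. by rewrite coord_mulmx; apply: eq_bigr => j _; rewrite !mxE. Qed.

(** The remainder u is tested against itself: the derivative of <u, c(x + t s)> grows by at most |u|
    L |s|^2 t, hence |u|^2 <= |u| L/2 |s|^2. Working coordinate by coordinate would lose a factor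
    depending on q. *)
Lemma vector_descent x s : enorm (c (x + s) - c x - Jac c x *m s) <= L / 2 * enorm s ^+ 2.
Proof.
set u := c (x + s) - c x - Jac c x *m s.
have hd (t : R) : is_derive t (1 : R) (fun t => dotp u (c (x + t *: s)))
   (dotp u (Jac c (x + t *: s) *m s)).
  rewrite (_ : (fun t => _) = \sum_i (fun t => u i 0 * c (x + t *: s) i 0)); last first.
    by apply/funext => z; rewrite fct_sumE.
  apply: is_derive_sum => i.
  have := is_derive_line (dc i (x + t *: s)) => h.
  apply: is_derive_eq; rewrite coord_Jac_mul.
  by rewrite -![_ *: _]/(_ * _); ring.
have hl (t : R) : 0 <= t <= 1 -> dotp u (Jac c (x + t *: s) *m s)
    - dotp u (Jac c (x + 0 *: s) *m s) <= enorm u * (L * enorm s ^+ 2) * t.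
  move=> /andP[t0 _]; rewrite -dotpBr -mulmxBl; apply: le_trans (dotp_le _ _) _.
  rewrite -mulrA; apply: ler_wpM2l; first exact: enorm_ge0.
  apply: le_trans (opnorm_mulmx _ _) _.
  have := Lc (x + t *: s) (x + 0 *: s).
  rewrite scale0r addr0 addrAC subrr add0r enormZ ger0_norm // => h.
  apply: le_trans (ler_wpM2r (enorm_ge0 _) h) _.
  by rewrite expr2 le_eqVlt; apply/orP; left; apply/eqP; ring.
have := quadratic_growth hd hl.
rewrite !scale1r scale0r addr0 -!dotpBr -/u -enorm_sqr.
(* If u = 0, the claim is L |s|^2 >= 0; the sign comes from [Lc], an operator norm being
   nonnegative. *)
have [->|u0] := eqVneq (enorm u) 0.
  move=> _; have := Lc (x + s) x; rewrite addrAC subrr add0r.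
  have := opnorm_ge0 (Jac c (x + s) - Jac c x) => h0 h1.
  have := le_trans h0 h1; have := enorm_ge0 s; nra.
have up : 0 < enorm u by rewrite lt_def u0 enorm_ge0.
by move=> h; rewrite -(ler_pM2l up) -expr2; apply: le_trans h _; lra.
Qed.

End vector_descent.

End Calculus.

(** * The proximal step *)

Section ProxStep.
Variables (R : realType) (n q : nat) (dz : measure_display).
Variables (Z : measurableType dz) (pb : problem R n q Z).
Hypothesis as1 : AS1 pb.
Variable rho : R.
Hypothesis rho0 : 0 < rho.
Variables (y g u : 'cV[R]_n).
Hypothesis umin : minimizer (sz_model pb rho (Lrho pb rho)^-1 y g) u.

Let L := Lrho pb rho.
Let s := u - y.
Let c := con pb y.
Let J := Jac (con pb) y.
Let e := g - grad (obj pb) y.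
Let lin t := dotp g t + rho * enorm (c + J *m t).

Lemma Lrho_gt0 : 0 < Lrho pb rho.
Proof. by case: as1 => _ _ _ [? ?] _; rewrite /Lrho addr_gt0 ?mulr_gt0. Qed.

(** First-order optimality: -L s is a subgradient of [lin] at s. The minimizer is compared with the
    point s + k (t - s) of the segment; convexity of the norm leaves k (a + k b) >= 0 for small k,
    which forces a >= 0. *)
Lemma prox_convex t : lin s - L * dotp s (t - s) <= lin t.
Proof.
have Lp : 0 < L := Lrho_gt0.
set a := lin t - lin s + L * dotp s (t - s).
set b := L / 2 * enorm (t - s) ^+ 2.
have b0 : 0 <= b by rewrite mulr_ge0 ?sqr_ge0 ?divr_ge0 ?(ltW Lp).
have hk k : 0 < k <= 1 -> - (k * b) <= a.
  move=> /andP[k0 k1].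
  have := umin (y + (s + k *: (t - s))).
  rewrite /sz_model -/s -/c -/J (addrC y) addrK invfM invrK -/L.
  have -> : dotp g (s + k *: (t - s)) = (1 - k) * dotp g s + k * dotp g t.
    by rewrite dotpDr dotpZr (dotpBr t s); ring.
  have -> : enorm (s + k *: (t - s)) ^+ 2
      = enorm s ^+ 2 + 2 * k * dotp s (t - s) + k ^+ 2 * enorm (t - s) ^+ 2.
    clear; move: (t - s) => w; clearbody s.
    by rewrite !enorm_sqr dotpDl !dotpDr !dotpZl !dotpZr (dotpC w s); ring.
  have : enorm (c + J *m (s + k *: (t - s))) <=
      (1 - k) * enorm (c + J *m s) + k * enorm (c + J *m t).
    have -> : c + J *m (s + k *: (t - s))
        = (1 - k) *: (c + J *m s) + k *: (c + J *m t).
      clear; clearbody s J c; rewrite mulmxDr -scalemxAr mulmxBr.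
      move: (J *m s) (J *m t) => js jt.
      by apply/matrixP => i j; rewrite !mxE; ring.
    apply: le_trans (enormD _ _) _.
    by rewrite !enormZ !ger0_norm ?subr_ge0 ?(ltW k0).
  move=> /(ler_wpM2l (ltW rho0)) hc h.
  have : 0 <= k * (a + k * b).
    by rewrite /a /b /lin; have := le_trans h (lerD (lerD (lexx _) hc) (lexx _)); lra.
  by rewrite pmulr_rge0 //; lra.
have [ha|ha] := leP 0 a; first by move: ha; rewrite /a; lra.
(* Instead of a limit k -> 0: if a < 0, this k gives -(k b) = a b/(b - a) > a, against [hk]. *)
have kb : 0 < - a / (b - a) <= 1.
  rewrite divr_gt0 ?oppr_gt0 //=; last by lra.
  by rewrite ler_pdivrMr ?mul1r; lra.
have := hk _ kb; rewrite mulrAC -mulrA.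
have : b / (b - a) < 1 by rewrite ltr_pdivrMr ?mul1r; lra.
by nra.
Qed.

(** Needed for measurability: a point with nearly minimal value is close to [u], so [u] is a limit
    of measurable near-minimizers. *)
Lemma prox_strongly_convex t :
  sz_model pb rho L^-1 y g u + L / 2 * enorm (t - u) ^+ 2
    <= sz_model pb rho L^-1 y g t.
Proof.
have := prox_convex (t - y); rewrite /lin /sz_model -/s -/c -/J invfM invrK.
have -> : enorm (t - u) ^+ 2 = enorm (t - y) ^+ 2 - enorm s ^+ 2
   - 2 * dotp s (t - y - s).
  have -> : t - u = (t - y) - s by rewrite /s opprB addrC addrA subrK addrC.
  by clearbody s; move: (t - y) => w; rewrite !enorm_sqr !dotpBl !dotpBr (dotpC w s); ring.
by lra.
Qed.

(** On the kernel of J the norm term does not move, so optimality tested along t and along -t makes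
    g + L s orthogonal to that kernel, hence in the range of J^T. The argument also covers c + J s =
    0, where the norm is not differentiable. *)
Lemma prox_stationary : exists lam, g + L *: s + J^T *m lam = 0.
Proof.
have [|lam hlam] := @orth_kernel_range R q n J (g + L *: s); last first.
  by exists (- lam); rewrite mulmxN hlam subrr.
have h t : J *m t = 0 -> 0 <= dotp (g + L *: s) t.
  move=> Jt; have := prox_convex (s + t).
  rewrite /lin (mulmxDr J s t) Jt addr0 (dotpDr s t g) (_ : s + t - s = t); last first.
    by rewrite addrAC subrr add0r.
  by rewrite (dotpDl g) dotpZl; lra.
move=> t Jt; apply/eqP; rewrite eq_le h // andbT.
by have := h (- t); rewrite mulmxN Jt oppr0 dotpNr oppr_ge0; apply.
Qed.

(** With the multiplier of [prox_stationary] the gradient of the Lagrangian is exactly -(e + L s);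
    the factor 2 is (a + b)^2 <= 2 (a^2 + b^2). *)
Lemma prox_near_stationary : exists lam,
  enorm (grad (obj pb) y + J^T *m lam) ^+ 2
    <= 2 * ((L * enorm s) ^+ 2 + enorm e ^+ 2).
Proof.
have [lam hl] := prox_stationary; exists lam.
have -> : grad (obj pb) y + J^T *m lam = - (e + L *: s).
  have -> : J^T *m lam = - (g + L *: s).
    by apply/eqP; rewrite -addr_eq0 addrC hl.
  by clearbody s; rewrite /e !opprD opprK addrA [grad _ _ + _]addrC.
rewrite enormN; have := enormD e (L *: s).
rewrite enormZ ger0_norm ?(ltW Lrho_gt0) // => h.
have := enorm_ge0 (e + L *: s); have := enorm_ge0 e; have := enorm_ge0 s.
have := Lrho_gt0; rewrite -/L.
set A := enorm (e + _) in h *; set B := enorm e in h *; set S := enorm s in h *.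
move=> L0 S0 B0 A0.
have := sqr_ge0 (L * S - B).
have : A ^+ 2 <= (B + L * S) ^+ 2 by rewrite ler_sqr // nnegrE addr_ge0 ?mulr_ge0 ?(ltW L0).
by lra.
Qed.

(** Optimality tested at t = 0 and the descent inequalities for f and c, the latter with weight rho,
    give L/2 |s|^2 <= Phi(y) - Phi(u) + |e| |s|; the quadratic terms combine because L = Lg + rho
    LJ. After multiplication by L, the product L |e| |s| is absorbed by |e|^2 + L^2 |s|^2/4. *)
Lemma prox_descent :
  (L * enorm s) ^+ 2 <= 4 * L * (Phi pb rho y - Phi pb rho u) + 4 * enorm e ^+ 2.
Proof.
have Lp : 0 < L := Lrho_gt0.
case: as1 => [C1f C1c _ [Lg0 LJ0] [Lf Lc]].
have := prox_convex 0; rewrite /lin mulmx0 addr0 dotp0r sub0r dotpNr -enorm_sqr.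
have uE : u = y + s by rewrite /s addrC subrK.
have := descent (proj1 C1f) Lf y s; rewrite ler_norml -uE => /andP[_ hf].
have := vector_descent (fun i => proj1 (C1c i)) Lc y s; rewrite -uE => hc.
have hc' : enorm (con pb u) <= enorm (c + J *m s) + LJ pb / 2 * enorm s ^+ 2.
  have -> : con pb u = (c + J *m s) + (con pb u - con pb y - Jac (con pb) y *m s).
    rewrite -/c -/J; move: (J *m s) => w.
    by apply/matrixP => i j; rewrite !mxE; ring.
  by apply: le_trans (enormD _ _) _; rewrite lerD2l.
have {}hc' := ler_wpM2l (ltW rho0) hc'.
have he : dotp e s = dotp g s - dotp (grad (obj pb) y) s by rewrite /e dotpBl.
have hcs := dotp_geN e s; have hsq := sqr_ge0 (enorm e - L / 2 * enorm s).
have hL : L = Lg pb + rho * LJ pb by [].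
move=> h0.
have : L * (L * enorm s ^+ 2) <= 4 * L * (Phi pb rho y - Phi pb rho u) + 4 * enorm e ^+ 2.
  have : L * (L / 2 * enorm s ^+ 2 - (Phi pb rho y - Phi pb rho u)) <= L * (enorm e * enorm s).
    rewrite ler_pM2l // /Phi -/c.
    have : L / 2 * enorm s ^+ 2 = Lg pb / 2 * enorm s ^+ 2 + rho * (LJ pb / 2 * enorm s ^+ 2).
      by rewrite hL; field.
    by lra.
  by move: hsq; lra.
by lra.
Qed.

Lemma theta_le x b : (forall t, enorm t <= 1 ->
    enorm (con pb x) - enorm (con pb x + Jac (con pb) x *m t) <= b) ->
  theta pb x <= b.
Proof.
move=> h; rewrite /theta lerBlDr -lerBlDl; apply: lb_le_inf.
  by exists (enorm (con pb x + Jac (con pb) x *m 0)), 0 => //; rewrite /unit_ball/= enorm0.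
by move=> _ [t ht <-]; have := h t ht; lra.
Qed.

(** Optimality compares s with an arbitrary t of the unit ball. The gradient against t costs kg,
    against s it costs kg |s|, and passing from c to c + J s costs rho kJ |s|; the last two fit into
    C L |s| because rho LJ <= L and Lg <= L. The noise costs 2|e|, the proximal term L |s|. *)
Lemma prox_theta (kg kJ C : R) : kJ / LJ pb + kg / Lg pb <= C -> 0 <= kg ->
  enorm (grad (obj pb) y) <= kg -> opnorm J <= kJ ->
  theta pb y <= kg / rho + C * (L * enorm s) / rho
    + Num.min kJ ((2 * enorm e + L * enorm s) / rho).
Proof.
move=> hC kg0 hg hJ; apply: theta_le => t ht; rewrite -/c -/J.
have Lp : 0 < L := Lrho_gt0; have s0 := enorm_ge0 s; have e0 := enorm_ge0 e.
have kJ0 : 0 <= kJ := le_trans (opnorm_ge0 _) hJ.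
case: as1 => [_ _ _ [Lg0 LJ0] _].
have hkg : 0 <= kg / Lg pb by rewrite divr_ge0 // ltW.
have hkJ : 0 <= kJ / LJ pb by rewrite divr_ge0 // ltW.
have C0 : 0 <= C by apply: le_trans hC; rewrite addr_ge0.
have kgr0 : 0 <= kg / rho by rewrite divr_ge0 // ltW.
have CS0 : 0 <= C * (L * enorm s) / rho.
  by rewrite divr_ge0 ?mulr_ge0 // ltW.
have Jt (v : 'cV[R]_n) : enorm (J *m v) <= kJ * enorm v.
  by apply: le_trans (opnorm_mulmx _ _) _; rewrite ler_wpM2r ?enorm_ge0.
have triv : enorm c - enorm (c + J *m t) <= kJ.
  have := enorm_distr c (c + J *m t); rewrite opprD addrA subrr add0r enormN => h.
  by apply: le_trans h _; apply: le_trans (Jt t) _; rewrite ler_piMr.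
have LLJ : rho * LJ pb <= L by rewrite /L /Lrho lerDr ltW.
have LLg : Lg pb <= L by rewrite /L /Lrho lerDl mulr_ge0 // ltW.
(* For a step longer than 1 the term e.s is no longer bounded by |e|; but then C L |s|/rho already
   reaches kJ, which bounds the decrease trivially. *)
have [s1|s1] := leP (enorm s) 1; last first.
  apply: le_trans triv _; rewrite -[X in X <= _]addr0; apply: lerD; last first.
    by rewrite le_min kJ0 divr_ge0 ?addr_ge0 ?mulr_ge0 // ltW.
  apply: (le_trans (y := C * (L * enorm s) / rho)); last by rewrite lerDr.
  rewrite ler_pdivlMr //.
  apply: (le_trans (y := C * (rho * LJ pb))).
    apply: (le_trans (y := kJ / LJ pb * (rho * LJ pb))).
      by rewrite le_eqVlt; apply/orP; left; apply/eqP; field; rewrite gt_eqF.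
    by rewrite ler_wpM2r ?mulr_ge0 ?(ltW rho0) ?(ltW LJ0) //; lra.
  by rewrite ler_wpM2l //; apply: le_trans LLJ _; rewrite ler_pMr // ltW.
rewrite -lerBlDl le_min; apply/andP; split; first by lra.
rewrite lerBlDl -!mulrDl ler_pdivlMr // mulrC.
have := prox_convex t; rewrite /lin (dotpBr t s s) => hcv.
have hgt : dotp g t - dotp g s + L * (dotp s t - dotp s s) =
   dotp (grad (obj pb) y) t - dotp (grad (obj pb) y) s + dotp e t - dotp e s
   + L * dotp s t - L * enorm s ^+ 2.
  by clearbody s; rewrite enorm_sqr /e !dotpBl; ring.
have h1 : dotp (grad (obj pb) y) t <= kg.
  apply: le_trans (dotp_le _ _) _; apply: le_trans (ler_pM _ _ hg ht) _; rewrite ?enorm_ge0 ?mulr1 //.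
have h2 : - dotp (grad (obj pb) y) s <= kg * enorm s.
  by have := dotp_geN (grad (obj pb) y) s; have := ler_wpM2r s0 hg; lra.
have h3 : dotp e t <= enorm e.
  by apply: le_trans (dotp_le _ _) _; rewrite ler_piMr.
have h4 : - dotp e s <= enorm e.
  by have := dotp_geN e s; have := ler_piMr e0 s1; lra.
have h5 : L * dotp s t <= L * enorm s.
  by rewrite ler_pM2l //; apply: le_trans (dotp_le _ _) _; rewrite ler_piMr.
have h6 : enorm c <= enorm (c + J *m s) + kJ * enorm s.
  have := enorm_distr c (c + J *m s); rewrite opprD addrA subrr add0r enormN => h.
  by have := Jt s; lra.
have {}h6 := ler_wpM2l (ltW rho0) h6.
have h7 : 0 <= L * enorm s ^+ 2 by rewrite mulr_ge0 ?sqr_ge0 ?ltW.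
have h8 : rho * kJ * enorm s + kg * enorm s <= C * (L * enorm s).
  rewrite -mulrDl mulrA ler_wpM2r //.
  apply: (le_trans (y := (kJ / LJ pb + kg / Lg pb) * L)); last by rewrite ler_wpM2r // ltW.
  rewrite mulrDl; apply: lerD.
    rewrite mulrAC -mulrA; rewrite [rho * _]mulrC ler_wpM2l // ler_pdivlMr //.
  by rewrite mulrAC -mulrA ler_peMr // ler_pdivlMr // mul1r.
by lra.
Qed.

End ProxStep.

(** * Gaussian moments *)

Section Density.
Local Open Scope ereal_scope.
Context d (T : measurableType d) (R : realType).
Variables (mu nu : {measure set T -> \bar R}) (phi : T -> R).
Hypothesis phi_ge0 : forall x, (0 <= phi x)%R.
Hypothesis mphi : measurable_fun setT phi.
Hypothesis nuE : forall A, measurable A -> nu A = \int[mu]_(x in A) (phi x)%:E.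

Import HBNNSimple.

Let density_nnsfun (f : {nnsfun T >-> R}) :
  \int[nu]_x (f x)%:E = \int[mu]_x ((f x)%:E * (phi x)%:E).
Proof.
under [LHS]eq_integral do rewrite fimfunE -fsumEFin//.
rewrite [LHS]ge0_integral_fsum//; last 2 first.
  - by move=> r; exact/measurable_EFinP/measurableT_comp.
  - by move=> n x _; rewrite EFinM nnfun_muleindic_ge0.
under [RHS]eq_integral.
  move=> x xD; rewrite fimfunE -fsumEFin// muleC ge0_mule_fsumr; last first.
    by move=> r; rewrite EFinM nnfun_muleindic_ge0.
  over.
rewrite [RHS]ge0_integral_fsum//; last 2 first.
  - move=> r; apply: emeasurable_funM; first exact/measurable_EFinP.
    by apply/measurable_EFinP/measurableT_comp.
  - by move=> n x _; apply: mule_ge0; [rewrite lee_fin|rewrite EFinM nnfun_muleindic_ge0].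
apply: eq_fsbigr => r _.
have mA : measurable (f @^-1` [set r]) by exact: measurable_funPTI.
under [RHS]eq_integral do rewrite muleC EFinM -muleA.
under [LHS]eq_integral do rewrite EFinM.
have [r0|r0] := leP 0%R r; last first.
  by rewrite preimage_nnfun0 // [LHS]integral0_eq ?[RHS]integral0_eq // => x _;
    rewrite indic0 ?mul0e mule0.
rewrite [RHS]ge0_integralZl//=; last 2 first.
  - apply: emeasurable_funM; first exact/measurable_EFinP/measurable_indic.
    exact/measurable_EFinP.
  - by move=> x _; rewrite mule_ge0 ?lee_fin.
rewrite [LHS]ge0_integralZl//=; last exact/measurable_EFinP/measurable_indic.
congr (_ * _); rewrite integral_indic// setIT nuE// integral_mkcond.
apply: eq_integral => x _; rewrite patchE indicE.
by case: ifP => xA; rewrite ?mul1e ?mul0e.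
Qed.

(** Besides the Gaussian law, this serves for P restricted to the event R = j, whose density on a
    smaller sigma-algebra is the conditional probability of that event. *)
Lemma ge0_integral_density (f : T -> \bar R) :
  measurable_fun setT f -> (forall x, 0 <= f x) ->
  \int[nu]_x f x = \int[mu]_x (f x * (phi x)%:E).
Proof.
move=> mf f0; pose f_ := nnsfun_approx measurableT mf.
transitivity (lim (\int[nu]_x (f_ n x)%:E @[n --> \oo])).
  rewrite -monotone_convergence//=.
  - apply: eq_integral => x _; apply/esym/cvg_lim => //=.
    exact: cvg_nnsfun_approx.
  - by move=> n; exact/measurable_EFinP/measurable_funTS.
  - by move=> n ? _; rewrite lee_fin.
  - by move=> ? _ ? ? mn; rewrite lee_fin; exact/lefP/nd_nnsfun_approx.
transitivity (lim (\int[mu]_x ((f_ n x)%:E * (phi x)%:E) @[n --> \oo])).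
  by apply: congr_lim; apply/funext => n /=; exact: density_nnsfun.
rewrite -monotone_convergence//=.
- apply: eq_integral => x _; apply/cvg_lim => //=.
  apply: cvgeZr => //; exact: cvg_nnsfun_approx.
- move=> n; apply: emeasurable_funM; exact/measurable_EFinP/measurable_funTS.
- by move=> n x _; rewrite mule_ge0 ?lee_fin.
- move=> x _ a b ab; rewrite lee_wpmul2r ?lee_fin //.
  exact/lefP/nd_nnsfun_approx.
Qed.

End Density.

Section GaussianMoments.
Variable R : realType.
Local Notation pdf := (@normal_pdf R 0 1).
Local Notation leb := (@lebesgue_measure R).

Let pdfE x : pdf x = normal_peak 1 * expR (- (x ^+ 2) / 2).
Proof.
rewrite normal_pdfE ?oner_eq0 // /normal_fun subr0 expr1n.
by congr (_ * expR (_ / _)).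
Qed.

Let is_derive_pdf (x : R) : is_derive x (1 : R) (fun x => - pdf x) (x * pdf x).
Proof.
rewrite (_ : (fun x => - pdf x) = fun x => - (normal_peak 1 * expR (- (x ^+ 2) / 2))).
  apply: is_derive_eq.
  by rewrite pdfE -![_ *: _]/(_ * _); field.
by apply/funext => z; rewrite pdfE.
Qed.

Let pdf_even x : pdf (- x) = pdf x.
Proof. by rewrite !pdfE sqrrN. Qed.

Let cont_pow_pdf k : continuous (fun x : R => x ^+ k * pdf x).
Proof.
move=> x; apply: cvgM; first exact: exprn_continuous.
by apply: continuous_normal_pdf; rewrite oner_eq0.
Qed.

(* The moments satisfy M_{k+2} = (k+1) M_k: integration by parts on [0, b] and
   b --> +oo; the boundary term is only needed to vanish for k = 0, since it has
   the right sign for upper bounds. *)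
Let itvM k (b : R) := (\int[leb]_(x in `[0%R, b]) (x ^+ k * pdf x)%:E)%E.

Let itvM_rec k (b : R) : 0 < b ->
  (itvM k.+2 b = (- (b ^+ k.+1 * pdf b))%:E + (k.+1%:R)%:E * itvM k b)%E.
Proof.
move=> b0; rewrite /itvM.
have dX (x : R) : is_derive x (1 : R) (fun x : R => x ^+ k.+1) (k.+1%:R * x ^+ k).
  rewrite (_ : (fun x => _) = (@id R) ^+ k.+1); last first.
    by apply/funext => z; rewrite exprfctE.
  by apply: is_derive_eq; rewrite -![_ *: _]/(_ * _) mulr1.
have loo (F : R -> R) dF : (forall x : R, is_derive x (1 : R) F (dF x)) ->
    derivable_oo_LRcontinuous F 0 b.
  move=> dF'; have cF : continuous F.
    by move=> x; apply: differentiable_continuous; apply/derivable1_diffP; have [] := dF' x.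
  split; first by move=> x _; have [] := dF' x.
    by apply: cvg_at_right_filter; exact: cF.
  by apply: cvg_at_left_filter; exact: cF.
have := @integration_by_parts R (fun x => x ^+ k.+1) (fun x => - pdf x)
  (fun x => k.+1%:R * x ^+ k) (fun x => x * pdf x) 0 b b0.
have c1 : continuous (fun x : R => k.+1%:R * x ^+ k).
  by move=> x; apply: cvgM; [exact: cvg_cst|exact: exprn_continuous].
have c2 : continuous (fun x : R => x * pdf x).
  by move=> x; apply: cvgM; [exact: cvg_id|apply: continuous_normal_pdf; rewrite oner_eq0].
move=> /(_ (continuous_subspaceT c1) (loo _ _ dX)).
move=> /(_ _ (continuous_subspaceT c2) (loo _ _ is_derive_pdf)).
have e1 : {in `]0, b[, (fun x : R => x ^+ k.+1)^`()%classic =1 (fun x => k.+1%:R * x ^+ k)}.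
  by move=> x _; rewrite derive1E; exact: derive_val.
have e2 : {in `]0, b[, (fun x : R => - pdf x)^`()%classic =1 (fun x => x * pdf x)}.
  by move=> x _; rewrite derive1E; have := is_derive_pdf x => ?; exact: derive_val.
move=> /(_ e1 e2); rewrite expr0n mul0r subr0 => h.
transitivity (\int[leb]_(x in `[0%R, b]) ((x ^+ k.+1 * (x * pdf x))%:E))%E.
  by apply: eq_integral => x _; rewrite [x ^+ k.+2]exprSr mulrA.
rewrite h mulrN; congr (_ + _)%E.
have -> : (\int[leb]_(x in `[0%R, b]) (k.+1%:R * x ^+ k * - pdf x)%:E =
   \int[leb]_(x in `[0%R, b]) ((- k.+1%:R)%:E * (x ^+ k * pdf x)%:E))%E.
  by apply: eq_integral => x _; rewrite -EFinM; congr (_%:E); ring.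
rewrite integralZl //; last first.
  apply: continuous_compact_integrable; first exact: segment_compact.
  exact: continuous_subspaceT.
by rewrite EFinN mulNe oppeK.
Qed.

Let halfM k := (\int[leb]_(x in `[0%R, +oo[) (x ^+ k * pdf x)%:E)%E.

Let pow_pdf_ge0 k x : ~~ odd k -> 0 <= x ^+ k * pdf x.
Proof. by move=> k2; rewrite mulr_ge0 ?normal_pdf_ge0 ?exprn_even_ge0. Qed.

Let m_pow_pdf k : measurable_fun setT (fun x : R => x ^+ k * pdf x).
Proof. by apply: continuous_measurable_fun; exact: cont_pow_pdf. Qed.

Let cvg_itvM k : ~~ odd k -> itvM k n%:R @[n --> \oo] --> halfM k.
Proof. by move=> k2; apply: ge0_cvgn_integral => // x; exact: pow_pdf_ge0. Qed.

Let itvM_le k n : ~~ odd k -> (itvM k n%:R <= halfM k)%E.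
Proof.
move=> k2; apply: ge0_subset_integral => //.
- by apply/measurable_EFinP; apply: measurable_funTS; exact: m_pow_pdf.
- by move=> x _; rewrite lee_fin pow_pdf_ge0.
- by move=> x /=; rewrite !in_itv/= => /andP[->].
Qed.

Let halfM_le k : ~~ odd k -> (halfM k.+2 <= (k.+1%:R)%:E * halfM k)%E.
Proof.
move=> k2; have k2' : ~~ odd k.+2 by rewrite /= negbK.
rewrite -(cvg_lim _ (cvg_itvM k2')) //; apply: lime_le.
  by apply/cvg_ex; exists (halfM k.+2); exact: cvg_itvM.
near=> n.
have n0 : (0 : R) < n%:R by rewrite ltr0n; near: n; exact: nbhs_infty_gt.
rewrite itvM_rec //; apply: (@le_trans _ _ (0 + (k.+1%:R)%:E * itvM k n%:R)%E).
  by apply: leeD2r; rewrite lee_fin oppr_le0 mulr_ge0 ?normal_pdf_ge0 ?exprn_ge0.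
by rewrite add0e lee_wpmul2l ?lee_fin // itvM_le.
Unshelve. all: by end_near. Qed.

Let fullM k : ~~ odd k ->
  (\int[leb]_x (x ^+ k * pdf x)%:E = 2%:E * halfM k)%E.
Proof.
move=> k2; rewrite ge0_symfun_integralT //.
- congr (_ * _)%E; rewrite /halfM; congr (integral _ _ _).
  by apply/seteqP; split => x /=; rewrite in_itv/= andbT.
- by move=> x; exact: pow_pdf_ge0.
- move=> x /=; rewrite pdf_even exprNn -signr_odd (negbTE k2) expr0 mul1r //.
Qed.

Let halfM0 : halfM 0 = (2^-1)%:E.
Proof.
have := @integral_normal_pdf R 0 1.
rewrite (_ : (\int[_]_x _)%E = (\int[leb]_x (x ^+ 0 * pdf x)%:E)%E); last first.
  by apply: eq_integral => x _; rewrite expr0 mul1r.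
rewrite fullM //; case: (halfM 0) => [r| |] //=.
  by rewrite -EFinM => -[h]; congr (_%:E); lra.
by rewrite mulry gtr0_sg // mul1e.
by rewrite mulrNy gtr0_sg // mul1e.
Qed.

(** Equality is required here, since E[v^2] = 1 is what makes the directional estimator unbiased. So
    the boundary term b pdf(b) is shown to vanish at infinity. *)
Let halfM2 : halfM 2 = (2^-1)%:E.
Proof.
have h : itvM 2 n%:R @[n --> \oo] --> (2^-1)%:E.
  have c0 : ((- (n%:R ^+ 1 * pdf n%:R))%:E + (1%:R)%:E * itvM 0 n%:R)%E @[n --> \oo]
      --> (0%:E + (1%:R)%:E * (2^-1)%:E)%E.
    apply: cvgeD => //.
      apply: cvg_EFin; first by near=> n.
      rewrite -[X in _ --> X]oppr0; apply: cvgN.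
      apply: (@squeeze_cvgr _ _ _ _ (fun=> 0) (fun n => normal_peak 1 * 2 * n.-1.+1%:R^-1)).
      - near=> n; rewrite expr1 mulr_ge0 ?normal_pdf_ge0 //=.
        have n0 : (0 < n)%N by near: n; exact: nbhs_infty_gt.
        rewrite prednK // pdfE mulrCA -mulrA ler_wpM2l ?normal_peak_ge0 //.
        have np : (0 : R) < n%:R by rewrite ltr0n.
        rewrite mulNr expRN ler_pdivrMr ?expR_gt0 // mulrAC ler_pdivlMr //.
        (* exp(x) >= 1 + x at x = n^2/2 turns the Gaussian tail into n exp(-n^2/2) <= 2/n. *)
        have := @expR_ge1Dx R (n%:R ^+ 2 / 2); lra.
      - exact: cvg_cst.
      - rewrite -[X in _ --> X](mulr0 (normal_peak 1 * 2)).
        apply: cvgM; first exact: cvg_cst.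
        rewrite -cvg_shiftS /=.
        exact: cvg_harmonic.
    by apply: cvgeZl => //; rewrite -halfM0; exact: cvg_itvM.
  rewrite add0e mul1e in c0.
  apply: cvg_trans c0; apply: near_eq_cvg; near=> n.
  have n0 : (0 : R) < n%:R by rewrite ltr0n; near: n; exact: nbhs_infty_gt.
  by rewrite -itvM_rec.
by rewrite -(cvg_lim _ h) // -(cvg_lim _ (cvg_itvM (erefl : ~~ odd 2))).
Unshelve. all: by end_near. Qed.

Let normal_powE k : ~~ odd k ->
  (\int[normal_prob (0 : R) 1]_x (x ^+ k)%:E = 2%:E * halfM k)%E.
Proof.
move=> k2; rewrite -fullM //.
rewrite (@ge0_integral_density _ _ _ leb (normal_prob (0 : R) 1) pdf) //.
- exact: normal_pdf_ge0.
- exact: measurable_normal_pdf.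
- by apply/measurable_EFinP; exact: measurable_funX.
- by move=> x; rewrite lee_fin exprn_even_ge0.
Qed.

Lemma normal_moment2 : (\int[normal_prob (0 : R) 1]_x (x ^+ 2)%:E = 1)%E.
Proof. by rewrite normal_powE // halfM2 -EFinM divff. Qed.

Lemma normal_moment4 : (\int[normal_prob (0 : R) 1]_x (x ^+ 4)%:E <= 3%:E)%E.
Proof.
rewrite normal_powE //; apply: le_trans (lee_wpmul2l _ (halfM_le (k := 2) _)) _ => //.
by rewrite halfM2 -!EFinM lee_fin; lra.
Qed.

Lemma normal_moment6 : (\int[normal_prob (0 : R) 1]_x (x ^+ 6)%:E <= 15%:E)%E.
Proof.
rewrite normal_powE //; apply: le_trans (lee_wpmul2l _ (halfM_le (k := 4) _)) _ => //.
rewrite muleA; apply: le_trans (lee_wpmul2l _ (halfM_le (k := 2) _)) _ => //.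
by rewrite halfM2 -!EFinM lee_fin; lra.
Qed.

Let integral_oppr (g : R -> \bar R) : measurable_fun setT g -> (forall x, 0 <= g x)%E ->
  (\int[leb]_x g (- x)%R = \int[leb]_x g x)%E.
Proof.
move=> mg g0.
have e : [set: R] = (-%R : _ -> measurableTypeR R) @^-1` setT by rewrite preimage_setT.
rewrite [in LHS]e -ge0_integral_pushforward //=.
by apply: eq_measure_integral => //= A mA _; exact: lebesgue_measureN.
Qed.

(** The negative part at x is the positive part at -x, and both have the same integral because the
    density is even. That integral is finite, as max(x, 0) <= 1 + x^2, so the difference is 0. *)
Lemma normal_mean : (\int[normal_prob (0 : R) 1]_x (x%:E) = 0)%E.
Proof.
pose g (x : R) := maxe x%:E 0%E.
have mg : measurable_fun setT g by apply: measurable_maxe.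
have g0 x : (0 <= g x)%E by rewrite le_max lexx orbT.
have dens (h : R -> \bar R) : measurable_fun setT h -> (forall x, 0 <= h x)%E ->
    (\int[normal_prob (0 : R) 1]_x h x = \int[leb]_x (h x * (pdf x)%:E))%E.
  move=> mh h0; apply: ge0_integral_density => //.
  - exact: normal_pdf_ge0.
  - exact: measurable_normal_pdf.
rewrite integralE.
have -> : ((@EFin R)^\+)%E = g by apply/funext => x; rewrite funepos.unlock.
have -> : ((@EFin R)^\-)%E = (fun x => g (- x)) by apply/funext => x; rewrite funeneg.unlock.
have mgN : measurable_fun setT (fun x : R => g (- x)%R).
  by apply: (measurableT_comp mg); exact: measurable_funN.
have fin : (\int[normal_prob (0 : R) 1]_x g x \is a fin_num)%E.
  rewrite ge0_fin_numE ?integral_ge0 //.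
  apply: (@le_lt_trans _ _ (\int[normal_prob (0 : R) 1]_x (1 + x ^+ 2)%:E)%E).
    apply: ge0_le_integral => //.
      by apply/measurable_EFinP; apply: measurable_funD.
    move=> x _; rewrite /g ge_max !lee_fin; apply/andP; split; last by nra.
    by nra.
  under eq_integral do rewrite EFinD.
  rewrite ge0_integralD //; last 2 first.
    by move=> x _; rewrite lee_fin sqr_ge0.
    by apply/measurable_EFinP; exact: measurable_funX.
  rewrite normal_moment2 [X in (X + _)%E](_ : _ = 1%E) ?ltry //.
  by rewrite integral_cst // mul1e; exact: probability_setT.
have e : (\int[normal_prob (0 : R) 1]_x (fun x : R => g (- x)%R) x
     = \int[normal_prob (0 : R) 1]_x g x)%E; last by rewrite e subee.
have g0N (x : R) : (0 <= g (- x)%R)%E := g0 _.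
rewrite (dens _ mgN g0N) (dens _ mg g0).
have := @integral_oppr (fun x => g x * (pdf x)%:E)%E; move=> <-.
- by apply: eq_integral => x _; rewrite pdf_even.
- apply: emeasurable_funM => //; apply/measurable_EFinP; exact: measurable_normal_pdf.
- by move=> x; rewrite mule_ge0 // lee_fin normal_pdf_ge0.
Qed.

End GaussianMoments.

(** * Independence *)

Section Independence.
Context d (T : measurableType d) (R : realType) (P : probability T R).
Local Open Scope ereal_scope.
Implicit Types (F G : set (set T)).

Definition indep F G := forall A B, F A -> G B -> P (A `&` B) = P A * P B.

Lemma indepC F G : indep F G -> indep G F.
Proof. by move=> h A B GA FB; rewrite setIC h // muleC. Qed.

Lemma sigma_sub_measurable F : F `<=` measurable -> <<s F >> `<=` measurable.
Proof.
by move=> Fm; apply: smallest_sub => //; exact: sigma_algebra_measurable.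
Qed.

(** For fixed B both sides are finite measures of A that agree on the pi-system F, hence on the
    sigma-algebra it generates. *)
Lemma indep_sigma F G : F `<=` measurable -> setI_closed F -> F setT ->
  G `<=` measurable -> indep F G -> indep <<s F >> G.
Proof.
move=> Fm FI FT Gm h A B FA GB; have mB := Gm _ GB.
have pB : P B \is a fin_num by exact: fin_num_measure.
have pB0 : (0 <= fine (P B))%R by rewrite fine_ge0.
pose m1 := mrestr P mB.
pose m2 := mscale (NngNum pB0) P.
have m2E C : m2 C = P B * P C by rewrite -[in RHS](fineK pB).
have : m1 A = m2 A.
  apply: (@g_sigma_algebra_measure_unique _ R T F Fm (fun=> setT)) => //.
  - by rewrite bigcup_const //; exists 0%N.
  - by move=> C FC; rewrite [RHS]m2E muleC -h.
  - move=> _; change (P (setT `&` B) < +oo).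
    by rewrite setTI -ge0_fin_numE.
by rewrite m2E muleC.
Qed.

Lemma indep_sigma2 F G : F `<=` measurable -> setI_closed F -> F setT ->
  G `<=` measurable -> setI_closed G -> G setT ->
  indep F G -> indep <<s F >> <<s G >>.
Proof.
move=> Fm FI FT Gm GI GT h.
apply: indep_sigma => //; first exact: sigma_sub_measurable.
by apply: indepC; apply: indep_sigma => //; exact: indepC.
Qed.

Section decoupling.
Variables F G : set (set T).
Hypotheses (Fm : F `<=` measurable) (Gm : G `<=` measurable).
Hypothesis FG : indep <<s F >> <<s G >>.
Let TF := g_sigma_algebraType F.
Let TG := g_sigma_algebraType G.

Lemma measurable_id_sub F' : F' `<=` measurable ->
  measurable_fun setT (id : T -> g_sigma_algebraType F').
Proof.
by move=> Fm' _ B mB; rewrite setTI preimage_id; exact: sigma_sub_measurable mB.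
Qed.

Let idF : T -> TF := id.
Let idG : T -> TG := id.
Let midF : measurable_fun setT idF := measurable_id_sub Fm.
Let midG : measurable_fun setT idG := measurable_id_sub Gm.
Let diag (w : T) : TF * TG := (idF w, idG w).
Let mdiag : measurable_fun setT diag.
Proof. exact: measurable_fun_pair. Qed.

HB.instance Definition _ := isMeasurableFun.Build _ _ _ _ idF midF.
HB.instance Definition _ := isMeasurableFun.Build _ _ _ _ idG midG.
HB.instance Definition _ := isMeasurableFun.Build _ _ _ _ diag mdiag.

Let PF : probability TF R := distribution P idF.
Let PG : probability TG R := distribution P idG.

Let product_law X : measurable X -> (PF \x PG) X = pushforward P diag X.
Proof.
apply: product_measure_unique => A B mA mB.
by rewrite /pushforward /PF /PG /distribution /= /pushforward -FG.
Qed.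

(** The form in which conditioning on the past is used. Seen as a map into T with the two coarser
    sigma-algebras, the diagonal has the product law by independence, and Tonelli freezes the
    argument that belongs to F. *)
Lemma ge0_decoupling (h : TF * TG -> \bar R) : measurable_fun setT h ->
  (forall z, 0 <= h z) -> \int[P]_w h (w, w) = \int[P]_w \int[P]_w' h (w, w').
Proof.
move=> mh h0.
transitivity (\int[pushforward P diag]_z h z).
  by rewrite ge0_integral_pushforward // preimage_setT.
transitivity (\int[PF \x PG]_z h z).
  by apply: eq_measure_integral => A mA _; exact/esym/product_law.
rewrite fubini_tonelli1 // ge0_integral_pushforward //; last 2 first.
  exact: measurable_fun_fubini_tonelli_F.
  by move=> x _; apply: integral_ge0 => y _; exact: h0.
rewrite preimage_setT; apply: eq_integral => w _ /=.
rewrite /fubini_F ge0_integral_pushforward ?preimage_setT //.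
exact: measurableT_comp.
Qed.

Lemma measurable_decoupled (h : TF * TG -> \bar R) : measurable_fun setT h ->
  (forall z, 0 <= h z) -> measurable_fun setT (fun w : T => \int[P]_w' h (w, w')).
Proof.
move=> mh h0; have := @measurable_fun_fubini_tonelli_F _ _ TF TG R PG h mh h0.
move=> mF; have := measurableT_comp mF midF.
apply: eq_measurable_fun => w _ /=.
rewrite /fubini_F ge0_integral_pushforward ?preimage_setT //.
exact: measurableT_comp.
Qed.

End decoupling.

End Independence.

Lemma mem_bigsetI (T : Type) (I : eqType) (s : seq I) (A : I -> set T) x :
  (\big[setI/setT]_(i <- s) A i) x <-> forall i, i \in s -> A i x.
Proof.
elim: s => [|a s IH]; first by rewrite big_nil.
rewrite big_cons; split=> [[ax sx] i|h].
  by rewrite inE => /orP[/eqP -> //|]; move: i; apply/IH.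
split; first by apply: h; rewrite mem_head.
by apply/IH => i hi; apply: h; rewrite inE hi orbT.
Qed.

Section Groups.
Context d (T : measurableType d) (R : realType) (P : probability T R).
Local Open Scope ereal_scope.
Variables (I : eqType) (S : I -> set (set T)).
Hypothesis Sm : forall i, S i `<=` measurable.
Hypothesis SI : forall i, setI_closed (S i).
Hypothesis ST : forall i, S i setT.
Hypothesis ind : mutually_independent P S.
Implicit Types J K : set I.

Definition gens J : set (set T) := [set X | exists2 i, J i & S i X].

Let pisys J : set (set T) := [set X | exists s, exists2 A : I -> set T,
  uniq s /\ (forall i, i \in s -> J i /\ S i (A i)) &
  X = \big[setI/setT]_(i <- s) A i].

Let gens_pisys J : gens J `<=` pisys J.
Proof.
move=> X [i Ji SX]; exists [:: i], (fun=> X); last by rewrite big_seq1.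
by split => // j; rewrite inE => /eqP ->.
Qed.

Lemma gens_measurable J : gens J `<=` measurable.
Proof. by move=> X [i _ /Sm]. Qed.

Let pisys_measurable J : pisys J `<=` measurable.
Proof.
move=> X [s [A [_ h] ->]]; rewrite big_seq; apply: bigsetI_measurable => i /h[_].
exact: Sm.
Qed.

Let pisysT J : pisys J setT.
Proof. by exists [::], (fun=> setT); rewrite ?big_nil. Qed.

Let pisysI J : setI_closed (pisys J).
Proof.
move=> _ _ [s1 [A1 [u1 h1] ->]] [s2 [A2 [u2 h2] ->]].
pose A i := (if i \in s1 then A1 i else setT) `&` (if i \in s2 then A2 i else setT).
exists (undup (s1 ++ s2)), A.
  split; first exact: undup_uniq.
  move=> i; rewrite mem_undup mem_cat => hi; split.
    by case/orP: hi => [/h1[]|/h2[]].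
  by apply: SI; case: ifP => [hs|_] //; [case: (h1 i hs)|case: (h2 i hs)].
apply/seteqP; split => x.
  move=> [/mem_bigsetI x1 /mem_bigsetI x2]; apply/mem_bigsetI => i _; rewrite /A; split.
    by case: ifP => // i1; exact: x1.
  by case: ifP => // i2; exact: x2.
move=> /mem_bigsetI h; split; apply/mem_bigsetI => i hi; have := h i;
  by rewrite mem_undup mem_cat hi ?orbT => /(_ isT)[]; rewrite hi.
Qed.

(** Finite intersections of sample events form pi-systems. Two of them over disjoint index sets
    concatenate into one over distinct indices, to which mutual independence applies. *)
Lemma indep_gens J K : J `&` K = set0 -> indep P <<s gens J >> <<s gens K >>.
Proof.
move=> JK; have sub L : <<s gens L >> `<=` <<s pisys L >>.
  by apply: sub_sigma_algebra2; exact: gens_pisys.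
suff h : indep P <<s pisys J >> <<s pisys K >> by move=> A B /sub ? /sub ?; exact: h.
apply: indep_sigma2 => //.
move=> _ _ [s1 [A1 [u1 h1] ->]] [s2 [A2 [u2 h2] ->]].
pose A i := if i \in s1 then A1 i else A2 i.
have dis i : i \in s2 -> (i \in s1) = false.
  move=> /h2[Ki _]; apply/negP => /h1[Ji _].
  by suff : (J `&` K) i by rewrite JK.
have e1 : \big[setI/setT]_(i <- s1) A1 i = \big[setI/setT]_(i <- s1) A i.
  by apply: eq_big_seq => i hi; rewrite /A hi.
have e2 : \big[setI/setT]_(i <- s2) A2 i = \big[setI/setT]_(i <- s2) A i.
  by apply: eq_big_seq => i hi; rewrite /A dis.
have hA1 i : i \in s1 -> S i (A i) by move=> hi; rewrite /A hi; case: (h1 i hi).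
have hA2 i : i \in s2 -> S i (A i) by move=> hi; rewrite /A dis //; case: (h2 i hi).
rewrite e1 e2 -big_cat /= !ind // ?big_cat //.
  rewrite cat_uniq u1 u2 andbT /=; apply/hasPn => i hi; apply/negbT; exact: dis.
by move=> i; rewrite mem_cat => /orP[/hA1|/hA2].
Qed.

End Groups.

(** * Expectations of products of independent variables *)

Section ProductExpectation.
Context d (T : measurableType d) (R : realType) (P : probability T R).
Variables F G : set (set T).
Hypotheses (Fm : F `<=` measurable) (Gm : G `<=` measurable).
Hypothesis FG : indep P <<s F >> <<s G >>.
Local Notation TF := (g_sigma_algebraType F).
Local Notation TG := (g_sigma_algebraType G).

Lemma sub_measurable_fun F' d' (U : measurableType d') (X : T -> U) :
  F' `<=` measurable ->
  measurable_fun (setT : set (g_sigma_algebraType F')) X -> measurable_fun setT X.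
Proof.
by move=> Fm' mX; exact: (measurableT_comp mX (measurable_id_sub Fm')).
Qed.

Let ge0_indepM (X Y : T -> R) : measurable_fun (setT : set TF) X ->
  measurable_fun (setT : set TG) Y -> (forall w, 0 <= X w) -> (forall w, 0 <= Y w) ->
  (\int[P]_w (X w * Y w)%:E = \int[P]_w (X w)%:E * \int[P]_w (Y w)%:E)%E.
Proof.
move=> mX mY X0 Y0.
have mX' := sub_measurable_fun Fm mX; have mY' := sub_measurable_fun Gm mY.
have := @ge0_decoupling _ T R P F G Fm Gm FG (fun z => (X z.1 * Y z.2)%:E).
move=> /= ->; last 2 first.
- apply/measurable_EFinP; apply: measurable_funM.
    exact: (measurableT_comp mX (measurable_fst)).
  exact: (measurableT_comp mY (measurable_snd)).
- by move=> z; rewrite lee_fin mulr_ge0.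
under eq_integral.
  move=> w _; under eq_integral do rewrite EFinM.
  rewrite ge0_integralZl ?lee_fin //; [|exact/measurable_EFinP|by move=> x _; rewrite lee_fin].
  over.
rewrite ge0_integralZr //; first exact/measurable_EFinP.
  by move=> x _; rewrite lee_fin.
by apply: integral_ge0 => x _; rewrite lee_fin.
Qed.

Lemma indep_integrableM (X Y : T -> R) : measurable_fun (setT : set TF) X ->
  measurable_fun (setT : set TG) Y ->
  P.-integrable setT (EFin \o X) -> P.-integrable setT (EFin \o Y) ->
  P.-integrable setT (EFin \o (fun w => X w * Y w)).
Proof.
move=> mX mY iX iY; apply/integrableP; split.
  apply/measurable_EFinP; apply: measurable_funM.
    exact: sub_measurable_fun mX.
  exact: sub_measurable_fun mY.
have [_ fX] := integrableP _ _ _ iX; have [_ fY] := integrableP _ _ _ iY.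
rewrite (eq_integral (fun w => (`|X w| * `|Y w|)%:E)); last first.
  by move=> w _ /=; rewrite normrM.
rewrite ge0_indepM //; last 2 first.
- exact: measurableT_comp.
- exact: measurableT_comp.
by rewrite lte_mul_pinfty ?integral_ge0 // ge0_fin_numE // integral_ge0.
Qed.

(** Extension of the nonnegative case by positive and negative parts: expanding the product gives
    four terms, each a product of nonnegative integrable variables. *)
Lemma indep_RintegralM (X Y : T -> R) : measurable_fun (setT : set TF) X ->
  measurable_fun (setT : set TG) Y ->
  P.-integrable setT (EFin \o X) -> P.-integrable setT (EFin \o Y) ->
  \int[P]_w (X w * Y w) = (\int[P]_w X w) * \int[P]_w Y w.
Proof.
move=> mX mY iX iY.
pose p (Z : T -> R) w := (`|Z w| + Z w) / 2; pose m (Z : T -> R) w := (`|Z w| - Z w) / 2.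
have pm Z w : Z w = p Z w - m Z w by rewrite /p /m; field.
have p0 Z w : 0 <= p Z w by rewrite /p; have := ler_norm (- Z w); rewrite normrN; lra.
have m0 Z w : 0 <= m Z w by rewrite /m; have := ler_norm (Z w); lra.
have mp F' (Z : T -> R) : measurable_fun (setT : set (g_sigma_algebraType F')) Z ->
   measurable_fun (setT : set (g_sigma_algebraType F')) (p Z).
  move=> mZ; apply: measurable_funM => //; apply: measurable_funD => //.
  exact: measurableT_comp.
have mm F' (Z : T -> R) : measurable_fun (setT : set (g_sigma_algebraType F')) Z ->
   measurable_fun (setT : set (g_sigma_algebraType F')) (m Z).
  move=> mZ; apply: measurable_funM => //; apply: measurable_funB => //.
  exact: measurableT_comp.
have ip Z : P.-integrable setT (EFin \o Z) -> P.-integrable setT (EFin \o p Z).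
  move=> iZ; apply: (eq_integrable measurableT (fun w => (2^-1)%:E * ((`|Z w|)%:E + (Z w)%:E))%E).
    by move=> w _; rewrite -EFinD -EFinM /= mulrC.
  by apply: integrableZl => //; apply: integrableD => //; exact: integrable_norm.
have im Z : P.-integrable setT (EFin \o Z) -> P.-integrable setT (EFin \o m Z).
  move=> iZ; apply: (eq_integrable measurableT (fun w => (2^-1)%:E * ((`|Z w|)%:E - (Z w)%:E))%E).
    by move=> w _; rewrite -EFinB -EFinM /= mulrC.
  by apply: integrableZl => //; apply: integrableB => //; exact: integrable_norm.
have M (X' Y' : T -> R) : measurable_fun (setT : set TF) X' -> measurable_fun (setT : set TG) Y' ->
    (forall w, 0 <= X' w) -> (forall w, 0 <= Y' w) ->
    P.-integrable setT (EFin \o X') -> P.-integrable setT (EFin \o Y') ->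
    \int[P]_w (X' w * Y' w) = (\int[P]_w X' w) * \int[P]_w Y' w.
  move=> h1 h2 h3 h4 h5 h6; rewrite /Rintegral ge0_indepM // fineM //; exact: integrable_fin_num.
have iM X' Y' := @indep_integrableM X' Y'.
transitivity (\int[P]_w ((p X w * p Y w + m X w * m Y w) - (p X w * m Y w + m X w * p Y w))).
  by apply: eq_Rintegral => w _; rewrite {1}(pm X) {1}(pm Y); ring.
rewrite RintegralB //; last 2 first.
- by apply: (integrableD measurableT (f := EFin \o _) (g := EFin \o _)); apply: iM; auto.
- by apply: (integrableD measurableT (f := EFin \o _) (g := EFin \o _)); apply: iM; auto.
rewrite !RintegralD //; [|by apply: iM; auto..].
rewrite (M (p X) (p Y)) ?(M (m X) (m Y)) ?(M (p X) (m Y)) ?(M (m X) (p Y)); try solve [auto].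
have eX : \int[P]_w X w = \int[P]_w p X w - \int[P]_w m X w.
  by rewrite -RintegralB //; auto; apply: eq_Rintegral => w _; exact: pm.
have eY : \int[P]_w Y w = \int[P]_w p Y w - \int[P]_w m Y w.
  by rewrite -RintegralB //; auto; apply: eq_Rintegral => w _; exact: pm.
by rewrite eX eY; ring.
Qed.

End ProductExpectation.

(** * Second moment of the gradient estimator *)

Section RealExpectation.
Context d (T : measurableType d) (R : realType) (P : probability T R).

Definition rint (X : T -> R) := P.-integrable setT (EFin \o X).

Lemma rint_measurable X : rint X -> measurable_fun setT X.
Proof. by move=> /(measurable_int P) /measurable_EFinP. Qed.

Lemma rint_le (X Y : T -> R) : measurable_fun setT X -> rint Y ->
  (forall w, `|X w| <= Y w) -> rint X.
Proof.
move=> mX iY h; apply: le_integrable iY => //; first exact/measurable_EFinP.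
by move=> w _ /=; rewrite lee_fin (le_trans (h w)) ?ler_norm.
Qed.

Lemma rint_cst (c : R) : rint (fun=> c).
Proof. exact: finite_measure_integrable_cst. Qed.

Lemma rintD X Y : rint X -> rint Y -> rint (fun w => X w + Y w).
Proof. by move=> iX iY; apply: (integrableD measurableT iX iY). Qed.

Lemma rintB X Y : rint X -> rint Y -> rint (fun w => X w - Y w).
Proof. by move=> iX iY; apply: (integrableB measurableT iX iY). Qed.

Lemma rintZ c X : rint X -> rint (fun w => c * X w).
Proof. by move=> iX; apply: (integrableZl measurableT c iX). Qed.

Lemma rint_sum (I : Type) (s : seq I) (X : I -> T -> R) :
  (forall i, rint (X i)) -> rint (fun w => \sum_(i <- s) X i w).
Proof.
move=> iX; elim: s => [|a s IH].
  by rewrite (_ : (fun w => _) = fun=> 0) ?[X in rint X](_ : _ = fun=> 0);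
    [exact: rint_cst|apply/funext => w; rewrite big_nil].
rewrite (_ : (fun w => _) = fun w => X a w + \sum_(i <- s) X i w); first exact: rintD.
by apply/funext => w; rewrite big_cons.
Qed.

Lemma Rintegral_sum (I : Type) (s : seq I) (X : I -> T -> R) :
  (forall i, rint (X i)) ->
  \int[P]_w (\sum_(i <- s) X i w) = \sum_(i <- s) \int[P]_w X i w.
Proof.
move=> iX; elim: s => [|a s IH].
  by under eq_Rintegral do rewrite big_nil; rewrite Rintegral_cst // mul0r big_nil.
rewrite big_cons -IH -RintegralD //; [|exact: iX|exact: rint_sum].
by apply: eq_Rintegral => w _; rewrite big_cons.
Qed.

Lemma Rintegral_prob_cst (c : R) : \int[P]_w c = c.
Proof. by rewrite Rintegral_cst //= [X in fine X](@probability_setT _ _ _ P) mulr1. Qed.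

Lemma rint_ge0_fin (X : T -> R) c : measurable_fun setT X -> (forall w, 0 <= X w) ->
  (\int[P]_w (X w)%:E <= c%:E)%E -> rint X.
Proof.
move=> mX X0 h; apply/integrableP; split; first exact/measurable_EFinP.
apply: le_lt_trans (ltry c); apply: le_trans h; rewrite le_eqVlt; apply/orP; left.
by apply/eqP; apply: eq_integral => w _ /=; rewrite ger0_norm.
Qed.

Lemma EFin_Rintegral (X : T -> R) : rint X ->
  (\int[P]_w X w)%:E = (\int[P]_w (X w)%:E)%E.
Proof. by move=> iX; rewrite /Rintegral fineK //; exact: integrable_fin_num. Qed.

End RealExpectation.

Section SubMeasurable.
Context d (T : measurableType d) (R : realType) (P : probability T R).
Variables (I : eqType) (S : I -> set (set T)).
Hypothesis Sm : forall i, S i `<=` measurable.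
Hypothesis SI : forall i, setI_closed (S i).
Hypothesis ST : forall i, S i setT.
Hypothesis ind : mutually_independent P S.

(** The bookkeeping through which independence is invoked: a variable is labelled by the samples it
    may depend on, and disjoint labels make expectations multiply. *)
Definition meas (J : set I) (X : T -> R) :=
  measurable_fun (setT : set (g_sigma_algebraType (gens S J))) X.

Lemma measW J K X : J `<=` K -> meas J X -> meas K X.
Proof.
move=> JK mX _ B mB; have := mX measurableT B mB.
by apply: sub_sigma_algebra2 => A [i /JK Ki SA]; exists i.
Qed.

Lemma meas_measurable J X : meas J X -> measurable_fun setT X.
Proof. by apply: sub_measurable_fun; exact: gens_measurable. Qed.

Lemma meas1 i X : (forall B, measurable B -> S i (X @^-1` B)) -> meas [set i] X.
Proof.
move=> h _ B mB; rewrite setTI; apply: sub_gen_smallest.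
by exists i => //; exact: h.
Qed.

Lemma meas_RintegralM J K X Y : J `&` K = set0 -> meas J X -> meas K Y ->
  rint P X -> rint P Y -> \int[P]_w (X w * Y w) = \int[P]_w X w * \int[P]_w Y w.
Proof.
move=> JK mX mY iX iY.
apply: (@indep_RintegralM _ T R P (gens S J) (gens S K)) => //.
- exact: gens_measurable.
- exact: gens_measurable.
- exact: indep_gens.
Qed.

Lemma meas_integrableM J K X Y : J `&` K = set0 -> meas J X -> meas K Y ->
  rint P X -> rint P Y -> rint P (fun w => X w * Y w).
Proof.
move=> JK mX mY iX iY.
apply: (@indep_integrableM _ T R P (gens S J) (gens S K)) => //.
- exact: gens_measurable.
- exact: gens_measurable.
- exact: indep_gens.
Qed.

Section one_sample.
Variables (n : nat) (ix : I) (iv : 'I_n -> I).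
Hypothesis iv_inj : injective iv.
Hypothesis ix_iv : forall l, ix != iv l.
Variables (v : 'I_n -> T -> R) (g : 'I_n -> T -> R) (c : 'I_n -> R).
Hypothesis mv : forall l, meas [set iv l] (v l).
Hypothesis mg : forall l, meas [set ix] (g l).
Hypothesis v1 : forall l, \int[P]_w v l w = 0.
Hypothesis v2 : forall l, \int[P]_w (v l w ^+ 2) = 1.
Hypothesis v4 : forall l, \int[P]_w (v l w ^+ 4) <= 3.
Hypothesis iv4 : forall l, rint P (fun w => v l w ^+ 4).
Hypothesis g1 : forall l, \int[P]_w g l w = c l.
Hypothesis ig2 : forall l, rint P (fun w => g l w ^+ 2).

Let mv' l : measurable_fun setT (v l). Proof. by apply: meas_measurable; exact: mv. Qed.
Let mg' l : measurable_fun setT (g l). Proof. by apply: meas_measurable; exact: mg. Qed.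

Let iv1 l : rint P (v l).
Proof.
apply: (@rint_le _ _ _ _ _ (fun w => 1 + v l w ^+ 4)) => //.
  by apply: rintD => //; exact: rint_cst.
move=> w; have := sqr_ge0 (v l w ^+ 2 - 1/2).
have := sqr_ge0 (v l w - 1/2); have := sqr_ge0 (v l w + 1/2).
by move=> ? ? ?; rewrite ler_norml; apply/andP; split; lra.
Qed.

Let iv2 l p : rint P (fun w => v l w * v p w).
Proof.
apply: (@rint_le _ _ _ _ _ (fun w => 1 + v l w ^+ 4 + v p w ^+ 4)).
- exact: measurable_funM.
- by apply: rintD => //; apply: rintD => //; exact: rint_cst.
- move=> w; have := sqr_ge0 (v l w ^+ 2 - 1/2); have := sqr_ge0 (v p w ^+ 2 - 1/2).
  have := sqr_ge0 (v l w - v p w); have := sqr_ge0 (v l w + v p w).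
  by move=> ? ? ? ?; rewrite ler_norml; apply/andP; split; lra.
Qed.

Let iv22 l p q : rint P (fun w => v l w ^+ 2 * (v p w * v q w)).
Proof.
apply: (@rint_le _ _ _ _ _ (fun w => v l w ^+ 4 + v p w ^+ 4 + v q w ^+ 4)).
- by apply: measurable_funM; [exact: measurable_funX|exact: measurable_funM].
- by do !apply: rintD.
- move=> w; rewrite normrM (ger0_norm (sqr_ge0 _)).
  have h : `|v p w * v q w| <= (v p w ^+ 2 + v q w ^+ 2) / 2.
    have := sqr_ge0 (v p w - v q w); have := sqr_ge0 (v p w + v q w).
    by move=> ? ?; rewrite ler_norml; apply/andP; split; lra.
  apply: le_trans (ler_wpM2l (sqr_ge0 _) h) _.
  have := sqr_ge0 (v l w ^+ 2 - v p w ^+ 2).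
  have := sqr_ge0 (v l w ^+ 2 - v q w ^+ 2); have := sqr_ge0 (v l w ^+ 2).
  have := sqr_ge0 (v p w ^+ 2); have := sqr_ge0 (v q w ^+ 2); lra.
Qed.

Let ig l p : rint P (fun w => g l w * g p w).
Proof.
apply: (@rint_le _ _ _ _ _ (fun w => g l w ^+ 2 + g p w ^+ 2)).
- exact: measurable_funM.
- exact: rintD.
- move=> w; have := sqr_ge0 (g l w - g p w); have := sqr_ge0 (g l w + g p w).
  have := sqr_ge0 (g l w); have := sqr_ge0 (g p w).
  by move=> ? ? ? ?; rewrite ler_norml; apply/andP; split; lra.
Qed.

Let ig1 l : rint P (g l).
Proof.
apply: (@rint_le _ _ _ _ _ (fun w => 1 + g l w ^+ 2)) => //.
  by apply: rintD => //; exact: rint_cst.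
by move=> w; rewrite ler_norml; apply/andP; split; nra.
Qed.

Let Vs : set I := [set iv l | l in setT].
Let Js : set I := [set i | i = ix \/ Vs i].

Let mvV l : meas Vs (v l).
Proof. by apply: (measW _ (@mv l)) => _ ->; exists l. Qed.

Let Vsix : Vs `&` [set ix] = set0.
Proof.
apply/seteqP; split => // i [[l _ <-]] /= h.
by have := ix_iv l; rewrite h eqxx.
Qed.

Let disj l p : l != p -> [set iv l] `&` [set iv p] = set0.
Proof.
move=> lp; apply/seteqP; split => // i [/= ->] /iv_inj h.
by rewrite h eqxx in lp.
Qed.

Let Evv l p : \int[P]_w (v l w * v p w) = (l == p)%:R.
Proof.
have [->|lp] := eqVneq l p.
  by rewrite -[RHS](v2 p); apply: eq_Rintegral => w _; rewrite expr2.
by rewrite (meas_RintegralM (disj lp) (@mv l) (@mv p)) // v1 mul0r.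
Qed.

(** At least one of p, q differs from both other indices; its factor is independent of the rest and
    centred. *)
Let Ev4_ne l p q : p != q -> \int[P]_w (v l w ^+ 2 * (v p w * v q w)) = 0.
Proof.
have split p' q' : l != p' -> p' != q' ->
    \int[P]_w (v l w ^+ 2 * (v p' w * v q' w)) = 0.
  move=> lp pq.
  rewrite (_ : (fun w => _) = fun w => v p' w * (v l w ^+ 2 * v q' w)); last first.
    by apply/funext => w; ring.
  rewrite (@meas_RintegralM [set iv p'] [set i | i = iv l \/ i = iv q']) ?v1 ?mul0r //.
  - apply/seteqP; split => // i [/= -> []] /iv_inj h.
      by rewrite h eqxx in lp.
    by rewrite h eqxx in pq.
  - apply: measurable_funM; last by apply: (measW _ (@mv q')) => i ->; right.
    by apply: measurable_funX; apply: (measW _ (@mv l)) => i ->; left.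
  - apply: (@rint_le _ _ _ _ _ (fun w => 1 + v l w ^+ 2 * (v q' w * v q' w) + v l w * v l w)).
    + by apply: measurable_funM => //; exact: measurable_funX.
    + apply: rintD; last exact: iv2.
      by apply: rintD; [exact: rint_cst|exact: iv22].
    + move=> w; rewrite normrM (ger0_norm (sqr_ge0 _)).
      have : `|v q' w| <= v q' w * v q' w + 1.
        by rewrite ler_norml; apply/andP; split; nra.
      move=> /(ler_wpM2l (sqr_ge0 (v l w))); lra.
move=> pq; have [lp|lp] := eqVneq l p; last exact: split.
rewrite (_ : (fun w => _) = fun w => v l w ^+ 2 * (v q w * v p w)); last first.
  by apply/funext => w; rewrite (mulrC (v q w)).
by rewrite split // ?lp // eq_sym.
Qed.

Let Ev4_eq l p : \int[P]_w (v l w ^+ 2 * (v p w * v p w)) <= 3.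
Proof.
have [lp|lp] := eqVneq l p.
  rewrite (_ : (fun w => _) = fun w => v l w ^+ 4) //.
  by apply/funext => w; rewrite -lp; ring.
rewrite (@meas_RintegralM [set iv l] [set iv p]) ?disj //.
- by rewrite v2 Evv eqxx mulr1; lra.
- by apply: measurable_funX; exact: mv.
- by apply: measurable_funM; exact: mv.
- exact: iv2.
Qed.

(* Coordinate l of (v^T g) v - c, the noise of a directional-derivative estimator
   of c = E[g]. *)
Definition smp (l : 'I_n) w := \sum_p (v p w * v l w * g p w) - c l.

Let mVg l p q : meas [set ix] (fun w => g p w * g q w) /\
  meas Vs (fun w => v l w ^+ 2 * (v p w * v q w)).
Proof.
split; first by apply: measurable_funM; exact: mg.
apply: measurable_funM; first by apply: measurable_funX; exact: mvV.
by apply: measurable_funM; exact: mvV.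
Qed.

Let i4 l p q : rint P (fun w => v l w ^+ 2 * (v p w * v q w) * (g p w * g q w)).
Proof. by have [h1 h2] := mVg l p q; exact: meas_integrableM Vsix h2 h1 _ _. Qed.

Let i2 l p : rint P (fun w => v p w * v l w * g p w).
Proof.
apply: (@meas_integrableM Vs [set ix] (fun w => v p w * v l w) (g p)) => //.
by apply: measurable_funM; exact: mvV.
Qed.

Lemma smp_meas l : meas Js (smp l).
Proof.
apply: measurable_funB => //; apply: measurable_sum => p.
apply: measurable_funM; last by apply: (measW _ (@mg p)) => i ->; left.
by apply: measurable_funM; apply: (measW _ (@mvV _)) => i; right.
Qed.

Lemma smp_rint l : rint P (smp l).
Proof. by apply: rintB; [apply: rint_sum => p; exact: i2|exact: rint_cst]. Qed.

Lemma smp_mean l : \int[P]_w smp l w = 0.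
Proof.
rewrite RintegralB //; last 2 first.
- by apply: (@rint_sum _ _ _ P) => p; exact: i2.
- exact: rint_cst.
rewrite Rintegral_prob_cst Rintegral_sum; last by move=> p; exact: i2.
rewrite (bigD1 l) //= big1 ?addr0.
  rewrite (@meas_RintegralM Vs [set ix]) //; last by apply: measurable_funM; exact: mvV.
  by rewrite Evv eqxx mul1r g1 subrr.
move=> p pl; rewrite (@meas_RintegralM Vs [set ix]) //; last by apply: measurable_funM; exact: mvV.
by rewrite Evv (negbTE pl) mul0r.
Qed.

Let sqE l w : (\sum_p (v p w * v l w * g p w)) ^+ 2 =
  \sum_p \sum_q (v l w ^+ 2 * (v p w * v q w) * (g p w * g q w)).
Proof.
rewrite expr2 mulr_suml; apply: eq_bigr => p _; rewrite mulr_sumr.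
by apply: eq_bigr => q _; ring.
Qed.

Lemma smp_sq_rint l : rint P (fun w => smp l w ^+ 2).
Proof.
apply: (@rint_le _ _ _ _ _ (fun w =>
   2 * \sum_p \sum_q (v l w ^+ 2 * (v p w * v q w) * (g p w * g q w)) + 2 * c l ^+ 2)).
- by apply: measurable_funX; by apply: meas_measurable; exact: smp_meas.
- apply: rintD; last exact: rint_cst.
  by apply: rintZ; do 2 apply: rint_sum => ?; exact: i4.
- move=> w; rewrite ger0_norm ?sqr_ge0 // -sqE /smp.
  by set a := \sum_p _; have := sqr_ge0 (a + c l); lra.
Qed.

(** Centring only lowers the second moment, so c drops out. In the double sum over p and q the
    Gaussian factor is independent of g; the terms with distinct p and q vanish, and the others have
    weight E[v_l^2 v_p^2], at most the bound 3 on the fourth moment. *)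
Lemma smp_second_moment l :
  \int[P]_w (smp l w ^+ 2) <= 3 * \sum_p \int[P]_w (g p w ^+ 2).
Proof.
have E w : smp l w ^+ 2 = (\sum_p \sum_q (v l w ^+ 2 * (v p w * v q w) * (g p w * g q w)))
    - (2 * c l * smp l w + c l ^+ 2).
  by rewrite -sqE /smp; ring.
have iS : rint P (fun w => \sum_p \sum_q (v l w ^+ 2 * (v p w * v q w) * (g p w * g q w))).
  by do 2 apply: rint_sum => ?; exact: i4.
have iL : rint P (fun w => 2 * c l * smp l w).
  by apply: rintZ; exact: smp_rint.
rewrite (_ : (fun w => _) = fun w => (\sum_p \sum_q (v l w ^+ 2 * (v p w * v q w)
    * (g p w * g q w))) - (2 * c l * smp l w + c l ^+ 2)); last exact/funext/E.
rewrite RintegralB //; last by apply: rintD => //; exact: rint_cst.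
rewrite RintegralD //; last exact: rint_cst.
rewrite RintegralZl //; last exact: smp_rint.
rewrite smp_mean mulr0 add0r Rintegral_prob_cst.
apply: le_trans (_ : _ <= \int[P]_w (\sum_p \sum_q (v l w ^+ 2 * (v p w * v q w)
    * (g p w * g q w)))) _; first by have := sqr_ge0 (c l); lra.
rewrite Rintegral_sum; last by move=> p; apply: rint_sum => q; exact: i4.
rewrite mulr_sumr; apply: ler_sum => p _.
rewrite Rintegral_sum; last by move=> q; exact: i4.
rewrite (bigD1 p) //= big1 ?addr0; last first.
  move=> q qp; have [h1 h2] := mVg l p q.
  rewrite (meas_RintegralM Vsix h2 h1) //.
  by rewrite Ev4_ne ?mul0r // eq_sym.
have [h1 h2] := mVg l p p.
rewrite (meas_RintegralM Vsix h2 h1) //.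
rewrite [X in _ * X <= _](_ : _ = \int[P]_w (g p w ^+ 2)); last first.
  by apply: eq_Rintegral => w _; rewrite expr2.
apply: ler_wpM2r; first by apply: Rintegral_ge0 => w _; exact: sqr_ge0.
exact: Ev4_eq.
Qed.

End one_sample.
End SubMeasurable.

Section Batch.
Context d (T : measurableType d) (R : realType) (P : probability T R).
Variables (I : eqType) (S : I -> set (set T)).
Hypothesis Sm : forall i, S i `<=` measurable.
Hypothesis SI : forall i, setI_closed (S i).
Hypothesis ST : forall i, S i setT.
Hypothesis ind : mutually_independent P S.
Variables (n : nat) (ix : nat -> I) (iv : nat -> 'I_n -> I).
Hypothesis ix_inj : injective ix.
Hypothesis iv_inj : forall i j l p, iv i l = iv j p -> i = j /\ l = p.
Hypothesis ix_iv : forall i j l, ix i != iv j l.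
Variables (v g : nat -> 'I_n -> T -> R) (c : 'I_n -> R) (B : R).
Hypothesis mv : forall i l, meas S [set iv i l] (v i l).
Hypothesis mg : forall i l, meas S [set ix i] (g i l).
Hypothesis v1 : forall i l, \int[P]_w v i l w = 0.
Hypothesis v2 : forall i l, \int[P]_w (v i l w ^+ 2) = 1.
Hypothesis v4 : forall i l, \int[P]_w (v i l w ^+ 4) <= 3.
Hypothesis iv4 : forall i l, rint P (fun w => v i l w ^+ 4).
Hypothesis g1 : forall i l, \int[P]_w g i l w = c l.
Hypothesis ig2 : forall i l, rint P (fun w => g i l w ^+ 2).
Hypothesis g2 : forall i, \sum_l \int[P]_w (g i l w ^+ 2) <= B.

Let a i := smp (v i) (g i) c.
Let ivi i : injective (iv i). Proof. by move=> l p /iv_inj[]. Qed.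

Let a_meas i := smp_meas c (@mv i) (@mg i).
Let a_rint i := smp_rint Sm SI ST ind (ix_iv i i) c (@mv i) (@mg i) (@iv4 i) (@ig2 i).
Let a_mean i := smp_mean Sm SI ST ind (@ivi i) (@ix_iv i i) (@mv i) (@mg i)
  (@v1 i) (@v2 i) (@iv4 i) (@g1 i) (@ig2 i).
Let a2_rint i := smp_sq_rint Sm SI ST ind (@ix_iv i i) c (@mv i) (@mg i)
  (@iv4 i) (@ig2 i).
Let a2_le i := smp_second_moment Sm SI ST ind (@ivi i) (@ix_iv i i) (@mv i) (@mg i)
  (@v1 i) (@v2 i) (@v4 i) (@iv4 i) (@g1 i) (@ig2 i).

Let a_meas' i l : measurable_fun setT (a i l).
Proof. by apply: (meas_measurable Sm); exact: a_meas. Qed.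

Let aa_rint i j l : rint P (fun w => a i l w * a j l w).
Proof.
apply: (@rint_le _ _ _ _ _ (fun w => a i l w ^+ 2 + a j l w ^+ 2)).
- exact: measurable_funM.
- by apply: rintD; exact: a2_rint.
- move=> w; have := sqr_ge0 (a i l w - a j l w); have := sqr_ge0 (a i l w + a j l w).
  have := sqr_ge0 (a i l w); have := sqr_ge0 (a j l w).
  by move=> ? ? ? ?; rewrite ler_norml; apply/andP; split; lra.
Qed.

Let aa_orth i j l : i != j -> \int[P]_w (a i l w * a j l w) = 0.
Proof.
move=> ij; rewrite (@meas_RintegralM _ _ _ P I S Sm SI ST ind
  [set x | x = ix i \/ range (iv i) x] [set x | x = ix j \/ range (iv j) x]) //.
- by rewrite a_mean mul0r.
- apply/seteqP; split => // x [/= [->|[l1 _ <-]] [|[l2 _]]].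
  + by move=> /ix_inj h; rewrite h eqxx in ij.
  + by move=> h; have := ix_iv i j l2; rewrite -h eqxx.
  + by move=> h; have := ix_iv j i l1; rewrite h eqxx.
  + by move=> /iv_inj[h _]; rewrite h eqxx in ij.
- exact: a_meas.
- exact: a_meas.
- exact: a_rint.
- exact: a_rint.
Qed.

Let sqE m l w : (\sum_(i < m) a i l w) ^+ 2 =
  \sum_(i < m) \sum_(j < m) (a i l w * a j l w).
Proof.
by rewrite expr2 mulr_suml; apply: eq_bigr => i _; rewrite mulr_sumr.
Qed.

Lemma batch_rint m : rint P (fun w => \sum_l (m%:R^-1 * \sum_(i < m) a i l w) ^+ 2).
Proof.
apply: rint_sum => l.
rewrite (_ : (fun w => _) = fun w => m%:R^-1 ^+ 2 *
   \sum_(i < m) \sum_(j < m) (a i l w * a j l w)).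
  by apply: rintZ; do 2 apply: rint_sum => ?; exact: aa_rint.
by apply/funext => w; rewrite exprMn sqE.
Qed.

(** Distinct samples of the batch involve disjoint families of indices, so the cross terms vanish
    and averaging divides by m; each of the n coordinates contributes 3 B. *)
Lemma batch_variance m : (0 < m)%N ->
  \int[P]_w (\sum_l (m%:R^-1 * \sum_(i < m) a i l w) ^+ 2) <= 3 * n%:R * B / m%:R.
Proof.
move=> m0; have mp : (0 : R) < m%:R by rewrite ltr0n.
have isum l : rint P (fun w => \sum_(i < m) \sum_(j < m) (a i l w * a j l w)).
  by do 2 apply: rint_sum => ?; exact: aa_rint.
rewrite (_ : (fun w => _) = fun w => \sum_l (m%:R^-1 ^+ 2 *
   \sum_(i < m) \sum_(j < m) (a i l w * a j l w))); last first.
  by apply/funext => w; apply: eq_bigr => l _; rewrite exprMn sqE.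
rewrite Rintegral_sum; last by move=> l; exact: rintZ.
apply: (@le_trans _ _ (\sum_(l < n) (3 * B / m%:R))); last first.
  rewrite sumr_const card_ord -mulr_natl le_eqVlt; apply/orP; left; apply/eqP; ring.
apply: ler_sum => l _; rewrite RintegralZl //; last exact: isum.
rewrite Rintegral_sum; last by move=> i; apply: rint_sum => j; exact: aa_rint.
apply: (@le_trans _ _ (m%:R^-1 ^+ 2 * \sum_(i < m) (3 * B))); last first.
  rewrite sumr_const card_ord -mulr_natl le_eqVlt; apply/orP; left; apply/eqP.
  by field; rewrite gt_eqF.
rewrite ler_wpM2l ?sqr_ge0 //; apply: ler_sum => i _.
rewrite Rintegral_sum; last by move=> j; exact: aa_rint.
rewrite (bigD1 i) //= big1 ?addr0; last first.
  by move=> j ji; rewrite aa_orth // eq_sym.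
rewrite (_ : (fun w => _) = fun w => a i l w ^+ 2); last first.
  by apply/funext => w; rewrite expr2.
by apply: le_trans (a2_le i l) _; rewrite ler_wpM2l.
Qed.

End Batch.

Section SixthMoment.
Context d (T : measurableType d) (R : realType) (P : probability T R).
Variables (n : nat) (v : 'I_n -> T -> R).
Hypothesis mv : forall l, measurable_fun setT (v l).
Hypothesis v6 : forall l, (\int[P]_w (v l w ^+ 6)%:E <= 15%:E)%E.

Let pow_sum (x : 'I_n -> R) : (forall l, 0 <= x l) ->
  (\sum_l x l) ^+ 3 <= n%:R ^+ 2 * \sum_l x l ^+ 3.
Proof.
move=> x0.
have -> : (\sum_l x l) ^+ 3 = \sum_l \sum_p \sum_q (x l * x p * x q).
  rewrite exprS mulr_suml; apply: eq_bigr => l _; rewrite expr2 mulr_suml mulr_sumr.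
  apply: eq_bigr => p _; rewrite mulr_sumr mulr_sumr.
  by apply: eq_bigr => q _; rewrite mulrA.
(* The inequality of arithmetic and geometric means for three numbers: a^3 + b^3 + c^3 - 3 a b c is
   half the product displayed below. *)
have h l p q : x l * x p * x q <= (x l ^+ 3 + x p ^+ 3 + x q ^+ 3) / 3.
  have := x0 l; have := x0 p; have := x0 q.
  move: (x l) (x p) (x q) => a b c c0 b0 a0.
  have : 0 <= (a + b + c) * ((a - b) ^+ 2 + (b - c) ^+ 2 + (a - c) ^+ 2).
    by rewrite mulr_ge0 ?addr_ge0 ?sqr_ge0.
  lra.
apply: (@le_trans _ _ (\sum_l \sum_p \sum_q ((x l ^+ 3 + x p ^+ 3 + x q ^+ 3) / 3))).
  by apply: ler_sum => l _; apply: ler_sum => p _; apply: ler_sum => q _; exact: h.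
set s := \sum_l x l ^+ 3.
have -> : \sum_l \sum_p \sum_q ((x l ^+ 3 + x p ^+ 3 + x q ^+ 3) / 3)
   = \sum_(l < n) \sum_(p < n) (n%:R * ((x l ^+ 3 + x p ^+ 3) / 3) + s / 3).
  apply: eq_bigr => l _; apply: eq_bigr => p _.
  under eq_bigr do rewrite mulrDl.
  by rewrite big_split /= sumr_const card_ord mulr_natl -mulr_suml.
have -> : \sum_(l < n) \sum_(p < n) (n%:R * ((x l ^+ 3 + x p ^+ 3) / 3) + s / 3)
   = \sum_(l < n) (n%:R ^+ 2 * (x l ^+ 3 / 3) + n%:R * (2 * s / 3)).
  apply: eq_bigr => l _; rewrite big_split /= sumr_const card_ord -mulr_natl -mulr_sumr.
  under eq_bigr do rewrite mulrDl.
  by rewrite big_split /= sumr_const card_ord -mulr_natl -mulr_suml -/s; ring.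
rewrite big_split /= sumr_const card_ord -mulr_natl -mulr_sumr -mulr_suml -/s.
by rewrite le_eqVlt; apply/orP; left; apply/eqP; field.
Qed.

Lemma norm6_le w : (\sum_l v l w ^+ 2) ^+ 3 <= n%:R ^+ 2 * \sum_l v l w ^+ 6.
Proof.
apply: le_trans (pow_sum (fun l => sqr_ge0 (v l w))) _.
by rewrite ler_wpM2l ?sqr_ge0 // ler_sum // => l _; rewrite -exprM.
Qed.

Let m6 l : measurable_fun setT (fun w => v l w ^+ 6). Proof. exact: measurable_funX. Qed.
Let p6 l w : 0 <= v l w ^+ 6. Proof. by rewrite exprn_even_ge0. Qed.
Let i6 l : rint P (fun w => v l w ^+ 6). Proof. exact: (rint_ge0_fin (m6 l) (p6 l) (v6 l)). Qed.

Lemma norm6_rint : rint P (fun w => (\sum_l v l w ^+ 2) ^+ 3).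
Proof.
apply: (@rint_le _ _ _ _ _ (fun w => n%:R ^+ 2 * \sum_l v l w ^+ 6)).
- apply: measurable_funX; apply: measurable_sum => l; exact: measurable_funX.
- by apply: rintZ; apply: rint_sum.
- move=> w; rewrite ger0_norm ?norm6_le // exprn_ge0 // sumr_ge0 // => l _; exact: sqr_ge0.
Qed.

(** Sixth moments enter because the Taylor remainder is of order mu |v|^2 and multiplies v: the
    squared smoothing bias is of order mu^2 |v|^6. *)
Lemma norm6_moment : \int[P]_w ((\sum_l v l w ^+ 2) ^+ 3) <= 15 * n%:R ^+ 3.
Proof.
apply: (@le_trans _ _ (\int[P]_w (n%:R ^+ 2 * \sum_l v l w ^+ 6))).
  apply: le_Rintegral => //; first exact: norm6_rint.
    by apply: rintZ; apply: rint_sum.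
  by move=> w _; exact: norm6_le.
rewrite RintegralZl //; last by apply: (@rint_sum _ _ _ P).
rewrite Rintegral_sum //.
apply: (@le_trans _ _ (n%:R ^+ 2 * \sum_(l < n) 15)); last first.
  by rewrite sumr_const card_ord -mulr_natl le_eqVlt; apply/orP; left; apply/eqP; ring.
rewrite ler_wpM2l ?sqr_ge0 //; apply: ler_sum => l _.
by rewrite -lee_fin EFin_Rintegral // v6.
Qed.

End SixthMoment.

(** * Measurability of minimizers and of the problem data *)

Section Selection.
Context {R : realType} {d : measure_display} {T : measurableType d}.

(** The least index satisfying a measurable condition is measurable. Combined with [enum_point],
    this selects from a countable dense set. *)
Lemma first_selection (p : nat -> T -> bool) :
  (forall m, measurable [set t | p m t]) -> (forall t, exists m, p m t) ->
  exists2 D : T -> nat, measurable_fun setT D & forall t, p (D t) t.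
Proof.
move=> mp ex; exists (fun t => ex_minn (ex t)); last by move=> t; case: ex_minnP.
have mE m : measurable [set t | ex_minn (ex t) = m].
  rewrite (_ : [set t | _] = [set t | p m t] `&`
    \big[setI/setT]_(k <- iota 0 m) ~` [set t | p k t]).
    apply: measurableI => //; apply: bigsetI_measurable => k _.
    exact: measurableC.
  apply/seteqP; split => t /=.
    case: ex_minnP => k pk kmin <-; split => //; apply/mem_bigsetI => j.
    by rewrite mem_iota /= => jk /kmin; rewrite leqNgt jk.
  case=> pm /mem_bigsetI h; case: ex_minnP => k pk kmin.
  apply/eqP; rewrite eqn_leq kmin // leqNgt; apply/negP => km.
  by apply: (h k) => //; rewrite mem_iota.
move=> _ B _; rewrite setTI.
rewrite (_ : _ @^-1` B = \bigcup_(m in B) [set t | ex_minn (ex t) = m]).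
  exact: bigcup_measurable.
by apply/seteqP; split => [t Bt|t [m Bm /= ->]] //=; exists (ex_minn (ex t)).
Qed.

Lemma measurable_ltr (f g : T -> R) : measurable_fun setT f -> measurable_fun setT g ->
  measurable [set t | f t < g t].
Proof.
move=> mf mg; rewrite -[X in measurable X]setTI.
exact: (measurable_fun_ltr mf mg measurableT (Y := [set true]) _).
Qed.

Lemma measurable_fun_lt (f : T -> R) :
  (forall a, measurable [set t | f t < a]) -> measurable_fun setT f.
Proof.
move=> h; apply: (measurability _ (RGenCInfty.measurableE R)) => //.
move=> _ [_ [a ->] <-]; rewrite setTI.
rewrite (_ : _ @^-1` _ = ~` [set t | f t < a]); first exact: measurableC.
by apply/seteqP; split => t /=; rewrite in_itv/= andbT leNgt => /negP.
Qed.

Definition enum_point p (m : nat) : 'cV[R]_p :=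
  if (unpickle m : option (nat * 'cV[int]_p)) is Some c then grid_point R c.1 c.2 else 0.

Lemma enum_dense p (h : 'cV[R]_p -> R) u b : {for u, continuous h} -> h u < b ->
  exists m, h (enum_point p m) < b.
Proof.
move=> hc /(grid_dense hc)[c hb]; exists (pickle c).
by rewrite /enum_point pickleK.
Qed.

(** f is the infimum of h, hence by continuity its infimum over a countable dense set: f < a is the
    union over m of the events h(q_m) < a. *)
Lemma measurable_dense_min p (h : T -> 'cV[R]_p -> R) (f : T -> R) :
  (forall t, continuous (h t)) -> (forall u, measurable_fun setT (h^~ u)) ->
  (forall t u, f t <= h t u) -> (forall t e, 0 < e -> exists u, h t u < f t + e) ->
  measurable_fun setT f.
Proof.
move=> hc hm fle fex; apply: measurable_fun_lt => a.
rewrite (_ : [set t | _] = \bigcup_m [set t | h t (enum_point p m) < a]).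
  by apply: bigcupT_measurable => m; apply: measurable_ltr.
apply/seteqP; split => t /=.
  move=> fa; have [|u] := fex t (a - f t); first by rewrite subr_gt0.
  by rewrite addrC subrK => /(enum_dense (hc t u))[m hm']; exists m.
by move=> [m _ /=]; apply: le_lt_trans.
Qed.

End Selection.

Section EuclidTopology.
Variable R : realType.

Lemma continuous_sum (X : topologicalType) (I : Type) (s : seq I) (F : I -> X -> R) :
  (forall i, continuous (F i)) -> continuous (fun x => \sum_(i <- s) F i x).
Proof.
move=> h; elim: s => [|a s IH] x.
  rewrite (_ : (fun x => _) = fun=> 0); first exact: cvg_cst.
  by apply/funext => y; rewrite big_nil.
rewrite (_ : (fun x => _) = fun x => F a x + \sum_(i <- s) F i x).
  by apply: cvgD; [exact: h|exact: IH].
by apply/funext => y; rewrite big_cons.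
Qed.

Lemma continuous_dotp n (u : 'cV[R]_n) : continuous (dotp u).
Proof.
apply: continuous_sum => i x.
by apply: continuousM; [exact: cst_continuous|exact: coord_continuous].
Qed.

Lemma continuous_enorm n : continuous (@enorm R n).
Proof.
move=> x; apply: (@continuous_comp _ _ _ (fun w : 'cV[R]_n => \sum_i w i 0 ^+ 2) (@Num.sqrt R)).
  apply: continuous_sum => i z.
  apply: (@continuous_comp _ _ _ (fun w : 'cV[R]_n => w i 0) (fun x : R => x ^+ 2)).
    exact: coord_continuous.
  exact: exprn_continuous.
exact: sqrt_continuous.
Qed.

Lemma continuousB_cst n (y : 'cV[R]_n) : continuous (fun u : 'cV[R]_n => u - y).
Proof. by move=> x; apply: (@continuousB _ _ _ (fun u => u) (fun=> y)); [exact: cvg_id|exact: cst_continuous]. Qed.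

Lemma continuous_affine_norm p n (c : 'cV[R]_p) (A : 'M[R]_(p, n)) :
  continuous (fun s : 'cV[R]_n => enorm (c + A *m s)).
Proof.
move=> x; apply: (@continuous_comp _ _ _
  (fun s : 'cV[R]_n => \sum_i (c + A *m s) i 0 ^+ 2) (@Num.sqrt R)); last exact: sqrt_continuous.
apply: continuous_sum => i z.
apply: (@continuous_comp _ _ _ (fun w : 'cV[R]_n => (c + A *m w) i 0) (fun x : R => x ^+ 2)).
  rewrite (_ : (fun w => _) = fun w => c i 0 + dotp (\col_j A i j) w).
    by apply: continuousD; [exact: cst_continuous|exact: continuous_dotp].
  by apply/funext => w; rewrite mxE coord_mulmx.
exact: exprn_continuous.
Qed.

End EuclidTopology.

Section ProblemMeasurability.
Variables (R : realType) (n q : nat) (dz : measure_display).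
Variables (Z : measurableType dz) (pb : problem R n q Z).
Hypothesis as1 : AS1 pb.
Hypothesis as5 : AS5 pb.

Lemma C1_continuous (f : 'cV[R]_n -> R) : C1 f -> continuous f.
Proof. by move=> [df _] x; exact: differentiable_continuous. Qed.

Lemma C1_grad_continuous (f : 'cV[R]_n -> R) l : C1 f ->
  continuous (fun x => grad f x l 0).
Proof.
move=> [_ cg] x; apply: (@continuous_comp _ _ _ (grad f) (fun w : 'cV[R]_n => w l 0)).
  exact: cg.
exact: coord_continuous.
Qed.

Lemma oracle_taylor x s z :
  `|oracle pb (x + s) z - oracle pb x z - dotp (Gr pb x z) s| <= Lg pb / 2 * enorm s ^+ 2.
Proof.
case: as5 => C1F LF _ _.
by have := @descent R n (fun u => oracle pb u z) (Lg pb) (proj1 (C1F z)) (LF z) x s.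
Qed.

Lemma measurable_oracle x : measurable_fun setT (oracle pb x).
Proof.
by case: as5 => _ _ iF _; have := measurable_int (law pb) (iF x); move/measurable_EFinP.
Qed.

(** Measurability in z is given for the oracle values; the gradient inherits it as a limit of
    difference quotients with step 1/(k+1), whose convergence follows from [oracle_taylor]. *)
Lemma measurable_Gr x l : measurable_fun setT (fun z => Gr pb x z l 0).
Proof.
case: as1 => _ _ _ [Lg0 _] _.
pose s k : 'cV[R]_n := k.+1%:R^-1 *: delta_mx l 0.
apply: (@measurable_fun_cvg _ _ _ _ (fun k z =>
   k.+1%:R * (oracle pb (x + s k) z - oracle pb x z))).
  by move=> k; apply: measurable_funM => //; apply: measurable_funB; exact: measurable_oracle.
move=> z _; apply/cvgrPdist_lt => e e0; near=> k.
have kp : (0 : R) < k.+1%:R by [].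
have ds : dotp (Gr pb x z) (s k) = k.+1%:R^-1 * Gr pb x z l 0.
  by rewrite /s dotpZr dotp_delta.
have ns : enorm (s k) ^+ 2 = k.+1%:R^-1 ^+ 2.
  by rewrite enorm_sqr /s dotpZl dotpZr dotp_delta mxE !eqxx mulr1 expr2.
have := oracle_taylor x (s k) z; rewrite ds ns => h.
apply: (@le_lt_trans _ _ (Lg pb / 2 * k.+1%:R^-1)).
  rewrite distrC -(ler_pM2l (_ : 0 < k.+1%:R^-1)) ?invr_gt0 //.
  rewrite -[X in X * `|_|]ger0_norm ?invr_ge0 // -normrM.
  rewrite mulrBr mulrA mulVf ?gt_eqF // mul1r.
  by apply: le_trans h _; rewrite expr2 mulrCA.
rewrite mulrC -ltr_pdivlMr ?divr_gt0 //.
by near: k; apply: near_inv_lt; rewrite !divr_gt0.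
Unshelve. all: by end_near. Qed.

Section composed.
Context {d : measure_display} {T : measurableType d}.
Implicit Types (X Y g : T -> 'cV[R]_n) (zeta : T -> Z).

Lemma measurable_oracle_comp X zeta : random_vector X -> measurable_fun setT zeta ->
  measurable_fun setT (fun t => oracle pb (X t) (zeta t)).
Proof.
move=> mX mz; case: as5 => C1F _ _ _.
apply: (measurable_caratheodory (f := fun x t => oracle pb x (zeta t))) => //.
  by move=> t; exact: (C1_continuous (C1F (zeta t))).
by move=> x; apply: (measurableT_comp (measurable_oracle x)).
Qed.

Lemma random_vector_grad X : random_vector X ->
  random_vector (fun t => grad (obj pb) (X t)).
Proof.
move=> mX l; case: as1 => C1f _ _ _ _.
apply: (measurable_continuous_rv (f := fun x => grad (obj pb) x l 0)) => //.
exact: C1_grad_continuous.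
Qed.

Lemma random_vector_con X : random_vector X -> random_vector (fun t => con pb (X t)).
Proof.
move=> mX i; case: as1 => _ C1c _ _ _.
apply: (measurable_continuous_rv (f := fun x => con pb x i 0)) => //.
exact: C1_continuous (C1c i).
Qed.

Lemma measurable_Jac X i j : random_vector X ->
  measurable_fun setT (fun t => Jac (con pb) (X t) i j).
Proof.
move=> mX; case: as1 => _ C1c _ _ _.
rewrite (_ : (fun t => _) = fun t => grad (fun u => con pb u i 0) (X t) j 0).
  apply: (measurable_continuous_rv (f := fun x => grad (fun u => con pb u i 0) x j 0)) => //.
  exact: C1_grad_continuous.
by apply/funext => t; rewrite mxE.
Qed.

Lemma random_vector_mulmx p m (A : T -> 'M[R]_(p, m)) (s : T -> 'cV[R]_m) :
  (forall i j, measurable_fun setT (fun t => A t i j)) -> random_vector s ->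
  random_vector (fun t => A t *m s t).
Proof.
move=> mA ms i.
apply: (eq_measurable_fun (fun t => \sum_j A t i j * s t j 0)).
  by move=> t _; rewrite mxE.
by apply: measurable_sum => j; exact: measurable_funM.
Qed.

Lemma random_vector_Jac_mul X s : random_vector X -> random_vector s ->
  random_vector (fun t => Jac (con pb) (X t) *m s t).
Proof. by move=> mX; apply: random_vector_mulmx => i j; exact: measurable_Jac. Qed.

Lemma random_vector_JacT_mul X (s : T -> 'cV[R]_q) : random_vector X -> random_vector s ->
  random_vector (fun t => (Jac (con pb) (X t))^T *m s t).
Proof.
move=> mX; apply: random_vector_mulmx => i j.
rewrite (_ : (fun t => _) = fun t => Jac (con pb) (X t) j i).
  exact: measurable_Jac.
by apply/funext => t; rewrite [LHS]mxE.
Qed.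

Lemma measurable_sz_model X g u (rho gam : T -> R) :
  random_vector X -> random_vector g -> random_vector u ->
  measurable_fun setT rho -> measurable_fun setT gam ->
  measurable_fun setT (fun t => sz_model pb (rho t) (gam t)^-1 (X t) (g t) (u t)).
Proof.
move=> mX mg mu mr mga; rewrite /sz_model.
have mux := random_vectorB mu mX.
apply: measurable_funD; first apply: measurable_funD.
- exact: measurable_dotp.
- apply: measurable_funM => //; apply: measurable_enorm; apply: random_vectorD.
    exact: random_vector_con.
  exact: random_vector_Jac_mul.
- apply: measurable_funM; last by apply: measurable_funX; exact: measurable_enorm.
  apply: (eq_measurable_fun (fun t => 2^-1 * gam t)).
    by move=> t _; rewrite invfM invrK.
  exact: measurable_funM.
Qed.

Lemma continuous_sz_model rho gam y (g : 'cV[R]_n) : continuous (sz_model pb rho gam y g).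
Proof.
move=> u; rewrite /sz_model.
have cuy := @continuousB_cst R n y.
apply: (@continuousD R R^o 'cV[R]_n); first apply: (@continuousD R R^o 'cV[R]_n).
- apply: (@continuous_comp _ _ _ (fun u : 'cV[R]_n => u - y) (dotp g)); first exact: cuy.
  exact: continuous_dotp.
- apply: continuousM; first exact: cst_continuous.
  apply: (@continuous_comp _ _ _ (fun u : 'cV[R]_n => u - y)
    (fun s => enorm (con pb y + Jac (con pb) y *m s))); first exact: cuy.
  exact: continuous_affine_norm.
- apply: continuousM; first exact: cst_continuous.
  apply: (@continuous_comp _ _ _ (fun u : 'cV[R]_n => enorm (u - y)) (fun x : R => x ^+ 2)); last exact: exprn_continuous.
  apply: (@continuous_comp _ _ _ (fun u : 'cV[R]_n => u - y) (@enorm R n)); first exact: cuy.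
  exact: continuous_enorm.
Qed.

(** The minimal value is measurable as an infimum over a dense set. A dense point within 1/(k+1) of
    it is then selected measurably, and strong convexity forces these points to converge to the
    minimizer. *)
Lemma random_vector_minimizer X g u (rho : T -> R) :
  random_vector X -> random_vector g -> measurable_fun setT rho ->
  (forall t, 0 < rho t) ->
  (forall t, minimizer (sz_model pb (rho t) (Lrho pb (rho t))^-1 (X t) (g t)) (u t)) ->
  random_vector u.
Proof.
move=> mX mg mr r0 umin.
pose h t w := sz_model pb (rho t) (Lrho pb (rho t))^-1 (X t) (g t) w.
have mL : measurable_fun setT (fun t => Lrho pb (rho t)).
  by apply: measurable_funD => //; exact: measurable_funM.
have mh (U : T -> 'cV[R]_n) : random_vector U -> measurable_fun setT (fun t => h t (U t)).
  by move=> mU; exact: measurable_sz_model.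
have ch t : continuous (h t) by exact: continuous_sz_model.
have mV : measurable_fun setT (fun t => h t (u t)).
  apply: (measurable_dense_min ch) => [w|t w|t e e0].
  - exact: (mh (fun=> w) (random_vector_cst w)).
  - exact: umin.
  - by exists (u t); rewrite ltrDl.
have sel k : exists2 D : T -> nat, measurable_fun setT D &
    forall t, h t (enum_point n (D t)) < h t (u t) + k.+1%:R^-1.
  apply: (first_selection (p := fun m t => h t (enum_point n m) < h t (u t) + k.+1%:R^-1)).
    move=> m; apply: measurable_ltr.
      exact: (mh (fun=> enum_point n m) (random_vector_cst _)).
    by apply: measurable_funD.
  move=> t; apply: (enum_dense (u := u t)); first exact: ch.
  by rewrite ltrDl invr_gt0.
move=> l; pose Dk k := sval (cid2 (sel k)).
have mD k : measurable_fun setT (Dk k) by rewrite /Dk; case: cid2.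
have hD k t : h t (enum_point n (Dk k t)) < h t (u t) + k.+1%:R^-1.
  by rewrite /Dk; case: cid2 => D /= _; apply.
apply: (@measurable_fun_cvg _ _ _ _ (fun k t => enum_point n (Dk k t) l 0)).
  move=> k; exact: (measurable_select_nat (mD k) (f := fun m _ => enum_point n m l 0)).
move=> t _; apply/cvgrPdist_lt => e e0.
have Lp : 0 < Lrho pb (rho t) := Lrho_gt0 as1 (r0 t).
near=> k.
have := prox_strongly_convex as1 (r0 t) (umin t) (enum_point n (Dk k t)).
set v := enum_point n _ => h1; have := hD k t; rewrite -/v => h2.
have h3 : Lrho pb (rho t) / 2 * enorm (v - u t) ^+ 2 < k.+1%:R^-1.
  by rewrite -(ltrD2l (h t (u t))); apply: le_lt_trans h2.
have h4 : k.+1%:R^-1 < Lrho pb (rho t) / 2 * e ^+ 2.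
  by near: k; apply: near_inv_lt; rewrite mulr_gt0 ?divr_gt0 ?exprn_gt0.
have : enorm (v - u t) < e.
  rewrite -(ltr_pXn2r (_ : 0 < 2)%N) ?nnegrE ?enorm_ge0 ?(ltW e0) //.
  rewrite -(ltr_pM2l (_ : 0 < Lrho pb (rho t) / 2)) ?divr_gt0 //.
  exact: lt_trans h4.
apply: le_lt_trans; rewrite distrC.
by have := coord_le_enorm (v - u t) l; rewrite !mxE.
Unshelve. all: by end_near. Qed.

Lemma measurable_theta X : random_vector X -> measurable_fun setT (fun t => theta pb (X t)).
Proof.
move=> mX; rewrite /theta; apply: measurable_funB.
  by apply: measurable_enorm; exact: random_vector_con.
(* Retraction onto the unit ball: it turns the constrained infimum into one over the whole space,
   where the dense set lives. *)
pose pr (s : 'cV[R]_n) : 'cV[R]_n := (Num.max 1 (enorm s))^-1 *: s.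
have pr1 s : enorm (pr s) <= 1.
  rewrite /pr enormZ ger0_norm; last by rewrite invr_ge0 le_max ler01.
  by rewrite ler_pdivrMl ?mulr1 ?le_max ?lexx ?orbT // lt_max ltr01.
have pre s : enorm s <= 1 -> pr s = s.
  by move=> s1; rewrite /pr max_l // invr1 scale1r.
pose h t s := enorm (con pb (X t) + Jac (con pb) (X t) *m pr s).
have mlt1 (s : 'cV[R]_n) : Num.max 1 (enorm s) != 0.
  by rewrite gt_eqF // lt_max ltr01.
apply: (measurable_dense_min (h := h)).
- move=> t s.
  apply: (@continuous_comp _ _ _ pr (fun s => enorm (con pb (X t) + Jac (con pb) (X t) *m s))); last exact: continuous_affine_norm.
  apply: (@continuousZ _ _ _ (fun s : 'cV[R]_n => (Num.max 1 (enorm s))^-1) id); last exact: cvg_id.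
  apply: (@continuousV _ _ (fun s : 'cV[R]_n => Num.max 1 (enorm s))) => //.
  by apply: continuous_max; [exact: cst_continuous|exact: continuous_enorm].
- move=> s; apply: measurable_enorm; apply: random_vectorD.
    exact: random_vector_con.
  by apply: random_vector_Jac_mul => //; exact: random_vector_cst.
- move=> t s; apply: inf_lbound; last by exists (pr s); [exact: pr1|].
  by exists 0 => _ [w _ <-]; exact: enorm_ge0.
- move=> t e e0.
  have hi : has_inf [set enorm (con pb (X t) + Jac (con pb) (X t) *m s) | s in @unit_ball R n].
    split; last by exists 0 => _ [w _ <-]; exact: enorm_ge0.
    by eexists; exists 0 => //; rewrite /unit_ball/= enorm0.
  have [_ [s s1 <-] hs] := inf_adherent e0 hi.
  by exists s; rewrite /h pre.
Qed.

End composed.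
End ProblemMeasurability.

Section RealMeasurable.
Context {R : realType} {d : measure_display} {T : measurableType d}.

(** Inversion is not continuous at 0. The functions x/(x^2 + 1/(k+1)) are continuous and converge to
    the inverse everywhere, with value 0 at 0 as [invr0] prescribes. *)
Lemma measurable_fun_invr (X : T -> R) : measurable_fun setT X ->
  measurable_fun setT (fun t => (X t)^-1).
Proof.
move=> mX.
apply: (@measurable_fun_cvg _ _ _ _ (fun k t => X t / (X t ^+ 2 + k.+1%:R^-1))).
  move=> k; apply: (measurableT_comp (f := fun x : R => x / (x ^+ 2 + k.+1%:R^-1))) => //.
  apply: continuous_measurable_fun => x.
  apply: (@continuousM _ _ id (fun x : R => (x ^+ 2 + k.+1%:R^-1)^-1)); first exact: cvg_id.
  apply: (@continuousV _ _ (fun x : R => x ^+ 2 + k.+1%:R^-1)).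
    by rewrite gt_eqF // ltr_wpDl ?sqr_ge0 // invr_gt0.
  by apply: (@continuousD R R^o R (fun x : R => x ^+ 2) (fun=> k.+1%:R^-1)); [exact: exprn_continuous|exact: cst_continuous].
move=> t _; move: (X t) => x; have [->|x0] := eqVneq x 0.
  rewrite invr0 [X in X @ _ --> _](_ : _ = fun=> 0); first exact: cvg_cst.
  by apply/funext => k; rewrite mul0r.
have -> : x^-1 = x * (x ^+ 2)^-1 by field.
apply: cvgM; first exact: cvg_cst.
apply: cvgV; first by rewrite expf_neq0.
rewrite -[x ^+ 2 in X in _ --> X]addr0; apply: cvgD; first exact: cvg_cst.
exact: cvg_harmonic.
Qed.

Lemma measurable_of_nat d' (U : measurableType d') (f : nat -> U) (X : T -> nat) :
  measurable_fun setT X -> measurable_fun setT (fun t => f (X t)).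
Proof.
by move=> mX; apply: (measurable_select_nat mX (f := fun m _ => f m)) => m; exact: measurable_cst.
Qed.

Lemma measurable_natceil (X : T -> R) : measurable_fun setT X ->
  measurable_fun setT (fun t => natceil (X t)).
Proof.
move=> mX; apply: (measurable_select (D := fun t => Num.ceil (X t)) (f := fun z _ => `|z|%N)) => [z|z]; last exact: measurable_cst.
rewrite (_ : [set t | _] = X @^-1` `](z - 1)%:~R, z%:~R]).
  by rewrite -[X in measurable X]setTI; exact: mX.
apply/seteqP; split => t /=; rewrite in_itv/=; first by move=> <-; exact: ceil_itv.
by move=> h; apply/eqP; rewrite ceil_eq.
Qed.

End RealMeasurable.

Section BatchMeasurability.
Variables (R : realType) (n q : nat) (dz : measure_display).
Variables (Z : measurableType dz) (pb : problem R n q Z).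
Hypothesis as5 : AS5 pb.
Context {d : measure_display} {T : measurableType d}.

Lemma random_vector_Gmu (mu : T -> R) (X V : T -> 'cV[R]_n) (zeta : T -> Z) :
  measurable_fun setT mu -> random_vector X -> measurable_fun setT zeta ->
  random_vector V -> random_vector (fun t => Gmu pb (mu t) (X t) (zeta t) (V t)).
Proof.
move=> mmu mX mz mV; apply: random_vectorZ => //.
apply: measurable_funM; last exact: measurable_fun_invr.
apply: measurable_funB; apply: measurable_oracle_comp => //.
by apply: random_vectorD => //; exact: random_vectorZ.
Qed.

Lemma random_vector_sz_batch (mu : T -> R) (m : T -> nat) (X : T -> 'cV[R]_n)
    (z : nat -> T -> Z) (v : nat -> T -> 'cV[R]_n) :
  measurable_fun setT mu -> measurable_fun setT m -> random_vector X ->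
  (forall i, measurable_fun setT (z i)) -> (forall i, random_vector (v i)) ->
  random_vector (fun t => sz_batch pb (mu t) (m t) (X t) (z ^~ t) (v ^~ t)).
Proof.
move=> mmu mm mX mz mv.
apply: (random_vector_select_nat mm (f := fun m t => sz_batch pb (mu t) m (X t) (z ^~ t) (v ^~ t))) => k.
apply: random_vectorZ; first exact: measurable_cst.
by apply: random_vector_sum => i; exact: random_vector_Gmu.
Qed.

End BatchMeasurability.

Section LawTransfer.
Context d (T : measurableType d) (R : realType) (P : probability T R).
Context d' (U : measurableType d') (Q : {measure set U -> \bar R}) (X : T -> U).
Hypothesis mX : measurable_fun setT X.
Hypothesis lawX : forall B, measurable B -> P (X @^-1` B) = Q B.

Lemma ge0_integral_law (f : U -> \bar R) : measurable_fun setT f ->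
  (forall u, 0 <= f u)%E -> (\int[P]_w f (X w) = \int[Q]_u f u)%E.
Proof.
move=> mf f0; have := @ge0_integral_pushforward _ _ T U R X mX P setT f measurableT mf (fun y _ => f0 y).
rewrite preimage_setT => <-; apply: eq_measure_integral => //= A mA _.
exact: lawX.
Qed.

Lemma rint_law (f : U -> R) : measurable_fun setT f ->
  Q.-integrable setT (EFin \o f) -> rint P (fun w => f (X w)).
Proof.
move=> mf /integrableP[_ h]; apply/integrableP; split.
  by apply/measurable_EFinP; exact: measurableT_comp.
have := @ge0_integral_law (fun u => `|(EFin \o f) u|%E); move=> /= -> //.
by do 2 apply: measurableT_comp => //.
Qed.

Lemma integral_law (f : U -> R) : measurable_fun setT f ->
  Q.-integrable setT (EFin \o f) -> (\int[P]_w (f (X w))%:E = \int[Q]_u (f u)%:E)%E.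
Proof.
move=> mf iF.
have mf' : measurable_fun setT (fun u => (f u)%:E) by exact/measurable_EFinP.
rewrite [LHS]integralE [RHS]integralE; congr (_ - _)%E.
  rewrite -ge0_integral_law; [|exact: measurable_funepos|by []].
  by apply: eq_integral => w _; rewrite !funepos.unlock.
rewrite -ge0_integral_law; [|exact: measurable_funeneg|by []].
by apply: eq_integral => w _; rewrite !funeneg.unlock.
Qed.

End LawTransfer.

(** * Expected error of a batch *)

Section Samples.
Variables (R : realType) (n q : nat) (dz : measure_display).
Variables (Z : measurableType dz) (pb : problem R n q Z) (st : settings R n).
Variables (d : measure_display) (Om : measurableType d) (P : probability Om R).
Variable r : pz_data R n Z Om.
Hypothesis as1 : AS1 pb.
Hypothesis as5 : AS5 pb.
Hypothesis fresh : fresh_samples pb P r.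
Local Notation SE := (sample_events r).

Lemma sample_events_measurable s : SE s `<=` measurable.
Proof.
case: fresh => mxi mv _ _ _; case: s => [t|t] A [B mB <-].
  exact: mxi.
exact: mv.
Qed.

Lemma sample_eventsI s : setI_closed (SE s).
Proof.
by case: s => [t|t] _ _ [B mB <-] [C mC <-] /=; exists (B `&` C);
  rewrite ?setTI ?preimage_setI //; exact: measurableI.
Qed.

Lemma sample_eventsT s : SE s setT.
Proof. by case: s => [t|t] /=; exists setT; rewrite ?preimage_setT ?setTI. Qed.

Lemma sample_independent : mutually_independent P SE.
Proof. by case: fresh. Qed.

Section fixed_point.
Variables (k j : nat) (y : 'cV[R]_n).
Hypothesis ay : AS4_at pb y.
Hypothesis gy : enorm (grad (obj pb) y) <= kg st.

Let xi i := pz_xi r k j i.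
Let v i (l : 'I_n) w : R := pz_v r k j i w l 0.
Let g i l w : R := Gr pb y (xi i w) l 0.
Let c l : R := grad (obj pb) y l 0.
Let ix (i : nat) : sample_index n := inl (k, j, i).
Let iv (i : nat) (l : 'I_n) : sample_index n := inr ((k, j, i), l).

Let ix_inj : injective ix. Proof. by move=> a b [->]. Qed.
Let iv_inj i i' l p : iv i l = iv i' p -> i = i' /\ l = p.
Proof. by move=> [-> ->]. Qed.
Let ix_iv i i' l : ix i != iv i' l. Proof. by []. Qed.

Let mxi i : measurable_fun setT (xi i).
Proof. by case: fresh => h _ _ _ _; exact: h. Qed.
Let mv i l : measurable_fun setT (v i l).
Proof. by case: fresh => _ h _ _ _; exact: h. Qed.

Let mvS i l : meas SE [set iv i l] (v i l).
Proof. by apply: meas1 => B mB; exists B => //; rewrite setTI. Qed.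

Let mgS i l : meas SE [set ix i] (g i l).
Proof.
apply: meas1 => B mB; exists ((fun z => Gr pb y z l 0) @^-1` B); last by rewrite setTI.
by have := measurable_Gr as1 as5 y l measurableT mB; rewrite setTI.
Qed.

Let lawv i l B : measurable B -> P (v i l @^-1` B) = normal_prob (0 : R) 1 B.
Proof. by case: fresh => _ _ _ h _; exact: h. Qed.

Let lawxi i B : measurable B -> P (xi i @^-1` B) = law pb B.
Proof. by case: fresh => _ _ h _ _; exact: h. Qed.

Let mX m : measurable_fun setT (fun x : R => x ^+ m).
Proof. exact: measurable_funX. Qed.

Let even_law i l m : ~~ odd m ->
  (\int[P]_w (v i l w ^+ m)%:E = \int[normal_prob (0 : R) 1]_x (x ^+ m)%:E)%E.
Proof.
move=> m2; have := ge0_integral_law (Q := normal_prob (0 : R) 1) (mv i l) (@lawv i l) (f := fun x => (x ^+ m)%:E).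
apply; first exact/measurable_EFinP.
by move=> u; rewrite lee_fin exprn_even_ge0.
Qed.

Let iv4 i l : rint P (fun w => v i l w ^+ 4).
Proof.
apply: (@rint_ge0_fin _ _ _ _ _ 3).
- exact: measurable_funX.
- by move=> w; rewrite exprn_even_ge0.
- by rewrite even_law // normal_moment4.
Qed.

Let v4 i l : \int[P]_w (v i l w ^+ 4) <= 3.
Proof. by rewrite -lee_fin EFin_Rintegral // even_law // normal_moment4. Qed.

Let v2 i l : \int[P]_w (v i l w ^+ 2) = 1.
Proof. by rewrite /Rintegral even_law // normal_moment2. Qed.

Let v6 i l : (\int[P]_w (v i l w ^+ 6)%:E <= 15%:E)%E.
Proof. by rewrite even_law // normal_moment6. Qed.

Let normal_id_integrable : (normal_prob (0 : R) 1).-integrable setT (EFin \o id).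
Proof.
apply: (@rint_le _ _ _ (normal_prob (0 : R) 1) _ (fun x => 1 + x ^+ 2)) => //.
- apply: rintD; first exact: rint_cst.
  apply: (@rint_ge0_fin _ _ _ _ _ 1) => //; first by move=> x; exact: sqr_ge0.
  by rewrite normal_moment2.
- by move=> x; rewrite ler_norml; apply/andP; split; nra.
Qed.

Let v1 i l : \int[P]_w v i l w = 0.
Proof.
rewrite /Rintegral (integral_law (Q := normal_prob (0 : R) 1) (mv i l) (@lawv i l) (f := id)) //.
by rewrite normal_mean.
Qed.

Let mGr l : measurable_fun setT (fun z => Gr pb y z l 0).
Proof. exact: measurable_Gr. Qed.

Let iGr l : rint (law pb) (fun z => Gr pb y z l 0).
Proof. by case: ay => h _ _; exact: h. Qed.

Let eGr l : (\int[law pb]_z (Gr pb y z l 0)%:E = (c l)%:E)%E.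
Proof. by case: ay => _ h _; have := h l; rewrite unlock. Qed.

Let g1 i l : \int[P]_w g i l w = c l.
Proof.
rewrite /Rintegral (integral_law (mxi i) (@lawxi i) (f := fun z => Gr pb y z l 0)) ?eGr //.
exact: iGr.
Qed.

Let var_Gr : (\int[law pb]_z (\sum_l (Gr pb y z l 0 - c l) ^+ 2)%:E <= (sigma pb ^+ 2)%:E)%E.
Proof.
case: ay => _ _; rewrite unlock => h; apply: le_trans h; rewrite le_eqVlt; apply/orP; left.
apply/eqP; apply: eq_integral => z _; congr (_%:E); rewrite enorm_sqr.
by apply: eq_bigr => l _; rewrite coordB expr2.
Qed.

Let mdG l : measurable_fun setT (fun z => (Gr pb y z l 0 - c l) ^+ 2).
Proof. by apply: measurable_funX; exact: measurable_funB. Qed.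

Let isum : rint (law pb) (fun z => \sum_l (Gr pb y z l 0 - c l) ^+ 2).
Proof.
apply: (rint_ge0_fin _ _ var_Gr); first by apply: measurable_sum => l.
by move=> z; apply: sumr_ge0 => l _; exact: sqr_ge0.
Qed.

Let idG l : rint (law pb) (fun z => (Gr pb y z l 0 - c l) ^+ 2).
Proof.
apply: (rint_le _ isum) => // z; rewrite ger0_norm ?sqr_ge0 //.
by rewrite (bigD1 l) //= lerDl sumr_ge0 // => p _; exact: sqr_ge0.
Qed.

Let GrE l z : Gr pb y z l 0 ^+ 2 =
  (Gr pb y z l 0 - c l) ^+ 2 + (2 * c l * Gr pb y z l 0 + - c l ^+ 2).
Proof. by ring. Qed.

Let iG2 l : rint (law pb) (fun z => Gr pb y z l 0 ^+ 2).
Proof.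
rewrite (_ : (fun z => _) = fun z => (Gr pb y z l 0 - c l) ^+ 2
   + (2 * c l * Gr pb y z l 0 + - c l ^+ 2)); last exact/funext/GrE.
apply: rintD => //; apply: rintD; last exact: rint_cst.
by apply: rintZ; exact: iGr.
Qed.

Let G2 l : \int[law pb]_z (Gr pb y z l 0 ^+ 2)
  = \int[law pb]_z ((Gr pb y z l 0 - c l) ^+ 2) + c l ^+ 2.
Proof.
rewrite (_ : (fun z => _) = fun z => (Gr pb y z l 0 - c l) ^+ 2
   + (2 * c l * Gr pb y z l 0 + - c l ^+ 2)); last exact/funext/GrE.
rewrite RintegralD //; [|exact: idG|]; last first.
  by apply: rintD; [apply: rintZ; exact: iGr|exact: rint_cst].
rewrite RintegralD //; [|by apply: rintZ; exact: iGr|exact: rint_cst].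
rewrite RintegralZl //; last exact: iGr.
by rewrite Rintegral_prob_cst /Rintegral eGr /=; ring.
Qed.

Let ig2 i l : rint P (fun w => g i l w ^+ 2).
Proof.
apply: (rint_law (mxi i) (@lawxi i) (f := fun z => Gr pb y z l 0 ^+ 2)).
  exact: measurable_funX.
exact: iG2. Qed.

(** The second moment of G is its variance plus |grad f|^2; [sigma] bounds the first and [kg] the
    second. *)
Let g2 i : \sum_l \int[P]_w (g i l w ^+ 2) <= kg st ^+ 2 + sigma pb ^+ 2.
Proof.
have -> : \sum_l \int[P]_w (g i l w ^+ 2) = \sum_l \int[law pb]_z (Gr pb y z l 0 ^+ 2).
  apply: eq_bigr => l _; rewrite /Rintegral.
  rewrite (integral_law (mxi i) (@lawxi i) (f := fun z => Gr pb y z l 0 ^+ 2)) //.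
    exact: measurable_funX.
  exact: iG2.
under eq_bigr do rewrite G2.
rewrite big_split /= -Rintegral_sum // addrC; apply: lerD.
  rewrite (_ : \sum_l _ = enorm (grad (obj pb) y) ^+ 2); last first.
    by rewrite enorm_sqr; apply: eq_bigr => l _; rewrite expr2.
  by rewrite ler_sqr ?nnegrE ?enorm_ge0 // (le_trans (enorm_ge0 _) gy).
by rewrite -lee_fin EFin_Rintegral.
Qed.

Let a i := smp (v i) (g i) c.

(** Here y is deterministic; the iterate is substituted in [weighted_error], once the past has been
    frozen. *)
Definition batch_error (mu : R) (m : nat) w : R :=
  enorm (sz_batch pb mu m y (fun i => xi i w) (fun i => pz_v r k j i w) - grad (obj pb) y) ^+ 2.

(** The finite difference splits into the exact directional derivative, which produces the noise
    [a], and the Taylor remainder along mu v divided by mu, which produces the bias [rr] v. *)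
Let Gmu_le mu i w : 0 < mu -> exists2 rr : R,
   (rr ^+ 2 <= (Lg pb * mu / 2) ^+ 2 * (\sum_l v i l w ^+ 2) ^+ 2) &
   forall l, Gmu pb mu y (xi i w) (pz_v r k j i w) l 0 - c l = a i l w + rr * v i l w.
Proof.
move=> mu0; case: as1 => _ _ _ [Lg0 _] _.
pose D := dotp (Gr pb y (xi i w)) (pz_v r k j i w).
exists ((oracle pb (y + mu *: pz_v r k j i w) (xi i w) - oracle pb y (xi i w)) / mu - D).
  have := oracle_taylor as5 y (mu *: pz_v r k j i w) (xi i w).
  rewrite dotpZr -/D => h.
  have : `|(oracle pb (y + mu *: pz_v r k j i w) (xi i w) - oracle pb y (xi i w)) / mu - D|
    <= Lg pb * mu / 2 * \sum_l v i l w ^+ 2.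
    rewrite -(ler_pM2l mu0) -[X in X * `|_|]gtr0_norm // -normrM mulrBr mulrCA divff ?gt_eqF // mulr1.
    apply: le_trans h _; rewrite enormZ exprMn real_normK ?num_real // enorm_sqr.
    rewrite (_ : dotp _ _ = \sum_l v i l w ^+ 2); last by apply: eq_bigr => l _; rewrite expr2.
    by rewrite le_eqVlt; apply/orP; left; apply/eqP; ring.
  set X := _ / mu - D => h'; rewrite -exprMn -(real_normK (num_real X)).
  rewrite ler_sqr ?nnegrE //; apply: le_trans h'; exact: normr_ge0.
move=> l; rewrite /Gmu mxE /a /smp.
have -> : \sum_p (v i p w * v i l w * g i p w) = D * v i l w.
  by rewrite /D /dotp mulr_suml; apply: eq_bigr => p _; rewrite /v /g; ring.
by rewrite /v; ring.
Qed.

Lemma sqr_mean_le m (x : nat -> R) : (0 < m)%N ->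
  (m%:R^-1 * \sum_(i < m) x i) ^+ 2 <= m%:R^-1 * \sum_(i < m) x i ^+ 2.
Proof.
move=> m0; have mp : (0 : R) < m%:R by rewrite ltr0n.
set s := m%:R^-1 * \sum_(i < m) x i.
have : 0 <= \sum_(i < m) (x i - s) ^+ 2 by apply: sumr_ge0 => i _; exact: sqr_ge0.
have -> : \sum_(i < m) (x i - s) ^+ 2 = \sum_(i < m) x i ^+ 2 - m%:R * s ^+ 2.
  have -> : \sum_(i < m) (x i - s) ^+ 2 = \sum_(i < m) (x i ^+ 2 - 2 * s * x i + s ^+ 2).
    by apply: eq_bigr => i _; ring.
  rewrite big_split /= sumrB -mulr_sumr sumr_const card_ord -mulr_natl.
  have -> : \sum_(i < m) x i = m%:R * s by rewrite /s mulrA divff ?gt_eqF // mul1r.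
  by ring.
by rewrite subr_ge0 => h; rewrite ler_pdivlMl.
Qed.

(** (A + B)^2 <= 2 A^2 + 2 B^2 separates noise from bias. The noise stays averaged inside the
    square, so that its variance is divided by m; for the bias convexity moves the average
    outside. *)
Let error_le mu m w : 0 < mu -> (0 < m)%N -> batch_error mu m w <=
  2 * \sum_l (m%:R^-1 * \sum_(i < m) a i l w) ^+ 2 +
  2 * (Lg pb * mu / 2) ^+ 2 * (m%:R^-1 * \sum_(i < m) (\sum_l v i l w ^+ 2) ^+ 3).
Proof.
move=> mu0 m0; have mp : (0 : R) < m%:R by rewrite ltr0n.
pose rr i := sval (cid2 (@Gmu_le mu i w mu0)).
have rr1 i : rr i ^+ 2 <= (Lg pb * mu / 2) ^+ 2 * (\sum_l v i l w ^+ 2) ^+ 2.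
  by rewrite /rr; case: cid2.
have rr2 i l : Gmu pb mu y (xi i w) (pz_v r k j i w) l 0 - c l = a i l w + rr i * v i l w.
  by rewrite /rr; case: cid2.
have -> : batch_error mu m w = \sum_l (m%:R^-1 * \sum_(i < m) a i l w
    + m%:R^-1 * \sum_(i < m) (rr i * v i l w)) ^+ 2.
  rewrite /batch_error enorm_sqr; apply: eq_bigr => l _; rewrite -expr2; congr (_ ^+ 2).
  rewrite -mulrDr -big_split /=.
  have -> : \sum_(i < m) (a i l w + rr i * v i l w)
     = \sum_(i < m) (Gmu pb mu y (xi i w) (pz_v r k j i w) l 0 - c l).
    by apply: eq_bigr => i _; rewrite rr2.
  rewrite sumrB sumr_const card_ord -[c l *+ m]mulr_natl mulrBr [_ * (_ * c l)]mulrA mulVf ?gt_eqF // mul1r.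
  by rewrite coordB /sz_batch mxE summxE.
apply: (@le_trans _ _ (\sum_l (2 * (m%:R^-1 * \sum_(i < m) a i l w) ^+ 2 +
   2 * (m%:R^-1 * \sum_(i < m) (rr i * v i l w) ^+ 2)))).
  apply: ler_sum => l _.
  have := sqr_mean_le (fun i => rr i * v i l w) m0.
  set A := m%:R^-1 * \sum_(i < m) a i l w; set B := m%:R^-1 * \sum_(i < m) (rr i * v i l w).
  by have := sqr_ge0 (A - B); lra.
rewrite big_split /= -!mulr_sumr lerD2l -mulrA ler_wpM2l // mulrCA ler_wpM2l ?invr_ge0 ?ler0n //.
rewrite exchange_big mulr_sumr; apply: ler_sum => i _ /=.
under eq_bigr do rewrite exprMn.
rewrite -mulr_sumr [X in _ <= _ * X]exprSr mulrA ler_wpM2r //.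
by apply: sumr_ge0 => l _; exact: sqr_ge0.
Qed.

(** 6 n is twice the 3 n of [batch_variance]; 15/2 is twice the 15 of [norm6_moment] times 1/4, the
    square of the Taylor constant 1/2. *)
Lemma batch_error_expectation mu m : 0 < mu -> (0 < m)%N ->
  (\int[P]_w (batch_error mu m w)%:E <=
   (6 * n%:R * (kg st ^+ 2 + sigma pb ^+ 2) / m%:R
     + 15 / 2 * (Lg pb * mu) ^+ 2 * n%:R ^+ 3)%:E)%E.
Proof.
move=> mu0 m0; have mp : (0 : R) < m%:R by rewrite ltr0n.
have iA := batch_rint sample_events_measurable sample_eventsI sample_eventsT
  sample_independent ix_iv c mvS mgS iv4 ig2 m.
have vA := batch_variance sample_events_measurable sample_eventsI sample_eventsT
  sample_independent ix_inj iv_inj ix_iv mvS mgS v1 v2 v4 iv4 g1 ig2 g2 m0.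
have iB i := norm6_rint (mv i) (v6 i).
have vB i := norm6_moment (mv i) (v6 i).
pose A w := 2 * \sum_l (m%:R^-1 * \sum_(i < m) a i l w) ^+ 2.
pose B w := 2 * (Lg pb * mu / 2) ^+ 2 * (m%:R^-1 * \sum_(i < m) (\sum_l v i l w ^+ 2) ^+ 3).
have rA : rint P A by exact: rintZ.
have rB : rint P B by do 2 apply: rintZ; exact: rint_sum.
apply: (@le_trans _ _ (\int[P]_w (A w + B w)%:E)%E).
  apply: ge0_le_integral => //.
  - by move=> w _; rewrite lee_fin sqr_ge0.
  - apply/measurable_EFinP; apply: measurable_funX; apply: measurable_enorm.
    apply: random_vectorB; last exact: random_vector_cst.
    by apply: random_vector_sz_batch => // i; case: fresh => _ h _ _ _; exact: h.
  - apply/measurable_EFinP; exact: rint_measurable (rintD rA rB).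
  - by move=> w _; rewrite lee_fin; exact: error_le.
rewrite -EFin_Rintegral ?lee_fin; last exact: rintD.
rewrite RintegralD // RintegralZl // RintegralZl //; last first.
  by apply: (@rintZ _ _ _ P); apply: rint_sum.
rewrite RintegralZl; [|by []|by apply: (@rint_sum _ _ _ P)].
apply: lerD.
  have -> : 6 * n%:R * (kg st ^+ 2 + sigma pb ^+ 2) / m%:R
    = 2 * (3 * n%:R * (kg st ^+ 2 + sigma pb ^+ 2) / m%:R) by ring.
  by rewrite ler_wpM2l.
rewrite Rintegral_sum //.
apply: (@le_trans _ _ (2 * (Lg pb * mu / 2) ^+ 2 * (m%:R^-1 * \sum_(i < m) (15 * n%:R ^+ 3)))).
  apply: ler_wpM2l; first by rewrite mulr_ge0 ?sqr_ge0.
  apply: ler_wpM2l; first by rewrite invr_ge0 ler0n.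
  by apply: ler_sum => i _; exact: vB.
rewrite sumr_const card_ord -mulr_natl le_eqVlt; apply/orP; left; apply/eqP.
by field; rewrite gt_eqF.
Qed.

End fixed_point.
End Samples.

(** * Information available before an iteration *)

Section BatchSizes.
Variables (R : realType) (n q : nat) (dz : measure_display).
Variables (Z : measurableType dz) (pb : problem R n q Z) (st : settings R n).
Context {d : measure_display} {T : measurableType d}.

Lemma measurable_Lrho (rho : T -> R) : measurable_fun setT rho ->
  measurable_fun setT (fun t => Lrho pb (rho t)).
Proof. by move=> mr; apply: measurable_funD => //; exact: measurable_funM. Qed.

Lemma measurable_batch_size (nbar : T -> nat) (rho : T -> R) :
  measurable_fun setT nbar -> measurable_fun setT rho ->
  measurable_fun setT (fun t => batch_size pb st (nbar t) (rho t)).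
Proof.
move=> mn mr; apply: measurable_natceil.
have mnR : measurable_fun setT (fun t => (nbar t)%:R : R) by exact: measurable_of_nat.
apply: measurable_minr => //; apply: measurable_maxr => //.
apply: measurable_funM; first by apply: measurable_fun_invr; exact: measurable_Lrho.
apply: (measurableT_comp (f := @Num.sqrt R)).
  by apply: continuous_measurable_fun; exact: sqrt_continuous.
exact: measurable_funM.
Qed.

Lemma measurable_nat_ratio (a b : T -> nat) : measurable_fun setT a -> measurable_fun setT b ->
  measurable_fun setT (fun t => natceil ((a t)%:R / (b t)%:R : R)).
Proof.
move=> ma mb; apply: measurable_natceil; apply: measurable_funM.
  exact: measurable_of_nat.
by apply: measurable_fun_invr; exact: measurable_of_nat.
Qed.

End BatchSizes.

Section Past.
Variables (R : realType) (n q : nat) (dz : measure_display).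
Variables (Z : measurableType dz) (pb : problem R n q Z) (st : settings R n).
Variables (d : measure_display) (Om : measurableType d) (P : probability Om R).
Variables (N : nat) (r : pz_data R n Z Om).
Hypothesis as1 : AS1 pb.
Hypothesis as5 : AS5 pb.
Hypothesis fresh : fresh_samples pb P r.
Hypothesis hist : forall k, (1 <= k < N)%N ->
  history_measurable r k (pz_rho r k) /\ history_measurable r k (pz_nbar r k).
Hypothesis unif : forall k, (1 <= k < N)%N -> uniform_index pb st P r k.
Local Notation SE := (sample_events r).

Definition inner (s : sample_index n) : nat :=
  match s with inl t => t.1.2 | inr t => t.1.1.2 end.

Definition past_gens k (J : set (sample_index n)) : set (set Om) :=
  [set A | (exists2 s, J s & SE s A) \/ past_index r k A].

Lemma past_gensS k k' J J' : (k <= k')%N -> J `<=` J' -> past_gens k J `<=` past_gens k' J'.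
Proof.
move=> kk' JJ' A [[s Js As]|[k0 /andP[h1 h2] hA]]; first by left; exists s => //; exact: JJ'.
by right; exists k0 => //; rewrite h1 (leq_trans h2).
Qed.

Lemma past_gens_measurable k J : (k <= N)%N -> past_gens k J `<=` measurable.
Proof.
move=> kN A [[s _ /(sample_events_measurable fresh)] //|[k' /andP[h1 h2] [B mB <-]]].
have [|mR _ _] := unif (k := k'); first by rewrite h1 (leq_trans h2).
exact: mR.
Qed.

Local Notation TF k J := (g_sigma_algebraType (past_gens k J)).
Local Notation TG K := (g_sigma_algebraType (gens SE K)).

Lemma past_measurableS k k' J J' d' (T' : measurableType d') (X : Om -> T') :
  (k <= k')%N -> J `<=` J' ->
  measurable_fun (setT : set (TF k J)) X -> measurable_fun (setT : set (TF k' J')) X.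
Proof.
move=> kk' JJ' mX _ B mB; have := mX measurableT B mB.
by apply: sub_sigma_algebra2; exact: past_gensS.
Qed.

Lemma history_past k J d' (T' : measurableType d') (X : Om -> T') :
  [set s | (stage s < k)%N] `<=` J -> history_measurable r k X ->
  measurable_fun (setT : set (TF k J)) X.
Proof.
move=> hJ hX _ B mB; rewrite setTI; have := hX B mB.
by apply: sub_sigma_algebra2; exact: past_gensS.
Qed.

Lemma past_batch k J : (1 <= k < N)%N -> [set s | (stage s < k)%N] `<=` J ->
  measurable_fun (setT : set (TF k J)) (batch pb st r k).
Proof.
move=> kN hJ; have [h1 h2] := hist kN; apply: measurable_batch_size; exact: history_past.
Qed.

Lemma past_Nin k J : (1 <= k < N)%N -> [set s | (stage s < k)%N] `<=` J ->
  measurable_fun (setT : set (TF k J)) (Nin pb st r k).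
Proof.
move=> kN hJ; have [h1 h2] := hist kN; apply: measurable_nat_ratio.
  exact: history_past.
exact: past_batch.
Qed.

(* P(R_k = i) conditionally on all samples and the earlier indices. *)
Definition index_weight k i w : R :=
  if (1 <= i <= Nin pb st r k w)%N then (Nin pb st r k w)%:R^-1 else 0.

Lemma past_index_weight k i J : (1 <= k < N)%N -> [set s | (stage s < k)%N] `<=` J ->
  measurable_fun (setT : set (TF k J)) (index_weight k i).
Proof.
move=> kN hJ; apply: (measurable_of_nat (fun m => if (1 <= i <= m)%N then (m%:R^-1 : R) else 0)).
exact: past_Nin.
Qed.

Lemma index_weight_ge0 k i w : 0 <= index_weight k i w.
Proof. by rewrite /index_weight; case: ifP => // _; rewrite invr_ge0. Qed.

Lemma index_weight_le1 k i w : index_weight k i w <= 1.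
Proof.
rewrite /index_weight; case: ifP => // /andP[h1 h2].
have : (1 <= Nin pb st r k w)%N by exact: leq_trans h2.
by case: (Nin _ _ _ _ _) => // m _; rewrite invf_le1 // ler1n.
Qed.

Lemma past_samples_history k J : <<s past_gens k J >> `<=` samples_and_history r k.
Proof.
apply: sub_sigma_algebra2 => A [[s _ As]|hA]; last by right.
by left; exists s.
Qed.

Lemma gens_samples_history k J : <<s gens SE J >> `<=` samples_and_history r k.
Proof. by apply: sub_sigma_algebra2 => A [s _ As]; left; exists s. Qed.

Lemma past_gens_small k J : (k <= 1)%N -> past_gens k J = gens SE J.
Proof.
move=> k1; apply/seteqP; split => A; last by move=> [s Js As]; left; exists s.
move=> [[s Js As]|[k' /andP[h1 h2] _]]; first by exists s.
by have := leq_ltn_trans h1 (leq_trans h2 k1).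
Qed.

(* Induction on the call: R_k only adds events A /\ (R_k = i), whose probability
   given the samples is the index weight, a function of the earlier past. *)
Lemma past_independent k J K : (k <= N)%N -> [set s | (stage s < k)%N] `<=` J ->
  J `&` K = set0 -> indep P <<s past_gens k J >> <<s gens SE K >>.
Proof.
elim: k J K => [|k IH] J K kN hJ JK.
  rewrite past_gens_small //; apply: indep_gens => //.
  - exact: sample_events_measurable fresh.
  - exact: sample_eventsI.
  - exact: sample_eventsT.
  - exact: sample_independent fresh.
(* There is no call number 0, hence no index to add in that case. *)
have [k0|k0] := posnP k.
  rewrite past_gens_small ?k0 //; apply: indep_gens => //.
  - exact: sample_events_measurable fresh.
  - exact: sample_eventsI.
  - exact: sample_eventsT.
  - exact: sample_independent fresh.
have kN' : (1 <= k < N)%N by rewrite k0.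
have hJ' : [set s | (stage s < k)%N] `<=` J.
  by move=> s /= sk; apply: hJ; rewrite /= ltnS ltnW.
have {}IH := IH J K (ltnW kN) hJ' JK.
have [mR R1 RE] := unif kN'.
have Fm := past_gens_measurable (J := J) (ltnW kN).
have Km : gens SE K `<=` measurable.
  by apply: gens_measurable; exact: sample_events_measurable fresh.
(* [None] keeps A alone, [Some i] adds the event R_k = i. The resulting family is stable under
   intersection because the events R_k = i are pairwise disjoint. *)
pose X A o := A `&` (if o is Some i then pz_R r k @^-1` [set i] else setT).
pose G := [set B | exists2 A, <<s past_gens k J >> A & exists o, B = X A o].
have mRi i : measurable (pz_R r k @^-1` [set i]).
  by rewrite -[Y in measurable Y]setTI; exact: mR.
have Gm : G `<=` measurable.
  move=> _ [A FA [t ->]]; apply: measurableI; first exact: (sigma_sub_measurable Fm).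
  by case: t => [i|] //; exact: mRi.
have GI : setI_closed G.
  move=> _ _ [A FA [t ->]] [A' FA' [t' ->]].
  have FAA' : <<s past_gens k J >> (A `&` A').
    exact: (@measurableI _ (TF k J)).
  rewrite /X setIACA; case: t => [i|]; case: t' => [i'|].
  - have [<-|ii'] := eqVneq i i'; first by exists (A `&` A') => //; exists (Some i); rewrite setIid.
    exists set0; first exact: (@measurable0 _ (TF k J)).
    exists None; rewrite /X set0I; apply/seteqP; split => // w [_ [/= ->]] h.
    by rewrite h eqxx in ii'.
  - by exists (A `&` A') => //; exists (Some i); rewrite setIT.
  - by exists (A `&` A') => //; exists (Some i'); rewrite setTI.
  - by exists (A `&` A') => //; exists None; rewrite setTI.
have GT : G setT.
  by exists setT; [exact: (@measurableT _ (TF k J))|exists None; rewrite /X setTI].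
have GK : indep P <<s G >> <<s gens SE K >>.
  apply: indep_sigma => //; first exact: sigma_sub_measurable.
  move=> _ B [A FA [t ->]] KB; case: t => [i|]; last by rewrite /X !setIT IH.
  have mA : measurable A := sigma_sub_measurable Fm FA.
  have mB : measurable B := sigma_sub_measurable Km KB.
  (* The conditional law of R_k, used both for A and for its intersection with B. The weight depends
     on the past alone, so the factor coming from B splits off by the induction hypothesis. *)
  have wE (C : set Om) : samples_and_history r k C ->
      P (C `&` pz_R r k @^-1` [set i]) = (\int[P]_w (index_weight k i w * \1_C w)%:E)%E.
    move=> hC; rewrite RE // integral_mkcond; apply: eq_integral => w _.
    by rewrite patchE indicE /index_weight; case: ifP => wC; rewrite ?mulr1 ?mulr0.
  have hA : samples_and_history r k A by exact: past_samples_history FA.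
  have hB : samples_and_history r k B by exact: gens_samples_history KB.
  have hAB : samples_and_history r k (A `&` B).
    exact: (@measurableI _ (g_sigma_algebraType [set A | (exists s, SE s A) \/ past_index r k A])).
  rewrite /X setIAC wE // wE //.
  have mw : measurable_fun (setT : set (TF k J)) (fun w => index_weight k i w * \1_A w).
    by apply: measurable_funM; [exact: past_index_weight|exact: measurable_indic].
  have mw' := sub_measurable_fun Fm mw.
  have iw : rint P (fun w => index_weight k i w * \1_A w).
    apply: (rint_le mw' (rint_cst _ 1)) => w.
    rewrite ger0_norm ?mulr_ge0 ?index_weight_ge0 //.
    rewrite -[leRHS]mulr1; apply: ler_pM; rewrite ?index_weight_ge0 ?index_weight_le1 //.
  have iB : rint P \1_B by exact: integrable_indic.
  have mB' : measurable_fun (setT : set (TG K)) (\1_B : Om -> R).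
    exact: (measurable_indic (T := TG K)).
  have h := indep_RintegralM Fm Km IH mw mB' iw iB.
  have iAB := indep_integrableM Fm Km IH mw mB' iw iB.
  have -> : P B = (\int[P]_w (\1_B w : R)%:E)%E by rewrite integral_indic // setIT.
  rewrite -(EFin_Rintegral iw) -(EFin_Rintegral iB) -EFinM -h (EFin_Rintegral iAB).
  apply: eq_integral => w _.
  by rewrite -mulrA indicI.
move=> A B FA; apply: GK; move: A FA.
apply: smallest_sub; first exact: smallest_sigma_algebra.
move=> A [[s Js As]|[k' /andP[h1 h2] hA]].
  apply: sub_gen_smallest; exists A; last by exists None; rewrite /X setIT.
  by apply: sub_gen_smallest; left; exists s.
have [k'k|] := ltnP k' k.
  apply: sub_gen_smallest; exists A; last by exists None; rewrite /X setIT.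
  by apply: sub_gen_smallest; right; exists k' => //; rewrite h1.
rewrite leq_eqVlt ltnNge -ltnS h2 orbF => /eqP kk'.
case: hA => C _ <-; rewrite setTI -kk'.
rewrite (_ : _ @^-1` C = \bigcup_(i in C) (pz_R r k @^-1` [set i])); last first.
  by apply/seteqP; split => [w Cw|w [i Ci /= ->]] //=; exists (pz_R r k w).
apply: (@bigcup_measurable _ (g_sigma_algebraType G)) => i _.
apply: sub_gen_smallest; exists setT; first exact: (@measurableT _ (TF k J)).
by exists (Some i); rewrite /X setTI.
Qed.

End Past.

Section Iterates.
Variables (R : realType) (n q : nat) (dz : measure_display).
Variables (Z : measurableType dz) (pb : problem R n q Z) (st : settings R n).
Variables (d : measure_display) (Om : measurableType d) (P : probability Om R).
Variables (N : nat) (r : pz_data R n Z Om).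
Hypothesis as1 : AS1 pb.
Hypothesis as5 : AS5 pb.
Hypothesis hst : settings_valid pb st.
Hypothesis run : pz_run pb st P N r.
Local Notation SE := (sample_events r).
Local Notation TF k J := (g_sigma_algebraType (past_gens r k J)).

Lemma run_fresh : fresh_samples pb P r. Proof. by case: run. Qed.

Lemma run_history k : (1 <= k < N)%N ->
  history_measurable r k (pz_rho r k) /\ history_measurable r k (pz_nbar r k).
Proof. by case: run => _ _ h /h[[]]. Qed.

Lemma run_uniform k : (1 <= k < N)%N -> uniform_index pb st P r k.
Proof. by case: run => _ _ h /h[]. Qed.

Lemma rho_lower k w : (k < N)%N -> rho0 st + k%:R * tau st <= pz_rho r k w.
Proof.
case: run => _ h0 h; elim: k => [|k IH] kN.
  by have [_ _ -> _] := h0 w; rewrite mul0r addr0.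
have [_ /(_ w)[h1 _] _ _ _] := h k.+1 kN.
have := IH (ltnW kN); rewrite -natr1 /= in h1 *; lra.
Qed.

Lemma rho_gt0 k w : (k < N)%N -> 0 < pz_rho r k w.
Proof.
move=> kN; apply: lt_le_trans (rho_lower w kN).
case: hst => _ _ h1 h2 _; apply: ltr_wpDr; last exact: lt_le_trans h1.
by rewrite mulr_ge0 ?(ltW h2).
Qed.

Definition before k : set (sample_index n) := [set s | (stage s < k)%N].
Definition before_inner k j : set (sample_index n) :=
  [set s | (stage s < k)%N \/ stage s = k /\ (inner s < j)%N].

Lemma before_innerS k j j' : (j <= j')%N -> before_inner k j `<=` before_inner k j'.
Proof.
by move=> jj' s [sk|[sk sj]]; [left|right; split => //; exact: leq_trans jj'].
Qed.

Lemma before_inner_next k j : before_inner k j `<=` before k.+1.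
Proof. by move=> s [sk|[<- _]]; rewrite /before/= ltnS // ltnW. Qed.

Lemma before_before_inner k j : before k `<=` before_inner k j.
Proof. by move=> s sk; left. Qed.

Lemma sample_past k s (J : set (sample_index n)) d' (U : measurableType d') (X : Om -> U) :
  J s -> (forall B, measurable B -> SE s (X @^-1` B)) ->
  measurable_fun (setT : set (TF k J)) X.
Proof.
move=> Js h _ B mB; rewrite setTI; apply: sub_gen_smallest; left; exists s => //.
exact: h.
Qed.

(** y_j uses the samples of iterations before j, its batch also those of iteration j; this shift
    makes y_j independent of the samples drawn at it. Both claims go through one induction, the next
    iterate being the minimizer built from y_j and its batch. *)
Lemma inner_iterate_measurable k : (1 <= k < N)%N ->
  @random_vector R _ (TF k (before k)) n (pz_x r k) ->
  forall j, (1 <= j)%N ->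
  @random_vector R _ (TF k (before_inner k j)) n (pz_y r k j) /\
  @random_vector R _ (TF k (before_inner k j.+1)) n (Gbatch pb st r k j).
Proof.
move=> kN mx; have [hr hn] := run_history kN.
have kN' : (k < N)%N by case/andP: kN.
have [_ _ /(_ _ kN)[[_ hmu _] _ _ _ path]] := run.
have mG j : (1 <= j)%N -> @random_vector R _ (TF k (before_inner k j)) n (pz_y r k j) ->
    @random_vector R _ (TF k (before_inner k j.+1)) n (Gbatch pb st r k j).
  move=> j1 my; have sub := @before_before_inner k j.+1.
  apply: (random_vector_sz_batch as5).
  - exact: history_past hmu.
  - by apply: (past_batch pb st run_history).
  - by move=> l; apply: past_measurableS (my l) => //; exact: before_innerS.
  - move=> i; apply: (@sample_past _ (inl (k, j, i))); first by right => /=.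
    by move=> B mB; exists B => //; rewrite setTI.
  - move=> i l; apply: (@sample_past _ (inr ((k, j, i), l))); first by right => /=.
    by move=> B mB; exists B => //; rewrite setTI.
elim=> [//|[_ _|j IH _]].
  have my : @random_vector R _ (TF k (before_inner k 1)) n (pz_y r k 1).
    move=> l; rewrite (_ : (fun w => _) = fun w => pz_x r k w l 0).
      by apply: past_measurableS (mx l) => //; exact: before_before_inner.
    by apply/funext => w; have [[-> _] _ _] := path w.
  by split => //; exact: mG.
have [my mg] := IH isT; have sub := @before_before_inner k j.+2.
have my' : @random_vector R _ (TF k (before_inner k j.+2)) n (pz_y r k j.+2).
  apply: (@random_vector_minimizer _ _ _ _ _ _ as1 _ (TF k (before_inner k j.+2)) (pz_y r k j.+1) (Gbatch pb st r k j.+1) _ (pz_rho r k)).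
  - by move=> l; apply: past_measurableS (my l) => //; exact: before_innerS.
  - exact: mg.
  - exact: history_past hr.
  - by move=> w; exact: rho_gt0.
  - by move=> w; have [[_ h] _ _] := path w; exact: h.
by split => //; exact: mG.
Qed.

(** The next x is picked among the inner iterates by R_k, which belongs to the past from call k + 1
    on. This is why the past contains the earlier indices besides the samples. *)
Lemma iterate_measurable k : (1 <= k <= N)%N ->
  @random_vector R _ (TF k (before k)) n (pz_x r k).
Proof.
elim: k => [//|[_ _|k IH kN]].
  move=> l; rewrite (_ : (fun w => _) = fun=> x1 st l 0); first exact: measurable_cst.
  by apply/funext => w; case: run => _ /(_ w)[-> _ _ _] _.
have kN' : (1 <= k.+1 < N)%N by case/andP: kN.
have my := inner_iterate_measurable kN' (IH (ltnW kN)).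
have [mR R1 _] := run_uniform kN'.
(* [maxn 1] redirects the value 0, which R never takes: the iterate numbered 0 is arbitrary and
   might not be measurable. *)
move=> l; rewrite (_ : (fun w => _) = fun w => pz_y r k.+1 (maxn 1 (pz_R r k.+1 w)) w l 0); last first.
  apply/funext => w; case: run => _ _ /(_ _ kN')[_ _ _ _ /(_ w)[_ -> _]].
  by have /andP[h _] := R1 w; rewrite (maxn_idPr h).
apply: (@measurable_select_nat _ (TF k.+2 (before k.+2)) _ _ (pz_R r k.+1) (fun j w => pz_y r k.+1 (maxn 1 j) w l 0)).
  move=> _ B mB; rewrite setTI; apply: sub_gen_smallest; right; exists k.+1; first by rewrite /= ltnSn.
  by exists B => //; rewrite setTI.
move=> j; have [h _] := my (maxn 1 j) (leq_maxl _ _).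
by apply: past_measurableS (h l) => //; exact: before_inner_next.
Qed.

End Iterates.

(** * Averaging over the random index *)

Section IndexAveraging.
Variables (R : realType) (n q : nat) (dz : measure_display).
Variables (Z : measurableType dz) (pb : problem R n q Z) (st : settings R n).
Variables (d : measure_display) (Om : measurableType d) (P : probability Om R).
Variables (N : nat) (r : pz_data R n Z Om).
Hypothesis run : pz_run pb st P N r.
Variable k : nat.
Hypothesis kN : (1 <= k < N)%N.
Local Notation SE := (sample_events r).
Local Notation TF := (g_sigma_algebraType (past_gens r k setT)).
Local Notation wt := (index_weight pb st r k).

Let Fm : past_gens r k setT `<=` d.-measurable.
Proof.
apply: (past_gens_measurable (run_fresh run) (run_uniform run)).
by case/andP: kN => _ /ltnW.
Qed.

Let mR : measurable_fun setT (pz_R r k).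
Proof. by have [h _ _] := run_uniform run kN. Qed.

Let mRj j : d.-measurable (pz_R r k @^-1` [set j]).
Proof. by rewrite -[X in measurable X]setTI; exact: mR. Qed.

Let mwt j : measurable_fun (setT : set TF) (wt j).
Proof. by apply: (past_index_weight pb st (run_history run)). Qed.

(** On the sigma-algebra of all samples and earlier indices, P restricted to R = j has density
    [wt j]: this is the conditional law required by [uniform_index]. *)
Lemma index_weight_integral (f : Om -> \bar R) j :
  measurable_fun (setT : set TF) f -> (forall w, 0 <= f w)%E ->
  (\int[P]_(w in pz_R r k @^-1` [set j]) f w = \int[P]_w (f w * (wt j w)%:E))%E.
Proof.
move=> mf f0; have mf' := sub_measurable_fun Fm mf.
have mid := measurable_id_sub Fm.
rewrite integral_mkcond.
transitivity (\int[P]_w (f w * (\1_(pz_R r k @^-1` [set j]) w : R)%:E))%E.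
  apply: eq_integral => w _; rewrite patchE indicE.
  by case: ifP => _; rewrite ?mule1 ?mule0.
rewrite -(@ge0_integral_density _ _ _ P (mrestr P (mRj j))) //; last first.
  move=> A mA; rewrite /mrestr integral_mkcond (eq_integral (fun w => (\1_(A `&` pz_R r k @^-1` [set j]) w)%:E)).
    by rewrite integral_indic ?setIT //; exact: measurableI.
  by move=> w _; rewrite patchE indicI /= !indicE; case: ifP => _; rewrite ?mul1r ?mul0r.
(* The density identity is available for events of [TF], so both measures are pushed to that coarser
   space by the identity map. *)
transitivity (\int[pushforward (mrestr P (mRj j)) (id : Om -> TF)]_w f w)%E.
  by rewrite ge0_integral_pushforward // preimage_setT.
rewrite (@ge0_integral_density _ _ _ (pushforward P (id : Om -> TF)) _ (wt j)) //; last 2 first.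
- exact: index_weight_ge0.
- move=> A mA; have [_ _ RE] := run_uniform run kN; rewrite [LHS](RE A j).
    rewrite [RHS]ge0_integral_pushforward //.
      by apply/measurable_EFinP; apply: measurable_funTS.
    by move=> w _; rewrite lee_fin index_weight_ge0.
  by apply: (past_samples_history (J := setT)).
rewrite ge0_integral_pushforward ?preimage_setT //.
- by apply: emeasurable_funM => //; exact/measurable_EFinP.
- by move=> w _; rewrite mule_ge0 // lee_fin index_weight_ge0.
Qed.

Definition index_mean (f : nat -> Om -> R) w : R :=
  (Nin pb st r k w)%:R^-1 * \sum_(1 <= j < (Nin pb st r k w).+1) f j w.

(** The number of terms is random. As a series over all j, with weights vanishing beyond N_in, the
    mean can be integrated term by term. *)
Lemma index_meanE (f : nat -> Om -> R) w : (forall j, 0 <= f j w) ->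
  ((index_mean f w)%:E = \sum_(j <oo) (f j w * wt j w)%:E)%E.
Proof.
move=> f0; set m := Nin pb st r k w.
rewrite (nneseries_split 0 m.+1); last first.
  by move=> j _; rewrite lee_fin mulr_ge0 ?index_weight_ge0.
rewrite add0n [X in (_ + X)%E]eseries0 ?adde0; last first.
  by move=> j mj _; rewrite /index_weight -/m [(j <= m)%N]leqNgt mj andbF mulr0.
rewrite sumEFin /index_mean -/m [in RHS]big_ltn // [wt 0%N w]/index_weight mulr0 add0r mulr_sumr.
congr (_%:E); apply: eq_big_nat => j; rewrite ltnS => hj.
by rewrite /index_weight -/m hj mulrC.
Qed.

Lemma index_mean_integral (f : nat -> Om -> R) : (forall j, measurable_fun (setT : set TF) (f j)) ->
  (forall j w, 0 <= f j w) ->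
  (\int[P]_w (index_mean f w)%:E = \sum_(j <oo) \int[P]_w (f j w * wt j w)%:E)%E.
Proof.
move=> mf f0; under eq_integral do rewrite index_meanE //.
apply: integral_nneseries => // [j|j w _]; last by rewrite lee_fin mulr_ge0 ?index_weight_ge0.
apply/measurable_EFinP; apply: (sub_measurable_fun Fm); exact: measurable_funM.
Qed.

Lemma uniform_index_integral (f : nat -> Om -> R) : (forall j, measurable_fun (setT : set TF) (f j)) ->
  (forall j w, 0 <= f j w) ->
  (\int[P]_w (f (pz_R r k w) w)%:E = \int[P]_w (index_mean f w)%:E)%E.
Proof.
move=> mf f0; rewrite index_mean_integral //.
have RT : [set: Om] = \bigcup_j (pz_R r k @^-1` [set j]).
  by apply/seteqP; split => // w _; exists (pz_R r k w).
rewrite [in LHS]RT ge0_integral_bigcup //; last 3 first.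
- apply/measurable_EFinP; apply: measurable_funTS.
  by apply: measurable_select_nat => // j; exact: (sub_measurable_fun Fm).
- by move=> w _; rewrite lee_fin.
- by move=> i j _ _ [w [/= <- ->]].
apply: eq_eseriesr => j _; under [RHS]eq_integral do rewrite EFinM.
rewrite -index_weight_integral //; last by move=> w; rewrite lee_fin.
  by apply: eq_integral => w; rewrite inE /= => ->.
exact/measurable_EFinP.
Qed.

Lemma Nin_gt0 w : (0 < Nin pb st r k w)%N.
Proof. by have [_ /(_ w)/andP[h1 h2] _] := run_uniform run kN; exact: leq_trans h2. Qed.

Lemma index_mean_cst (c : Om -> R) w : index_mean (fun=> c) w = c w.
Proof.
rewrite /index_mean sumr_const_nat subSS subn0 -[c w *+ _]mulr_natl mulrA mulVf ?mul1r //.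
by rewrite pnatr_eq0 -lt0n Nin_gt0.
Qed.

(** Since B fails at the drawn index, the indicator of [B j] has null integral over R = j, that is,
    against [wt j]; and [wt j] is positive for 1 <= j <= N_in. *)
Lemma uniform_index_ae (B : nat -> Om -> Prop) :
  (forall j, <<s past_gens r k setT >> (B j)) -> {ae P, forall w, ~ B (pz_R r k w) w} ->
  forall j, {ae P, forall w, (1 <= j <= Nin pb st r k w)%N -> ~ B j w}.
Proof.
move=> mB aeB j.
have mb : measurable_fun (setT : set TF) (fun w => (\1_(B j) w : R)).
  exact: (measurable_indic (T := TF) (mB j)).
have := @index_weight_integral (fun w => (\1_(B j) w)%:E) j.
rewrite (ae_eq_integral (cst 0%E)) //; last 2 first.
- apply/measurable_EFinP; apply: measurable_funTS; exact: (sub_measurable_fun Fm mb).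
- apply: filterS aeB => w h /= Rj; rewrite Rj in h.
  by rewrite indicE memNset.
rewrite integral0 => h.
have {}h : (\int[P]_w `|(\1_(B j) w * wt j w)%:E| = 0)%E.
  rewrite h; [|exact/measurable_EFinP|by move=> w; rewrite lee_fin].
  by apply: eq_integral => w _; rewrite -EFinM abse_EFin ger0_norm // mulr_ge0 // index_weight_ge0.
have mbw : measurable_fun setT (fun w => (\1_(B j) w * wt j w)%:E).
  by apply/measurable_EFinP; apply: (sub_measurable_fun Fm); exact: measurable_funM.
move/(ae_eq_integral_abs P measurableT mbw): h; apply: filterS => w /(_ I)/eqP.
rewrite /= eqe /index_weight => + jw Bw; rewrite jw indicE mem_set // mul1r invr_eq0.
by rewrite pnatr_eq0 -leqn0 leqNgt (leq_trans _ (proj2 (andP jw))) //; case/andP: jw.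
Qed.

End IndexAveraging.

(** * Batch error along one call *)

Section InnerError.
Variables (R : realType) (n q : nat) (dz : measure_display).
Variables (Z : measurableType dz) (pb : problem R n q Z) (st : settings R n).
Variables (d : measure_display) (Om : measurableType d) (P : probability Om R).
Variables (N : nat) (r : pz_data R n Z Om).
Hypothesis as1 : AS1 pb.
Hypothesis as5 : AS5 pb.
Hypothesis hst : settings_valid pb st.
Hypothesis run : pz_run pb st P N r.
Variable k : nat.
Hypothesis kN : (1 <= k < N)%N.
Hypothesis batch_gt0 : forall w, (0 < batch pb st r k w)%N.
Local Notation SE := (sample_events r).
Local Notation wt := (index_weight pb st r k).
Local Notation m := (batch pb st r k).

Definition sq_error j w : R :=
  enorm (Gbatch pb st r k j w - grad (obj pb) (pz_y r k j w)) ^+ 2.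

(* Sampling noise of the batch mean plus smoothing bias. *)
Definition error_level w : R :=
  6 * n%:R * (kg st ^+ 2 + sigma pb ^+ 2) / (m w)%:R
    + 15 / 2 * (Lg pb * pz_mu r k w) ^+ 2 * n%:R ^+ 3.

Lemma error_level_ge0 w : 0 <= error_level w.
Proof.
have h6 : 0 <= 6 * n%:R :> R by rewrite mulr_ge0.
apply: addr_ge0.
  by apply: divr_ge0 => //; apply: mulr_ge0 => //; rewrite addr_ge0 ?sqr_ge0.
by apply: mulr_ge0; [apply: mulr_ge0; [lra|exact: sqr_ge0]|exact: exprn_ge0].
Qed.

Let kN' : (k <= N)%N. Proof. by case/andP: kN => _ /ltnW. Qed.

Let hmu : history_measurable r k (pz_mu r k).
Proof. by have [_ _ /(_ _ kN)[[_ ? _] _ _ _ _]] := run. Qed.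

Let mu_gt0 w : 0 < pz_mu r k w.
Proof. by have [_ _ /(_ _ kN)[_ _ ? _ _]] := run. Qed.

Let Fm J : past_gens r k J `<=` d.-measurable.
Proof. exact: (past_gens_measurable (run_fresh run) (run_uniform run)). Qed.

Let Gm K : gens SE K `<=` d.-measurable.
Proof. by apply: gens_measurable; exact: (sample_events_measurable (run_fresh run)). Qed.

Lemma past_error_level J : before k `<=` J ->
  measurable_fun (setT : set (g_sigma_algebraType (past_gens r k J))) error_level.
Proof.
move=> hJ; apply: measurable_funD; apply: measurable_funM => //.
  by apply: measurable_fun_invr; apply: measurable_of_nat;
     apply: (past_batch pb st (run_history run)).
apply: measurable_funM => //; apply: measurable_funX; apply: measurable_funM => //.
exact: history_past hmu.
Qed.

(** Iterate, smoothing parameter, batch size and weight depend on the past of iteration j and are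
    frozen by [ge0_decoupling]; the fresh samples are then averaged at a fixed point. The weight is
    kept inside because the properties of the iterate are known for j <= N_in, and elsewhere it is
    zero. *)
Lemma weighted_error j : (1 <= j)%N ->
  {ae P, forall w, (j <= Nin pb st r k w)%N ->
     AS4_at pb (pz_y r k j w) /\ enorm (grad (obj pb) (pz_y r k j w)) <= kg st} ->
  (\int[P]_w (sq_error j w * wt j w)%:E <= \int[P]_w (error_level w * wt j w)%:E)%E.
Proof.
move=> j1 good; pose J := @before_inner n k j.
pose K : set (sample_index n) := [set s | stage s = k /\ inner s = j].
have kN1 : (1 <= k <= N)%N by rewrite kN' andbT; case/andP: kN.
have [my _] := inner_iterate_measurable as1 as5 hst run kN (iterate_measurable as1 as5 hst run kN1) j1.
have hJ : before k `<=` J := @before_before_inner n k j.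
have JK : J `&` K = set0.
  apply/seteqP; split => // s [h [sk sj]]; move: h => [|[_]] /=.
    by rewrite sk ltnn.
  by rewrite sj ltnn.
have FG : indep P <<s past_gens r k J >> <<s gens SE K >>.
  exact: (past_independent (run_fresh run) (run_history run) (run_uniform run)).
have mmu := history_past hJ hmu.
have mm : measurable_fun (setT : set (g_sigma_algebraType (past_gens r k J))) m.
  by apply: (past_batch pb st (run_history run)).
have mw : measurable_fun (setT : set (g_sigma_algebraType (past_gens r k J))) (wt j).
  by apply: (past_index_weight pb st (run_history run)).
have mxi i : measurable_fun (setT : set (g_sigma_algebraType (gens SE K))) (pz_xi r k j i).
  move=> _ B mB; rewrite setTI; apply: sub_gen_smallest; exists (inl (k, j, i)) => //.
  by exists B => //; rewrite setTI.
have mv i : @random_vector R _ (g_sigma_algebraType (gens SE K)) n (pz_v r k j i).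
  move=> l _ B mB; rewrite setTI; apply: sub_gen_smallest; exists (inr ((k, j, i), l)) => //.
  by exists B => //; rewrite setTI.
pose e (w w' : Om) := batch_error pb r k j (pz_y r k j w) (pz_mu r k w) (m w) w'.
pose h (z : g_sigma_algebraType (past_gens r k J) * g_sigma_algebraType (gens SE K)) :=
  (e z.1 z.2 * wt j z.1)%:E.
have h0 z : (0 <= h z)%E.
  by rewrite lee_fin mulr_ge0 ?index_weight_ge0 // sqr_ge0.
have mh : measurable_fun setT h.
  apply/measurable_EFinP; apply: measurable_funM; last first.
    exact: (measurableT_comp mw measurable_fst).
  have my' : random_vector (fun z : g_sigma_algebraType (past_gens r k J) * g_sigma_algebraType (gens SE K) => pz_y r k j z.1).
    by move=> l; exact: (measurableT_comp (my l) measurable_fst).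
  apply: measurable_funX; apply: measurable_enorm; apply: random_vectorB; last first.
    exact: random_vector_grad.
  apply: (random_vector_sz_batch as5) => //.
  - exact: (measurableT_comp mmu measurable_fst).
  - exact: (measurableT_comp mm measurable_fst).
  - by move=> i; exact: (measurableT_comp (mxi i) measurable_snd).
  - by move=> i l; exact: (measurableT_comp (mv i l) measurable_snd).
have -> : (\int[P]_w (sq_error j w * wt j w)%:E = \int[P]_w \int[P]_w' h (w, w'))%E.
  exact: (ge0_decoupling (@Fm J) (@Gm K) FG mh h0).
apply: ae_ge0_le_integral => //.
- by move=> w _; apply: integral_ge0.
- exact: (measurable_decoupled P (@Fm J) (@Gm K) mh h0).
- by move=> w _; rewrite lee_fin mulr_ge0 ?index_weight_ge0 ?error_level_ge0.
- apply/measurable_EFinP; apply: (sub_measurable_fun (@Fm J)).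
  by apply: measurable_funM => //; exact: past_error_level.
apply: filterS good => w hw _; rewrite /h /=.
under eq_integral do rewrite EFinM.
have me : measurable_fun setT (fun w' => (e w w')%:E).
  apply/measurable_EFinP; apply: (sub_measurable_fun (@Gm K)).
  apply: measurable_funX; apply: measurable_enorm; apply: random_vectorB; last first.
    exact: random_vector_cst.
  by apply: (random_vector_sz_batch as5) => //; exact: random_vector_cst.
rewrite ge0_integralZr //; last 2 first.
- by move=> w' _; rewrite lee_fin sqr_ge0.
- by rewrite lee_fin index_weight_ge0.
rewrite EFinM /index_weight; case: ifP => [/andP[_ jw]|_]; last by rewrite !mule0.
apply: lee_pmul => //.
  by apply: integral_ge0 => w' _; rewrite lee_fin sqr_ge0.
have [a4 gy] := hw jw.
exact: (batch_error_expectation as1 as5 (run_fresh run) k j a4 gy (mu_gt0 w) (batch_gt0 w)).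
Qed.

End InnerError.

(** * Sizes prescribed for a call *)

Section CallSizes.
Variables (R : realType) (n q : nat) (dz : measure_display).
Variables (Z : measurableType dz) (pb : problem R n q Z) (st : settings R n).

Lemma natceil_ge (x : R) : x <= (natceil x)%:R.
Proof.
apply: le_trans (ceil_ge x) _; rewrite -[leRHS](_ : (`|Num.ceil x|%N%:Z)%:~R = _) //.
by rewrite ler_int lez_abs.
Qed.

Lemma natceil_lt (x : R) : 0 <= x -> (natceil x)%:R < x + 1.
Proof.
move=> x0; rewrite -[ltLHS](_ : (`|Num.ceil x|%N%:Z)%:~R = _) //.
have c0 : (0 <= Num.ceil x)%R by rewrite -(ceil0 R); exact: le_ceil.
by rewrite gez0_abs // -ltrBlDr; have := gt_pred_ceil x; rewrite intrB; apply.
Qed.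

Lemma natceil_le_nat (x : R) k : 0 <= x -> x <= k%:R -> (natceil x <= k)%N.
Proof.
move=> x0 xk; rewrite -ltnS -(ltr_nat R) -natr1.
by apply: lt_le_trans (natceil_lt x0) _; rewrite lerD2r.
Qed.

Hypothesis as1 : AS1 pb.
Hypothesis hst : settings_valid pb st.
Variables (eps rho mu : R) (x : 'cV[R]_n) (nb : nat).
Hypothesis low : Phi_low_valid pb.
Hypothesis rho0 : 0 < rho.
Hypothesis eps0 : 0 < eps.
Hypothesis nb_ge : Nbar_bound pb st eps rho x <= nb%:R.

Local Notation L := (Lrho pb rho).
Local Notation D := (Dphi pb rho x).
Local Notation m := (batch_size pb st nb rho).
Local Notation s := (Num.sqrt (D2 st)).
Local Notation b := (Num.sqrt (nb%:R : R)).
Let Ni := natceil (nb%:R / m%:R : R).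

Let Lp : 0 < L. Proof. exact: Lrho_gt0. Qed.

Let LgL : Lg pb <= L.
Proof. by case: as1 => _ _ _ [h1 h2] _; rewrite /Lrho lerDl mulr_ge0 // ltW. Qed.

Let D2p : 0 < D2 st. Proof. by case: hst => _ _ _ _ []. Qed.
Let D1p : 0 < D1 st. Proof. by case: hst => _ _ _ _ []. Qed.
Let sp : 0 < s. Proof. by rewrite sqrtr_gt0. Qed.

Lemma Dphi_ge0 : 0 <= D.
Proof. by have [_ h] := low rho0; rewrite /Dphi subr_ge0. Qed.

(** The purpose of the second entry of the maximum: it gives (1/L) sqrt(nb/D2) <= nb, so that the
    batch size is the ceiling of max(1, (1/L) sqrt(nb/D2)). *)
Lemma nbar_ge_inv : (L ^+ 2 * D2 st)^-1 <= nb%:R.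
Proof. by apply: le_trans nb_ge; rewrite le_max lexx orbT. Qed.

Lemma nbar_gt0 : (0 < nb)%N.
Proof.
rewrite -(ltr_nat R); apply: lt_le_trans nbar_ge_inv.
by rewrite invr_gt0 mulr_gt0 ?exprn_gt0.
Qed.

Let nbp : (0 : R) < nb%:R. Proof. by rewrite ltr0n nbar_gt0. Qed.
Let bp : 0 < b. Proof. by rewrite sqrtr_gt0. Qed.
Let b2 : b ^+ 2 = nb%:R. Proof. by rewrite sqr_sqrtr // ltW. Qed.
Let s2 : s ^+ 2 = D2 st. Proof. by rewrite sqr_sqrtr // ltW. Qed.

Let aE : L^-1 * Num.sqrt (nb%:R / D2 st) = b / (s * L).
Proof. by rewrite sqrtrM ?ler0n // sqrtrV ?(ltW D2p) // invfM mulrC mulrA. Qed.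

Let a_le : b / (s * L) <= nb%:R.
Proof.
rewrite ler_pdivrMr ?mulr_gt0 // -[X in _ <= X * _]b2 expr2 -mulrA ler_peMr ?(ltW bp) //.
have h : 1 <= (b * (s * L)) ^+ 2.
  rewrite !exprMn b2 s2; have := nbar_ge_inv.
  by rewrite -[(_ * _)^-1]mul1r ler_pdivrMr ?mulr_gt0 ?exprn_gt0 // [L ^+ 2 * _]mulrC.
have p : 0 < b * (s * L) by rewrite !mulr_gt0.
by rewrite -(ler_pXn2r (n := 2)) ?expr1n // nnegrE ltW.
Qed.

Let mE : m = natceil (Num.max 1 (b / (s * L))).
Proof.
rewrite /batch_size aE min_r // ge_max a_le andbT.
by rewrite ler1n nbar_gt0.
Qed.

Let max1_ge0 : 0 <= Num.max 1 (b / (s * L)). Proof. by rewrite le_max ler01. Qed.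

Lemma batch_size_gt0 : (0 < m)%N.
Proof.
rewrite -(ltr_nat R) mE; apply: lt_le_trans (natceil_ge _).
by rewrite lt_max ltr01.
Qed.

Let mp : (0 : R) < m%:R. Proof. by rewrite ltr0n batch_size_gt0. Qed.

Lemma batch_size_le : (m <= nb)%N.
Proof. by rewrite mE natceil_le_nat // ge_max a_le andbT ler1n nbar_gt0. Qed.

Let m_ge : b / (s * L) <= m%:R.
Proof. by rewrite mE; apply: le_trans (natceil_ge _); rewrite le_max lexx orbT. Qed.

Let ap : 0 < b / (s * L). Proof. by rewrite divr_gt0 ?mulr_gt0. Qed.

Let m_le : m%:R <= 1 + b / (s * L).
Proof.
rewrite mE; case: (leP 1 (b / (s * L))) => h.
  by rewrite addrC; apply/ltW/natceil_lt; exact: ltW.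
have : (natceil (1 : R) <= 1)%N by apply: natceil_le_nat.
by rewrite -(ler_nat R) => /le_trans; apply; rewrite lerDl ltW.
Qed.

(** m times the ceiling of nb/m is at most nb + m, and m <= nb. *)
Lemma calls_le : (m * Ni <= 2 * nb)%N.
Proof.
rewrite -(ler_nat R) natrM.
have : Ni%:R < nb%:R / m%:R + 1 :> R by apply: natceil_lt; rewrite divr_ge0.
rewrite -(ltr_pM2l mp) mulrDr mulr1 [m%:R * (_ / _)]mulrC divfK ?gt_eqF // => h.
have : m%:R <= nb%:R :> R by rewrite ler_nat batch_size_le.
rewrite natrM => h'; lra.
Qed.

Let invNi : Ni%:R^-1 <= (1 + b / (s * L)) / b ^+ 2.
Proof.
have h : nb%:R / m%:R <= Ni%:R :> R := natceil_ge _.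
have p : 0 < nb%:R / m%:R :> R by rewrite divr_gt0.
apply: (@le_trans _ _ (nb%:R / m%:R)^-1).
  by rewrite lef_pV2 // posrE // (lt_le_trans p).
by rewrite invf_div b2 ler_pM2r ?invr_gt0.
Qed.

Hypothesis mu_gt0 : 0 < mu.
Hypothesis mu_le : mu <= Num.sqrt (D1 st / nb%:R).

Let mu2 : mu ^+ 2 <= D1 st / b ^+ 2.
Proof.
rewrite b2 -[leRHS]sqr_sqrtr ?divr_ge0 // ?(ltW D1p) //.
by rewrite ler_pXn2r // nnegrE ?sqrtr_ge0 // ltW.
Qed.

(** The lower bound on nb has the form (A/eps)^2 + B/eps, so A/sqrt(nb) <= eps and B/nb <= eps. The
    batch size sqrt(nb)/(s L) balances the descent term against the sampling noise, both
    O(1/sqrt(nb)); rounding and smoothing are O(1/nb). *)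
Lemma call_accuracy : 4 * L * D / Ni%:R
  + 5 * (6 * n%:R * (kg st ^+ 2 + sigma pb ^+ 2) / m%:R
         + 15 / 2 * (Lg pb * mu) ^+ 2 * n%:R ^+ 3) <= 2 / 5 * eps.
Proof.
have Lg0 : 0 < Lg pb by case: as1 => _ _ _ [].
have D0 := Dphi_ge0.
set V := kg st ^+ 2 + sigma pb ^+ 2; set n4 : R := (n + 4)%:R.
have V0 : 0 <= V by rewrite addr_ge0 ?sqr_ge0.
have nn : 0 <= n%:R :> R by [].
have n4E : n4 = n%:R + 4 by rewrite /n4 natrD.
pose A := 64 * D / s + 4 * L * Ctilde1 pb st.
pose B := 448 * L * Lg pb * D1 st * n4 ^+ 3 + 256 * L * D.
have AE : A = 64 * D / s + 96 * n4 * V * (s * L) by rewrite /A /Ctilde1 -/V -/n4; ring.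
have A0 : 0 <= A.
  rewrite AE addr_ge0 //; first by rewrite divr_ge0 ?mulr_ge0 ?(ltW sp).
  by rewrite !mulr_ge0 ?(ltW sp) ?(ltW Lp) // n4E addr_ge0.
have t1 : 0 <= L * Lg pb * D1 st * n4 ^+ 3.
  by rewrite !mulr_ge0 ?(ltW Lp) ?(ltW Lg0) ?(ltW D1p) // n4E addr_ge0.
have LD : 0 <= L * D by rewrite mulr_ge0 ?(ltW Lp).
have B0 : 0 <= B by rewrite /B; nra.
have nbAB : A ^+ 2 / eps ^+ 2 + B / eps <= nb%:R.
  by apply: le_trans nb_ge; rewrite le_max lexx.
have Ab : A / b <= eps.
  rewrite ler_pdivrMr // mulrC -ler_pdivrMr //.
  have h : (A / eps) ^+ 2 <= b ^+ 2.
    rewrite b2 exprMn exprVn; apply: le_trans nbAB; rewrite lerDl.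
    by rewrite divr_ge0 // ltW.
  by rewrite -(ler_pXn2r (n := 2)) // nnegrE ?divr_ge0 // ltW.
have Bb : B / b ^+ 2 <= eps.
  rewrite ler_pdivrMr ?exprn_gt0 // mulrC -ler_pdivrMr // b2.
  by apply: le_trans nbAB; rewrite lerDr divr_ge0 ?sqr_ge0.
have e1 : 4 * L * D / Ni%:R <= 4 * (L * D) / b ^+ 2 + 4 * D / s / b.
  have -> : 4 * (L * D) / b ^+ 2 + 4 * D / s / b = 4 * L * D * ((1 + b / (s * L)) / b ^+ 2).
    by field; rewrite !gt_eqF.
  by rewrite ler_wpM2l // -mulrA mulr_ge0.
have e2 : 6 * n%:R * V / m%:R <= 6 * n4 * V * (s * L) / b.
  have h : m%:R^-1 <= s * L / b.
    rewrite -[leRHS]invrK invf_div lef_pV2 ?posrE //.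
  rewrite -mulrA [V / _]mulrC.
  have h1 : m%:R^-1 * V <= s * L / b * V by rewrite ler_wpM2r.
  have h2 : 6 * n%:R <= 6 * n4 by rewrite n4E; lra.
  have -> : 6 * n4 * V * (s * L) / b = 6 * n4 * (s * L / b * V) by ring.
  by apply: ler_pM => //; rewrite ?mulr_ge0 // invr_ge0.
have e3 : (Lg pb * mu) ^+ 2 * n%:R ^+ 3 <= L * Lg pb * D1 st * n4 ^+ 3 / b ^+ 2.
  have h1 : Lg pb ^+ 2 * mu ^+ 2 <= (L * Lg pb) * (D1 st / b ^+ 2).
    apply: ler_pM; rewrite ?sqr_ge0 //.
    by rewrite expr2 ler_wpM2r // ltW.
  have h2 : n%:R ^+ 3 <= n4 ^+ 3.
    by rewrite lerXn2r ?nnegrE ?n4E ?addr_ge0 // lerDl.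
  have -> : L * Lg pb * D1 st * n4 ^+ 3 / b ^+ 2 = (L * Lg pb) * (D1 st / b ^+ 2) * n4 ^+ 3 by ring.
  by apply: ler_pM => //; rewrite ?sqr_ge0 ?exprn_ge0 // exprMn.
(* The left side is at most u1 + 30 u2 + 75/2 u3 + 4 u4, while 16 u1 + 96 u2 <= eps and 448 u3 + 256
   u4 <= eps. The constant 2/5 comes from 30/96 + 75/896 < 2/5. *)
set u1 := 4 * D / s / b in e1 *.
set u2 := n4 * V * (s * L) / b.
set u3 := L * Lg pb * D1 st * n4 ^+ 3 / b ^+ 2 in e3.
set u4 := L * D / b ^+ 2.
have AbE : A / b = 16 * u1 + 96 * u2.
  by rewrite AE /u1 /u2; field; rewrite !gt_eqF.
have BbE : B / b ^+ 2 = 448 * u3 + 256 * u4 by rewrite /B /u3 /u4; field; rewrite gt_eqF.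
have {}e1 : 4 * L * D / Ni%:R <= 4 * u4 + u1 by rewrite /u4 mulrA.
have {}e2 : 6 * n%:R * V / m%:R <= 6 * u2 by apply: le_trans e2 _; rewrite /u2 !mulrA.
have u20 : 0 <= u2.
  by rewrite divr_ge0 ?(ltW bp) // !mulr_ge0 ?(ltW sp) ?(ltW Lp) // n4E addr_ge0.
have u30 : 0 <= u3 by rewrite divr_ge0 ?sqr_ge0.
have u40 : 0 <= u4 by rewrite divr_ge0 ?sqr_ge0.
have u10 : 0 <= u1 by rewrite !divr_ge0 ?mulr_ge0 ?(ltW sp) ?(ltW bp).
move: Ab Bb e1 e2 e3; rewrite AbE BbE -[15 / 2 * _ * _]mulrA.
move: (4 * L * D / Ni%:R) (6 * n%:R * V / m%:R) (_ * n%:R ^+ 3) => v1 v2 v3; lra.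
Qed.

End CallSizes.

(** * Accuracy of the output of a call *)

Section CallResidual.
Variables (R : realType) (n q : nat) (dz : measure_display).
Variables (Z : measurableType dz) (pb : problem R n q Z) (st : settings R n).
Variables (d : measure_display) (Om : measurableType d) (P : probability Om R).
Variables (eps : R) (N : nat) (r : pz_data R n Z Om).
Hypothesis as1 : AS1 pb.
Hypothesis as5 : AS5 pb.
Hypothesis low : Phi_low_valid pb.
Hypothesis hst : settings_valid pb st.
Hypothesis eps0 : 0 < eps.
Hypothesis adm : pz_admissible pb st P eps N r.
Variable k : nat.
Hypothesis kN : (1 <= k < N)%N.
Local Notation TF := (g_sigma_algebraType (past_gens r k setT)).
Local Notation Ni := (Nin pb st r k).
Local Notation L w := (Lrho pb (pz_rho r k w)).
Local Notation err := (sq_error pb st r k).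

Let run : pz_run pb st P N r. Proof. by case: adm. Qed.
Let kN' : (k < N)%N. Proof. by case/andP: kN. Qed.
Let kN1 : (1 <= k <= N)%N. Proof. by case/andP: kN => -> /ltnW. Qed.

Definition residual j w : R :=
  (L w * enorm (pz_y r k j.+1 w - pz_y r k j w)) ^+ 2 + err j w.

Lemma residual_ge0 j w : 0 <= residual j w.
Proof. by rewrite addr_ge0 ?sqr_ge0. Qed.

Lemma inner_step j w : (1 <= j)%N ->
  minimizer (sz_model pb (pz_rho r k w) (L w)^-1 (pz_y r k j w) (Gbatch pb st r k j w))
    (pz_y r k j.+1 w).
Proof.
by move=> j1; have [_ _ /(_ _ kN)[_ _ _ _ /(_ w)[[_ h] _ _]]] := run; exact: h.
Qed.

Lemma inner_measurable j : (1 <= j)%N ->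
  @random_vector R _ TF n (pz_y r k j) /\ @random_vector R _ TF n (Gbatch pb st r k j).
Proof.
move=> j1; have := inner_iterate_measurable as1 as5 hst run kN (iterate_measurable as1 as5 hst run kN1) j1.
by move=> [my mg]; split => l; [apply: past_measurableS (my l)|apply: past_measurableS (mg l)].
Qed.

Lemma measurable_sq_error j : (1 <= j)%N -> measurable_fun (setT : set TF) (err j).
Proof.
move=> j1; have [my mg] := inner_measurable j1.
apply: measurable_funX; apply: measurable_enorm; apply: random_vectorB => //.
exact: random_vector_grad.
Qed.

Lemma measurable_residual j : (1 <= j)%N -> measurable_fun (setT : set TF) (residual j).
Proof.
move=> j1; have [my mg] := inner_measurable j1.
have [my' _] := @inner_measurable j.+1 isT.
apply: measurable_funD; last exact: measurable_sq_error.
apply: measurable_funX; apply: measurable_funM.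
  apply: measurable_Lrho; apply: history_past => //.
  by have [] := run_history run kN.
by apply: measurable_enorm; exact: random_vectorB.
Qed.

(** Of the five errors, four come from [prox_descent] and one from the residual itself. The decrease
    telescopes from Phi at x_k down to a value above [Phi_low], whence [Dphi]. *)
Lemma residual_mean w : index_mean pb st r k residual w
  <= 4 * L w * Dphi pb (pz_rho r k w) (pz_x r k w) / (Ni w)%:R
     + 5 * index_mean pb st r k err w.
Proof.
have r0 := rho_gt0 hst run w kN'.
set F := fun j => Phi pb (pz_rho r k w) (pz_y r k j w).
have h j : (1 <= j < (Ni w).+1)%N -> residual j w <= 4 * L w * (F j - F j.+1) + 5 * err j w.
  move=> /andP[j1 _]; have := prox_descent as1 r0 (inner_step w j1).
  rewrite /residual /sq_error /F; lra.
have y1 : pz_y r k 1 w = pz_x r k w.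
  by have [_ _ /(_ _ kN)[_ _ _ _ /(_ w)[[-> _] _ _]]] := run.
have tel : \sum_(1 <= j < (Ni w).+1) (F j - F j.+1) <= Dphi pb (pz_rho r k w) (pz_x r k w).
  rewrite -[leLHS]opprK -sumrN (eq_bigr (fun j => F j.+1 - F j)); last by move=> j _; rewrite opprB.
  rewrite telescope_sumr // opprB /F y1 /Dphi lerD2l lerN2.
  by have [_ hh] := low r0; exact: hh.
have Ni0 : (0 : R) <= (Ni w)%:R^-1 by rewrite invr_ge0.
rewrite /index_mean (mulrC _ (_^-1)) [5 * _]mulrCA -mulrDr ler_wpM2l //.
apply: le_trans (ler_sum_nat h) _; rewrite big_split /= -!mulr_sumr lerD2r.
by rewrite ler_wpM2l // mulr_ge0 // ltW // Lrho_gt0.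
Qed.

Let nb_ge w : Nbar_bound pb st eps (pz_rho r k w) (pz_x r k w) <= (pz_nbar r k w)%:R.
Proof. by case: adm => _ _ _ h _; exact: h. Qed.

Lemma batch_gt0 w : (0 < batch pb st r k w)%N.
Proof. exact: (batch_size_gt0 as1 hst (rho_gt0 hst run w kN') (nb_ge w)). Qed.

Lemma call_accuracy_run w :
  4 * L w * Dphi pb (pz_rho r k w) (pz_x r k w) / (Ni w)%:R
    + 5 * error_level pb st r k w <= 2 / 5 * eps.
Proof.
apply: (call_accuracy as1 hst low (rho_gt0 hst run w kN') eps0 (nb_ge w)).
- by have [_ _ /(_ _ kN)[_ _ h _ _]] := run; exact: h.
- by case: adm => _ _ _ _ h; exact: h.
Qed.

Lemma inner_iterate_good j : (1 <= j)%N ->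
  {ae P, forall w, (j <= Ni w)%N ->
     AS4_at pb (pz_y r k j w) /\ enorm (grad (obj pb) (pz_y r k j w)) <= kg st}.
Proof.
move=> j1; have a4 : {ae P, forall w, (j <= Ni w)%N -> AS4_at pb (pz_y r k j w)}.
  by case: adm => _ h _ _ _; exact: h.
(* [maxn 1 i]: nothing constrains the iterate of index 0. *)
pose B i w := kg st < enorm (grad (obj pb) (pz_y r k (maxn 1 i) w)).
have mB i : <<s past_gens r k setT >> (B i).
  apply: (@measurable_ltr R _ TF) => //; apply: measurable_enorm.
  by apply: random_vector_grad => //; have [] := @inner_measurable (maxn 1 i) (leq_maxl _ _).
have aeB : {ae P, forall w, ~ B (pz_R r k w) w}.
  have [_ _ /(_ k.+1) ib _ _] := adm; have := ib _; rewrite kN' => /(_ isT).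
  apply: filterS => w [_ _ h _]; rewrite /B.
  have [_ _ /(_ _ kN)[_ _ _ [_ /(_ w)/andP[R1 _] _] /(_ w)[_ xR _]]] := run.
  by rewrite (maxn_idPr R1) -xR; apply/negP; rewrite -leNgt.
have := uniform_index_ae run kN mB aeB j; move: a4; apply: filterS2 => w h1 h2 jw.
split; first exact: h1.
rewrite leNgt; apply/negP => h; apply: h2; first by rewrite j1.
by rewrite /B (maxn_idPr j1).
Qed.

Lemma output_residual :
  (\int[P]_w (residual (pz_R r k w) w)%:E <= (2 / 5 * eps)%:E)%E.
Proof.
pose res j := residual (maxn 1 j); pose er j := err (maxn 1 j).
have Fm : past_gens r k setT `<=` d.-measurable.
  by apply: (past_gens_measurable (run_fresh run) (run_uniform run)); exact: ltnW.
have mres j : measurable_fun (setT : set TF) (res j) by apply: measurable_residual; exact: leq_maxl.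
have mer j : measurable_fun (setT : set TF) (er j) by apply: measurable_sq_error; exact: leq_maxl.
have mc : measurable_fun (setT : set TF) (error_level pb st r k) by exact: (past_error_level run).
have mean1 f : index_mean pb st r k (fun j => f (maxn 1 j)) =1 index_mean pb st r k f.
  move=> w; rewrite /index_mean; congr (_ * _); apply: eq_big_nat => j /andP[j1 _].
  by rewrite (maxn_idPr j1).
have -> : (\int[P]_w (residual (pz_R r k w) w)%:E = \int[P]_w (res (pz_R r k w) w)%:E)%E.
  apply: eq_integral => w _; have [_ /(_ w)/andP[R1 _] _] := run_uniform run kN.
  by rewrite /res (maxn_idPr R1).
rewrite (uniform_index_integral run kN mres); last by move=> *; exact: residual_ge0.
have er0 j w : 0 <= er j w by exact: sqr_ge0.
have c0 w : 0 <= error_level pb st r k w by exact: error_level_ge0.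
have mean0 (f : nat -> Om -> R) w : (forall j, 0 <= f j w) -> 0 <= index_mean pb st r k f w.
  by move=> f0; rewrite mulr_ge0 ?invr_ge0 ?sumr_ge0.
have mmean f : (forall j, measurable_fun (setT : set TF) (f j)) ->
    measurable_fun setT (index_mean pb st r k f).
  move=> mf; apply: (@measurable_select_nat _ _ _ _ Ni
      (fun i w => i%:R^-1 * \sum_(1 <= j < i.+1) f j w)).
    by apply: (sub_measurable_fun Fm); apply: (past_Nin pb st (run_history run)).
  move=> i; apply: measurable_funM => //; apply: measurable_sum => j.
  exact: (sub_measurable_fun Fm).
(* [t] dominates the [Dphi] term and is nonnegative by [call_accuracy_run]; since t plus 5 times the
   error level is the constant 2/5 eps, no possibly infinite expectations have to be subtracted. *)
pose t w := 2 / 5 * eps - 5 * error_level pb st r k w.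
have mt : measurable_fun setT t.
  by apply: measurable_funB => //; apply: measurable_funM => //; exact: (sub_measurable_fun Fm).
have t0 w : 0 <= t w.
  rewrite subr_ge0; apply: le_trans (call_accuracy_run w); rewrite lerDr.
  have r0 := rho_gt0 hst run w kN'.
  by rewrite divr_ge0 // mulr_ge0 ?(Dphi_ge0 _ low) // mulr_ge0 // ltW // Lrho_gt0.
(* The error level does not depend on j, so it is its own index mean; the two series are then
   compared term by term with the same weights. *)
have E1 : (\int[P]_w (index_mean pb st r k er w)%:E <= \int[P]_w (error_level pb st r k w)%:E)%E.
  rewrite (index_mean_integral run) //.
  have -> : (\int[P]_w (error_level pb st r k w)%:E =
      \int[P]_w (index_mean pb st r k (fun=> error_level pb st r k) w)%:E)%E.
    by apply: eq_integral => w _; rewrite (index_mean_cst run).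
  rewrite (index_mean_integral run) //.
  apply: lee_nneseries => [j _ _|j _]; first by apply: integral_ge0 => w _; rewrite lee_fin mulr_ge0 ?index_weight_ge0.
  have [->|j0] := posnP j.
    by rewrite !integral0_eq // => w _; rewrite /index_weight mulr0.
  rewrite /er (maxn_idPr j0).
  exact: (weighted_error as1 as5 hst run kN batch_gt0 j0 (inner_iterate_good j0)).
apply: (@le_trans _ _ (\int[P]_w ((t w)%:E + 5%:E * (index_mean pb st r k er w)%:E))%E).
  apply: ge0_le_integral => //.
  - by move=> w _; rewrite lee_fin mean0 // => j; exact: residual_ge0.
  - by apply/measurable_EFinP; exact: mmean.
  - apply: emeasurable_funD; first exact/measurable_EFinP.
    by apply/measurable_EFinP; apply: measurable_funM => //; exact: mmean.
  move=> w _; rewrite -EFinM -EFinD lee_fin !mean1; apply: le_trans (residual_mean w) _.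
  by rewrite lerD2r lerBrDr; exact: call_accuracy_run.
have mm : measurable_fun setT (fun w => (index_mean pb st r k er w)%:E).
  by apply/measurable_EFinP; exact: mmean.
have mt' : measurable_fun setT (fun w => (t w)%:E) by exact/measurable_EFinP.
have mc' : measurable_fun setT (fun w => (error_level pb st r k w)%:E).
  by apply/measurable_EFinP; exact: (sub_measurable_fun Fm).
have -> : ((2 / 5 * eps)%:E = \int[P]_w ((t w)%:E + 5%:E * (error_level pb st r k w)%:E))%E.
  rewrite (eq_integral (fun=> (2 / 5 * eps)%:E)) => [|w _].
    by rewrite integral_cst // [X in (_ * X)%E](@probability_setT _ _ _ P) mule1.
  by rewrite -EFinM -EFinD /t subrK.
rewrite !ge0_integralD //; do ?[exact: emeasurable_funM]; do ?[by move=> w _; rewrite ?mule_ge0 // lee_fin ?mean0].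
rewrite leeD2l // !ge0_integralZl_EFin //; do ?[by move=> w _; rewrite lee_fin ?mean0].
by apply: lee_pmul => //; apply: integral_ge0 => w _; rewrite lee_fin mean0.
Qed.

End CallResidual.

(** * Stationarity and infeasibility of the output of a call *)

Section CallOutput.
Variables (R : realType) (n q : nat) (dz : measure_display).
Variables (Z : measurableType dz) (pb : problem R n q Z) (st : settings R n).
Variables (d : measure_display) (Om : measurableType d) (P : probability Om R).
Variables (eps : R) (N : nat) (r : pz_data R n Z Om).
Hypothesis as1 : AS1 pb.
Hypothesis as5 : AS5 pb.
Hypothesis low : Phi_low_valid pb.
Hypothesis hst : settings_valid pb st.
Hypothesis eps0 : 0 < eps.
Hypothesis adm : pz_admissible pb st P eps N r.
Variable k : nat.
Hypothesis kN : (1 <= k < N)%N.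
Local Notation res w := (residual pb st r k (pz_R r k w) w).
Local Notation x w := (pz_x r k.+1 w).

Let run : pz_run pb st P N r. Proof. by case: adm. Qed.
Let kN' : (k < N)%N. Proof. by case/andP: kN. Qed.

Let Rk w : (1 <= pz_R r k w)%N.
Proof. by have [_ /(_ w)/andP[h _] _] := run_uniform run kN. Qed.

Let outE w : x w = pz_y r k (pz_R r k w) w.
Proof. by have [_ _ /(_ _ kN)[_ _ _ _ /(_ w)[_ -> _]]] := run. Qed.

Let mx : random_vector (fun w => x w).
Proof.
have h := iterate_measurable as1 as5 hst run (k := k.+1) kN'.
have Fm := past_gens_measurable (J := before k.+1) (run_fresh run) (run_uniform run) kN'.
by move=> l; exact: sub_measurable_fun Fm (h l).
Qed.

Let mres : measurable_fun setT (fun w => res w).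
Proof.
have Fm := past_gens_measurable (J := setT) (run_fresh run) (run_uniform run) (ltnW kN').
rewrite (_ : (fun w => _) = fun w => residual pb st r k (maxn 1 (pz_R r k w)) w); last first.
  by apply/funext => w; rewrite (maxn_idPr (Rk w)).
apply: (measurable_select_nat (f := fun j => residual pb st r k (maxn 1 j))).
  by have [] := run_uniform run kN.
move=> j; apply: (sub_measurable_fun Fm).
by apply: (measurable_residual as1 as5 hst adm kN); exact: leq_maxl.
Qed.

Let res0 w : 0 <= res w. Proof. exact: residual_ge0. Qed.

Let int_res (a b : R) : 0 <= a -> 0 <= b ->
  (\int[P]_w (a + b * res w)%:E <= (a + b * (2 / 5 * eps))%:E)%E.
Proof.
move=> a0 b0; under eq_integral do rewrite EFinD EFinM.
have mr : measurable_fun setT (fun w => (res w)%:E) by exact/measurable_EFinP.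
rewrite ge0_integralD //; last 2 first.
- by move=> w _; rewrite mule_ge0 // lee_fin.
- exact: emeasurable_funM.
rewrite integral_cst // [X in (_ * X + _)%E](@probability_setT _ _ _ P) mule1.
rewrite ge0_integralZl_EFin //; last by move=> w _; rewrite lee_fin.
rewrite EFinD EFinM leeD2l // lee_pmul //.
  by apply: integral_ge0 => w _; rewrite lee_fin.
exact: (output_residual as1 as5 low hst eps0 adm kN).
Qed.

Lemma output_near_stationary : near_stationary pb P eps (pz_x r k.+1).
Proof.
pose h w (lam : 'cV[R]_q) := enorm (grad (obj pb) (x w) + (Jac (con pb) (x w))^T *m lam) ^+ 2.
have hc w : continuous (h w).
  move=> u; apply: (@continuous_comp _ _ _
    (fun lam : 'cV[R]_q => enorm (grad (obj pb) (x w) + (Jac (con pb) (x w))^T *m lam)) (fun z : R => z ^+ 2)).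
    exact: continuous_affine_norm.
  exact: exprn_continuous.
have mh (lam : Om -> 'cV[R]_q) : random_vector lam -> measurable_fun setT (fun w => h w (lam w)).
  move=> ml; apply: measurable_funX; apply: measurable_enorm; apply: random_vectorD.
    exact: random_vector_grad.
  exact: random_vector_JacT_mul.
(* Slack for the measurable multiplier: twice 2/5 eps plus eps/10 is still below eps. *)
have e10 : 0 < eps / 10 by rewrite divr_gt0.
(* The multiplier must be measurable: take the first point of a countable dense
   set that does almost as well as the one given by optimality. *)
pose p i w := h w (enum_point q i) < 2 * res w + eps / 10.
have [i|w|D mD pD] := @first_selection _ Om p.
- apply: measurable_ltr; first by apply: mh; exact: random_vector_cst.
  by apply: measurable_funD => //; exact: measurable_funM.
- have [lam hl] := prox_near_stationary as1 (rho_gt0 hst run w kN') (inner_step adm kN w (Rk w)).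
  apply: (enum_dense (h := h w) (u := lam)); first exact: hc.
  by rewrite /h outE; apply: (le_lt_trans hl); rewrite ltrDl.
have ml : random_vector (fun w => enum_point q (D w) : 'cV[R]_q).
  by move=> l; apply: (measurable_of_nat (fun i => enum_point q i l 0) mD).
exists (fun w => enum_point q (D w)); split => //; rewrite unlock.
apply: (@le_trans _ _ (\int[P]_w (eps / 10 + 2 * res w)%:E)%E).
  apply: ge0_le_integral => //.
  - by move=> w _; rewrite lee_fin sqr_ge0.
  - by apply/measurable_EFinP; exact: mh.
  - apply/measurable_EFinP; apply: measurable_funD => //; exact: measurable_funM.
  by move=> w _; rewrite lee_fin [leRHS]addrC; exact: (ltW (pD w)).
apply: le_trans (int_res _ _) _ => //; first exact: ltW.
by rewrite lee_fin; lra.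
Qed.

Lemma theta_ge0 y : 0 <= theta pb y.
Proof.
rewrite /theta subr_ge0; apply: ge_inf.
  by exists 0 => _ [s _ <-]; exact: enorm_ge0.
by exists 0; rewrite /unit_ball/= ?enorm0 // mulmx0 addr0.
Qed.

Variable rl : R.
Hypothesis rl_gt0 : 0 < rl.
Hypothesis rl_le : forall w, rl <= pz_rho r k w.
Let C := kJ st / LJ pb + kg st / Lg pb.

(* [min a (v/rho) <= sqrt (a v/rho)], linearised at the expected size of [v]. *)
Let min_le (a v e rho : R) : 0 < a -> 0 <= v -> 0 < e -> rl <= rho ->
  Num.min a (v / rho) <=
    Num.sqrt (2 * a / rl) * e * ((v / (2 * e ^+ 2)) ^+ 2 + 3) / 4.
Proof.
move=> a0 v0 e0 hr; have rho0 := lt_le_trans rl_gt0 hr.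
set b := Num.min _ _; set u := v / (2 * e ^+ 2); set s := Num.sqrt _.
have b0 : 0 <= b by rewrite le_min (ltW a0) divr_ge0 // ltW.
have s0 : 0 <= s by exact: sqrtr_ge0.
have s2 : s ^+ 2 = 2 * a / rl by rewrite sqr_sqrtr // divr_ge0 ?mulr_ge0 // ltW.
have vE : v = 2 * e ^+ 2 * u by rewrite /u; field; rewrite gt_eqF.
have u0 : 0 <= u by rewrite divr_ge0 // mulr_ge0 // sqr_ge0.
have bb : b ^+ 2 <= (s * e) ^+ 2 * u.
  have -> : (s * e) ^+ 2 * u = a * (v / rl) by rewrite exprMn s2 vE; field; rewrite gt_eqF.
  rewrite expr2; apply: ler_pM => //; first by rewrite ge_min lexx.
  rewrite ge_min; apply/orP; right.
  by rewrite ler_wpM2l // lef_pV2 // posrE.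
rewrite -(ler_pXn2r (n := 2)) // ?nnegrE ?divr_ge0 ?mulr_ge0 ?addr_ge0 ?sqr_ge0 ?(ltW e0) //.
apply: (le_trans bb).
have -> : (s * e * (u ^+ 2 + 3) / 4) ^+ 2 = (s * e) ^+ 2 * ((u ^+ 2 + 3) / 4) ^+ 2 by ring.
apply: ler_wpM2l; first exact: sqr_ge0.
have h1 := sqr_ge0 (u - 1).
have h2 : ((u + 1) / 2) ^+ 2 <= ((u ^+ 2 + 3) / 4) ^+ 2.
  rewrite lerXn2r // ?nnegrE; [lra|lra|].
  by move: h1; rewrite sqrrB expr1n mulr1; lra.
apply: le_trans h2; have -> : ((u + 1) / 2) ^+ 2 = u + (u - 1) ^+ 2 / 4 by field.
by rewrite lerDl divr_ge0.
Qed.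

(** What is known is the expectation of S^2 + |e|^2, so each term of [prox_theta] is majorised by an
    affine function of that sum: S by (S^2 + |e|^2)/(2 sqrt(eps)) + sqrt(eps)/2, the minimum through
    [min_le]. Inserting 2/5 eps gives the coefficients 7/10 and 7/8, both below 1. *)
Lemma output_theta :
  ('E_P[fun w => theta pb (x w)] <= (kg st / rl + C * Num.sqrt eps / rl
     + Num.sqrt (2 * kJ st / rl) * Num.sqrt (Num.sqrt eps))%:E)%E.
Proof.
set e2 := Num.sqrt eps; set e := Num.sqrt e2.
have e20 : 0 < e2 by rewrite sqrtr_gt0.
have e0' : 0 < e by rewrite sqrtr_gt0.
have e2E : e ^+ 2 = e2 by rewrite sqr_sqrtr // ltW.
have epsE : e2 ^+ 2 = eps by rewrite sqr_sqrtr // ltW.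
have [Lg0 LJ0] : 0 < Lg pb /\ 0 < LJ pb by case: as1.
have [kg0 kJ0] : 0 < kg st /\ 0 < kJ st by case: hst => _ _ _ _ [_ _ _ []].
have C0 : 0 <= C by rewrite addr_ge0 // divr_ge0 // ltW.
set s := Num.sqrt (2 * kJ st / rl).
have s0 : 0 <= s by exact: sqrtr_ge0.
pose al := kg st / rl + C * e2 / 2 / rl + 3 / 4 * (s * e).
pose be := C / (2 * e2) / rl + 5 / 16 * (s * e) / eps.
have al0 : 0 <= al.
  rewrite !addr_ge0 ?mulr_ge0 ?invr_ge0 ?(ltW e0') ?(ltW e20) ?(ltW rl_gt0) ?(ltW kg0) //.
have be0 : 0 <= be.
  rewrite addr_ge0 ?mulr_ge0 ?invr_ge0 ?mulr_ge0 ?(ltW e0') ?(ltW e20) ?(ltW rl_gt0) ?(ltW eps0) //.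
rewrite unlock; apply: (@le_trans _ _ (\int[P]_w (al + be * res w)%:E)%E).
  apply: ae_ge0_le_integral => //.
  - by move=> w _; rewrite lee_fin theta_ge0.
  - by apply/measurable_EFinP; exact: measurable_theta.
  - by move=> w _; rewrite lee_fin addr_ge0 // mulr_ge0.
  - by apply/measurable_EFinP; apply: measurable_funD => //; exact: measurable_funM.
  have [_ _ /(_ k.+1) ib _ _] := adm; have := ib _; rewrite kN' => /(_ isT).
  apply: filterS => w [_ _ hg hJ] _; rewrite lee_fin.
  have rho0 := rho_gt0 hst run w kN'.
  move: hg hJ; rewrite outE => hg hJ.
  have := prox_theta as1 rho0 (inner_step adm kN w (Rk w)) (lexx C) (ltW kg0) hg hJ.
  set S := Lrho _ _ * _; set E := enorm _; set rho := pz_rho r k w => ht.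
  have resE : res w = S ^+ 2 + E ^+ 2 by [].
  have S0 : 0 <= S by rewrite mulr_ge0 ?enorm_ge0 // ltW // Lrho_gt0.
  have E0 : 0 <= E by exact: enorm_ge0.
  clearbody S E.
  apply: (le_trans ht).
  have irl : rho^-1 <= rl^-1 by rewrite lef_pV2 ?posrE //; exact: rl_le.
  have h1 : kg st / rho <= kg st / rl by rewrite ler_wpM2l // ltW.
  have h2 : C * S / rho <= C * ((S ^+ 2 + E ^+ 2) / (2 * e2) + e2 / 2) / rl.
    apply: ler_pM; rewrite ?mulr_ge0 ?invr_ge0 ?(ltW rho0) //.
    rewrite ler_wpM2l // -subr_ge0.
    have -> : (S ^+ 2 + E ^+ 2) / (2 * e2) + e2 / 2 - S = ((S - e2) ^+ 2 + E ^+ 2) / (2 * e2).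
      by field; rewrite gt_eqF.
    by rewrite divr_ge0 ?addr_ge0 ?sqr_ge0 // mulr_ge0 // ltW.
  have v0 : 0 <= 2 * E + S by rewrite addr_ge0 ?mulr_ge0.
  have h3 := min_le kJ0 v0 e0' (rl_le w).
  have h4 : s * e * (((2 * E + S) / (2 * e ^+ 2)) ^+ 2 + 3) / 4
      <= s * e * (5 / 4 * (S ^+ 2 + E ^+ 2) / eps + 3) / 4.
    rewrite ler_wpM2r // ler_wpM2l ?mulr_ge0 ?(ltW e0') // lerD2r.
    rewrite e2E exprMn exprVn exprMn epsE.
    have -> : 5 / 4 * (S ^+ 2 + E ^+ 2) / eps = 5 * (S ^+ 2 + E ^+ 2) / (2 ^+ 2 * eps).
      by field; rewrite gt_eqF.
    rewrite ler_wpM2r // ?invr_ge0 ?mulr_ge0 ?(ltW eps0) //.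
    (* 5 (S^2 + E^2) - (2 E + S)^2 is exactly this square. *)
    by have := sqr_ge0 (E - 2 * S); nra.
  have -> : al + be * res w = kg st / rl + C * ((S ^+ 2 + E ^+ 2) / (2 * e2) + e2 / 2) / rl
      + s * e * (5 / 4 * (S ^+ 2 + E ^+ 2) / eps + 3) / 4.
    by rewrite resE /al /be; field; rewrite !gt_eqF.
  by apply: lerD; [exact: lerD|exact: le_trans h3 h4].
apply: le_trans (int_res al0 be0) _; rewrite lee_fin /al /be.
have -> : kg st / rl + C * e2 / 2 / rl + 3 / 4 * (s * e) +
   (C / (2 * e2) / rl + 5 / 16 * (s * e) / eps) * (2 / 5 * eps)
   = kg st / rl + 7 / 10 * (C * e2 / rl) + 7 / 8 * (s * e).
  by rewrite -epsE; field; rewrite !gt_eqF.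
have h5 : 0 <= C * e2 / rl by rewrite divr_ge0 ?mulr_ge0 // ltW.
have h6 : 0 <= s * e by rewrite mulr_ge0 // ltW.
by lra.
Qed.

End CallOutput.

(** * Penalty parameters and oracle calls *)

Section OuterBounds.
Variables (R : realType) (n q : nat) (dz : measure_display).
Variables (Z : measurableType dz) (pb : problem R n q Z) (st : settings R n).
Hypothesis as1 : AS1 pb.
Hypothesis hst : settings_valid pb st.
Variable eps : R.
Hypothesis eps01 : 0 < eps < 1.

Let e := eps `^ (4^-1).

Lemma root4_gt0 : 0 < e. Proof. by rewrite powR_gt0; case/andP: eps01. Qed.

Let ep : 0 < eps. Proof. by case/andP: eps01. Qed.

Lemma root4_sqr : e ^+ 2 = Num.sqrt eps.
Proof.
rewrite -powR_mulrn ?powR_ge0 // /e -powRrM -powR12_sqrt ?(ltW ep) //; congr (_ `^ _).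
by field.
Qed.

Lemma root4_sqrt : Num.sqrt (Num.sqrt eps) = e.
Proof. by rewrite -root4_sqr sqrtr_sqr ger0_norm // ltW // root4_gt0. Qed.

Lemma root4_pow4 : e ^+ 4 = eps.
Proof. by rewrite -[4%N]/(2 * 2)%N exprM root4_sqr sqr_sqrtr // ltW. Qed.

Lemma root4_le1 : e <= 1.
Proof.
rewrite leNgt; apply/negP => h; have := exprn_ege1 4 (ltW h).
by rewrite root4_pow4; case/andP: eps01 => _ h1 h2; have := lt_le_trans h1 h2; rewrite ltxx.
Qed.

Lemma powR_neg_half : eps `^ (- 2^-1) = e ^- 2.
Proof. by rewrite powRN powR12_sqrt ?(ltW ep) // root4_sqr. Qed.

Lemma powR_neg_7half : eps `^ (- (7 / 2)) = e ^- 14.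
Proof.
rewrite powRN; congr (_^-1); rewrite -powR_mulrn ?powR_ge0 // /e -powRrM; congr (_ `^ _).
by field.
Qed.

Let C := kJ st / LJ pb + kg st / Lg pb.
Let Lg0 : 0 < Lg pb. Proof. by case: as1 => _ _ _ []. Qed.
Let LJ0 : 0 < LJ pb. Proof. by case: as1 => _ _ _ []. Qed.
Let kg0 : 0 < kg st. Proof. by case: hst => _ _ _ _ [_ _ _ []]. Qed.
Let kJ0 : 0 < kJ st. Proof. by case: hst => _ _ _ _ [_ _ _ []]. Qed.
Let st01 : 0 < steer st < 1. Proof. by case: hst. Qed.
Let C0 : 0 <= C. Proof. by rewrite addr_ge0 // divr_ge0 // ltW. Qed.
Let kg_le : kg st <= Num.sqrt (kg st ^+ 2 + 4^-1 * eps).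
Proof.
rewrite -[leLHS]ger0_norm ?(ltW kg0) // -sqrtr_sqr ler_sqrt ?lerDl ?mulr_ge0 ?(ltW ep) //.
by rewrite addr_ge0 ?sqr_ge0 // mulr_ge0 // ltW.
Qed.
Let C_le : C <= Cbar pb st eps.
Proof. by rewrite /Cbar mulrC [_^-1 * Num.sqrt _]mulrC lerD2l ler_wpM2r // invr_ge0 ltW. Qed.

Let M := 2 * Cbar pb st eps + Num.sqrt (2 * Cbar pb st eps) * Num.sqrt (Lg pb + LJ pb).
Let M0 : 0 <= M.
Proof. by rewrite addr_ge0 ?mulr_ge0 ?sqrtr_ge0 // (le_trans C0). Qed.
Let K := Num.sqrt (kg st ^+ 2 + 4^-1 * eps).

(** Domination term by term. kg <= sqrt(kg^2 + eps/4) gives C <= [Cbar]; sqrt(eps)/p is below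
    eps^(1/4)/sqrt(p) as eps < 1 <= p; and kJ <= LJ Cbar turns sqrt(2 kJ) into sqrt(2 Cbar (Lg +
    LJ)). *)
Lemma outer_theta_le N (p := rho0 st + (N - 1)%N%:R * tau st) :
  kg st / p + C * Num.sqrt eps / p + Num.sqrt (2 * kJ st / p) * Num.sqrt (Num.sqrt eps)
    <= theta_bound pb st eps N.
Proof.
have [s0 s1] := andP st01.
have p1 : 1 <= p.
  by case: hst => _ _ h1 h2 _; rewrite /p -[leLHS]addr0 lerD // mulr_ge0 // ltW.
have p0 : 0 < p by exact: lt_le_trans p1.
have sp1 : 1 <= Num.sqrt p by rewrite -sqrtr1 ler_sqrt // ltW.
have sp0 : 0 < Num.sqrt p by rewrite sqrtr_gt0.
have e0 := root4_gt0; have e1 := root4_le1.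
rewrite root4_sqrt -root4_sqr /theta_bound -/p -/M -/K -/e.
have h1 : kg st / p <= K / ((1 - steer st) * p).
  apply: ler_pM; rewrite ?invr_ge0 ?(ltW kg0) ?(ltW p0) // lef_pV2 ?posrE ?mulr_gt0 ?subr_gt0 //.
  by rewrite ler_piMl ?(ltW p0) // lerBlDr lerDl ltW.
have h2 : C * e ^+ 2 / p <= 2 * Cbar pb st eps * e / (steer st * Num.sqrt p).
  apply: ler_pM; rewrite ?(mulr_ge0 C0 (sqr_ge0 e)) ?invr_ge0 ?(ltW p0) //.
    apply: ler_pM; rewrite ?sqr_ge0 //.
      by rewrite mulr_natl mulr2n (le_trans C_le) // lerDl (le_trans C0).
    by rewrite expr2 ler_piMl // ltW.
  rewrite lef_pV2 ?posrE ?mulr_gt0 //.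
  rewrite -[leRHS]sqr_sqrtr ?(ltW p0) // expr2; apply: ler_pM; rewrite ?(ltW s0) ?(ltW sp0) //.
  exact: le_trans (ltW s1) sp1.
have h3 : Num.sqrt (2 * kJ st / p) * e
    <= Num.sqrt (2 * Cbar pb st eps) * Num.sqrt (Lg pb + LJ pb) * e / (steer st * Num.sqrt p).
  rewrite [leRHS]mulrAC ler_wpM2r ?(ltW e0) // sqrtrM ?mulr_ge0 ?(ltW kJ0) // sqrtrV ?(ltW p0) //.
  apply: ler_pM; rewrite ?invr_ge0 ?sqrtr_ge0 //; last first.
    by rewrite lef_pV2 ?posrE ?mulr_gt0 // ler_piMl // ltW.
  rewrite -sqrtrM ?mulr_ge0 ?(le_trans C0 C_le) // ler_sqrt ?mulr_ge0 ?(le_trans C0 C_le) ?addr_ge0 ?(ltW Lg0) ?(ltW LJ0) //.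
  rewrite -mulrA ler_wpM2l //.
  have h : kJ st <= Cbar pb st eps * LJ pb.
    rewrite -ler_pdivrMr //; apply: le_trans C_le.
    by rewrite lerDl divr_ge0 // ltW.
  apply: (le_trans h); rewrite ler_wpM2l ?(le_trans C0 C_le) // lerDr ltW //.
have -> : M / (steer st * Num.sqrt p) * e = 2 * Cbar pb st eps * e / (steer st * Num.sqrt p)
   + Num.sqrt (2 * Cbar pb st eps) * Num.sqrt (Lg pb + LJ pb) * e / (steer st * Num.sqrt p).
  by rewrite /M; ring.
by move: h1 h2 h3; lra.
Qed.

Lemma enough_outer_penalty N : enough_outer pb st eps N -> (0 < N)%N ->
  Ctilde pb st eps * e ^- 2 <= rho0 st + (N - 1)%N%:R * tau st.
Proof.
move=> h N0; have t0 : 0 < tau st by case: hst.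
have : (tau st)^-1 * Ctilde pb st eps * e ^- 2 - (tau st)^-1 * rho0 st + 1 <= N%:R.
  by rewrite -powR_neg_half; apply: le_trans (ceil_ge _) _; rewrite -[N%:R]/(N%:Z%:~R) ler_int.
rewrite -(ler_pM2l t0) => h1.
have E : tau st * N%:R = tau st + (N - 1)%N%:R * tau st by rewrite natrB //; ring.
have E2 : tau st * ((tau st)^-1 * Ctilde pb st eps * e ^- 2 - (tau st)^-1 * rho0 st + 1)
  = Ctilde pb st eps * e ^- 2 - rho0 st + tau st.
  by move: (e ^- 2) => z; field; rewrite gt_eqF.
by move: h1; rewrite E E2; lra.
Qed.

(** With p e^2 >= [Ctilde], where e = eps^(1/4), each entry of the maximum in [Ctilde] makes one
    summand at most sqrt(eps)/2. By [M2] and [K2] these entries hold the doubled numerators of the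
    summands, the first one squared because p enters it under a root. *)
Lemma theta_bound_le N : enough_outer pb st eps N -> (0 < N)%N ->
  theta_bound pb st eps N <= Num.sqrt eps.
Proof.
move=> h N0; have hp := enough_outer_penalty h N0.
have [s0 s1] := andP st01; have e0 := root4_gt0.
rewrite /theta_bound -/M -/K -/e -root4_sqr; set p := rho0 st + _ in hp *.
have p1 : 1 <= p.
  by case: hst => _ _ h1 h2 _; rewrite /p -[leLHS]addr0 lerD // mulr_ge0 // ltW.
have p0 : 0 < p by exact: lt_le_trans p1.
have sp0 : 0 < Num.sqrt p by rewrite sqrtr_gt0.
have e20 : 0 < e ^+ 2 by rewrite exprn_gt0.
have c0 : 0 <= Cbar pb st eps := le_trans C0 C_le.
have M2 : 4 * Cbar pb st eps + Num.sqrt (8 * Cbar pb st eps) * Num.sqrt (Lg pb + LJ pb) = 2 * M.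
  have -> : 8 * Cbar pb st eps = 2 ^+ 2 * (2 * Cbar pb st eps) by ring.
  by rewrite sqrtrM ?sqr_ge0 // sqrtr_sqr ger0_norm // /M; ring.
have K2 : Num.sqrt (4 * kg st ^+ 2 + eps) = 2 * K.
  have -> : 4 * kg st ^+ 2 + eps = 2 ^+ 2 * (kg st ^+ 2 + 4^-1 * eps) by field.
  by rewrite sqrtrM ?sqr_ge0 // sqrtr_sqr ger0_norm.
have cp : Ctilde pb st eps <= p * e ^+ 2 by rewrite -ler_pdivrMr.
have c1 : (2 * M / steer st) ^+ 2 <= p * e ^+ 2.
  apply: le_trans cp; rewrite /Ctilde M2 exprMn exprVn le_max.
  by apply/orP; left.
have c2 : 2 * K / (1 - steer st) <= p * e ^+ 2.
  by apply: le_trans cp; rewrite /Ctilde K2 le_max lexx orbT.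
have {}c1 : 2 * M / steer st <= Num.sqrt p * e.
  rewrite -(ler_pXn2r (n := 2)) // ?nnegrE ?divr_ge0 ?mulr_ge0 ?sqrtr_ge0 ?(ltW s0) ?(ltW e0) //.
  by rewrite [leRHS]exprMn sqr_sqrtr // ltW.
have t1 : M / (steer st * Num.sqrt p) * e <= e ^+ 2 / 2.
  have -> : M / (steer st * Num.sqrt p) * e = (2 * M / steer st) * (e / (2 * Num.sqrt p)).
    by field; rewrite !gt_eqF.
  have -> : e ^+ 2 / 2 = Num.sqrt p * e * (e / (2 * Num.sqrt p)) by field; rewrite gt_eqF.
  by rewrite ler_wpM2r // divr_ge0 ?mulr_ge0 // ltW.
have t2 : K / ((1 - steer st) * p) <= e ^+ 2 / 2.
  have -> : K / ((1 - steer st) * p) = 2 * K / (1 - steer st) * (2 * p)^-1.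
    by field; rewrite (gt_eqF p0) gt_eqF // subr_gt0.
  have -> : e ^+ 2 / 2 = p * e ^+ 2 * (2 * p)^-1 by field; rewrite gt_eqF.
  by rewrite ler_wpM2r // invr_ge0 mulr_ge0 // ltW.
by lra.
Qed.

(** The constants 4, 4 and 32 make each of the three summands at most sqrt(eps)/4; 32 is 2 times 16,
    the 16 coming from squaring 1/4 under the root. *)
Lemma large_penalty_theta p : (4 * kg st + 4 * C + 32 * kJ st) * e ^- 2 <= p ->
  kg st / p + C * Num.sqrt eps / p + Num.sqrt (2 * kJ st / p) * Num.sqrt (Num.sqrt eps)
    <= Num.sqrt eps.
Proof.
have e0 := root4_gt0; have e1 := root4_le1; have e20 : 0 < e ^+ 2 by rewrite exprn_gt0.
rewrite root4_sqrt -root4_sqr ler_pdivrMr // => hp.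
have k1 := kg0; have k2 := kJ0; have k3 := C0.
have pe0 : 0 < p * e ^+ 2 by apply: lt_le_trans hp; lra.
have p0 : 0 < p by rewrite -(pmulr_lgt0 _ e20).
have e21 : e ^+ 2 <= 1 by rewrite exprn_ile1 // ltW.
have h1 : kg st / p <= e ^+ 2 / 4.
  by rewrite ler_pdivrMr // mulrAC [e ^+ 2 * p]mulrC; lra.
have h2 : C * e ^+ 2 / p <= e ^+ 2 / 4.
  rewrite ler_pdivrMr // mulrAC [e ^+ 2 * p]mulrC.
  have : C * e ^+ 2 <= C by rewrite ler_piMr.
  by lra.
have h3 : Num.sqrt (2 * kJ st / p) * e <= e ^+ 2 / 4.
  have -> : e ^+ 2 / 4 = e / 4 * e by ring.
  rewrite ler_wpM2r ?(ltW e0) // -[leRHS]ger0_norm ?divr_ge0 ?(ltW e0) // -sqrtr_sqr.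
  rewrite ler_sqrt ?sqr_ge0 // ler_pdivrMr // exprMn exprVn mulrAC [e ^+ 2 * p]mulrC.
  by lra.
by lra.
Qed.

End OuterBounds.

Section CallCount.
Variables (R : realType) (n q : nat) (dz : measure_display).
Variables (Z : measurableType dz) (pb : problem R n q Z) (st : settings R n).
Hypothesis as1 : AS1 pb.
Hypothesis hst : settings_valid pb st.
Hypothesis low : Phi_low_valid pb.

Let Lg0 : 0 < Lg pb. Proof. by case: as1 => _ _ _ []. Qed.
Let LJ0 : 0 < LJ pb. Proof. by case: as1 => _ _ _ []. Qed.
Let D1p : 0 < D1 st. Proof. by case: hst => _ _ _ _ []. Qed.
Let D2p : 0 < D2 st. Proof. by case: hst => _ _ _ _ []. Qed.
Let kc0 : 0 < kc st. Proof. by case: hst => _ _ _ _ [_ _ _ []]. Qed.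

(** For rho >= 1 both L and [Dphi] grow at most linearly in rho, with slopes [l0] and [d0]; [A0] and
    [B0] are the brackets of [Nbar_bound] evaluated at these slopes. *)
Let d0 : R := `|kf st - obj_low pb| + kc st.
Let l0 : R := Lg pb + LJ pb.
Let A0 : R := 64 * d0 / Num.sqrt (D2 st) + 4 * l0 * Ctilde1 pb st.
Let B0 : R := 448 * l0 * Lg pb * D1 st * (n + 4)%:R ^+ 3 + 256 * l0 * d0.

(** The final 1 pays for rounding the number of calls up to an integer. *)
Definition calls_factor : R := A0 ^+ 2 + B0 + (Lg pb ^+ 2 * D2 st)^-1 + 1.

Let d00 : 0 <= d0. Proof. by rewrite addr_ge0 // ltW. Qed.
Let l00 : 0 <= l0. Proof. by rewrite addr_ge0 // ltW. Qed.
Let Ct0 : 0 <= Ctilde1 pb st.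
Proof.
rewrite /Ctilde1 mulr_ge0 ?sqrtr_ge0 //; apply: mulr_ge0; first exact: mulr_ge0.
by rewrite addr_ge0 ?sqr_ge0.
Qed.
Let A00 : 0 <= A0.
Proof.
apply: addr_ge0; first by apply: divr_ge0; [exact: mulr_ge0|exact: sqrtr_ge0].
by apply: mulr_ge0 => //; exact: mulr_ge0.
Qed.
Let t0 : 0 <= l0 * Lg pb * D1 st * (n + 4)%:R ^+ 3.
Proof. by apply: mulr_ge0; rewrite ?exprn_ge0 //; rewrite !mulr_ge0 // ltW. Qed.
Let B00 : 0 <= B0.
Proof.
have -> : B0 = 448 * (l0 * Lg pb * D1 st * (n + 4)%:R ^+ 3) + 256 * (l0 * d0).
  by rewrite /B0; ring.
exact: addr_ge0 (mulr_ge0 (ler0n R 448) t0) (mulr_ge0 (ler0n R 256) (mulr_ge0 l00 d00)).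
Qed.
Let I00 : 0 <= (Lg pb ^+ 2 * D2 st)^-1.
Proof. by rewrite invr_ge0 mulr_ge0 ?sqr_ge0 // ltW. Qed.

Lemma calls_factor_ge1 : 1 <= calls_factor.
Proof.
by rewrite /calls_factor lerDr; do 2?apply: addr_ge0 => //; exact: sqr_ge0.
Qed.

(** One bracket is linear in rho and squared, the other at most quadratic, and 1/eps <= 1/eps^2; so
    everything scales like rho^2/eps^2. The other entry of the maximum is bounded because L >=
    Lg. *)
Lemma Nbar_bound_le (eps rho : R) x : 0 < eps < 1 -> 1 <= rho ->
  obj pb x <= kf st -> enorm (con pb x) <= kc st ->
  Nbar_bound pb st eps rho x <= (calls_factor - 1) * rho ^+ 2 / eps ^+ 2.
Proof.
move=> /andP[e0 e1] r1 hf hc; have r0 : 0 < rho by exact: lt_le_trans r1.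
have L0 := Lrho_gt0 as1 r0; have D0 := Dphi_ge0 x low r0.
have Ll : Lrho pb rho <= l0 * rho.
  by rewrite /Lrho /l0 mulrDl [LJ pb * rho]mulrC lerD2r ler_peMr // ltW.
have Dd : Dphi pb rho x <= d0 * rho.
  rewrite /Dphi /Phi /d0; have [h _] := low r0.
  have h1 : rho * enorm (con pb x) <= kc st * rho by rewrite mulrC ler_wpM2r // ltW.
  have h2 : kf st - obj_low pb <= `|kf st - obj_low pb| by exact: ler_norm.
  have h3 : `|kf st - obj_low pb| <= `|kf st - obj_low pb| * rho by rewrite ler_peMr.
  by rewrite mulrDl; lra.
have s0 : 0 < Num.sqrt (D2 st) by rewrite sqrtr_gt0.
have e20 : 0 < eps ^+ 2 by rewrite exprn_gt0.
have ie : eps^-1 <= (eps ^+ 2)^-1.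
  by rewrite lef_pV2 ?posrE // expr2 ler_piMl // ltW.
have hA : (64 * Dphi pb rho x / Num.sqrt (D2 st) + 4 * Lrho pb rho * Ctilde1 pb st) ^+ 2
    <= A0 ^+ 2 * rho ^+ 2.
  rewrite -exprMn lerXn2r // ?nnegrE.
  - apply: addr_ge0; first by apply: divr_ge0; [exact: mulr_ge0|exact: sqrtr_ge0].
    by apply: mulr_ge0 => //; apply: mulr_ge0 => //; exact: ltW.
  - by rewrite mulr_ge0 // ltW.
  have -> : A0 * rho = 64 * (d0 * rho) / Num.sqrt (D2 st) + 4 * (l0 * rho) * Ctilde1 pb st.
    by rewrite /A0; ring.
  apply: lerD; first by rewrite ler_wpM2r ?invr_ge0 ?sqrtr_ge0 // ler_wpM2l.
  by rewrite ler_wpM2r // ler_wpM2l.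
have rr : rho <= rho ^+ 2 by rewrite expr2 ler_peMr // ltW.
have hB : (448 * Lrho pb rho * Lg pb * D1 st * (n + 4)%:R ^+ 3
      + 256 * Lrho pb rho * Dphi pb rho x) <= B0 * rho ^+ 2.
  have Ll2 : Lrho pb rho <= l0 * rho ^+ 2 by apply: (le_trans Ll); rewrite ler_wpM2l.
  have -> : B0 * rho ^+ 2 = 448 * l0 * Lg pb * D1 st * (n + 4)%:R ^+ 3 * rho ^+ 2
      + 256 * l0 * d0 * rho ^+ 2 by rewrite /B0; ring.
  apply: lerD.
    have -> : 448 * l0 * Lg pb * D1 st * (n + 4)%:R ^+ 3 * rho ^+ 2
       = l0 * rho ^+ 2 * (448 * Lg pb * D1 st * (n + 4)%:R ^+ 3) by ring.
    have -> : 448 * Lrho pb rho * Lg pb * D1 st * (n + 4)%:R ^+ 3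
       = Lrho pb rho * (448 * Lg pb * D1 st * (n + 4)%:R ^+ 3) by ring.
    have p0 : 0 <= 448 * Lg pb * D1 st * (n + 4)%:R ^+ 3.
      exact: (mulr_ge0 (mulr_ge0 (mulr_ge0 (ler0n R 448) (ltW Lg0)) (ltW D1p)) (exprn_ge0 3 (ler0n R _))).
    exact: (ler_wpM2r p0 Ll2).
  have -> : 256 * l0 * d0 * rho ^+ 2 = 256 * (l0 * rho * (d0 * rho)) by ring.
  rewrite -mulrA; exact: (ler_wpM2l (ler0n R 256) (ler_pM (ltW L0) D0 Ll Dd)).
have hC : (Lrho pb rho ^+ 2 * D2 st)^-1 <= (Lg pb ^+ 2 * D2 st)^-1 * rho ^+ 2 / eps ^+ 2.
  apply: (@le_trans _ _ (Lg pb ^+ 2 * D2 st)^-1).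
    rewrite lef_pV2 ?posrE ?mulr_gt0 ?exprn_gt0 // ler_wpM2r ?(ltW D2p) //.
    rewrite lerXn2r ?nnegrE ?(ltW Lg0) ?(ltW L0) //.
    by rewrite /Lrho lerDl mulr_ge0 // ltW.
  rewrite -mulrA ler_peMr //.
  rewrite ler_pdivlMr // mul1r; apply: (@le_trans _ _ 1).
    by rewrite exprn_ile1 // ltW.
  by rewrite exprn_ege1.
have q0 : 0 <= (Lg pb ^+ 2 * D2 st)^-1 * rho ^+ 2 / eps ^+ 2.
  by rewrite divr_ge0 ?sqr_ge0 // mulr_ge0 ?sqr_ge0.
have -> : (calls_factor - 1) * rho ^+ 2 / eps ^+ 2 = A0 ^+ 2 * rho ^+ 2 / eps ^+ 2
    + B0 * rho ^+ 2 / eps ^+ 2 + (Lg pb ^+ 2 * D2 st)^-1 * rho ^+ 2 / eps ^+ 2.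
  rewrite /calls_factor addrK; move: (A0 ^+ 2) B0 (Lg pb ^+ 2 * D2 st)^-1 => a b c.
  by rewrite !mulrDl.
have u1 : 0 <= A0 ^+ 2 * rho ^+ 2 / eps ^+ 2 by rewrite divr_ge0 ?sqr_ge0 // mulr_ge0 ?sqr_ge0.
have u2 : 0 <= B0 * rho ^+ 2 / eps ^+ 2 by rewrite divr_ge0 ?sqr_ge0 // mulr_ge0 ?sqr_ge0.
rewrite /Nbar_bound ge_max; apply/andP; split; last first.
  by apply: (le_trans hC); rewrite lerDr addr_ge0.
rewrite -[leLHS]addr0; apply: lerD => //; apply: lerD.
  by rewrite ler_wpM2r ?invr_ge0 // ltW.
apply: (@le_trans _ _ (B0 * rho ^+ 2 / eps)).
  by rewrite ler_wpM2r ?invr_ge0 // ltW.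
by rewrite ler_wpM2l // mulr_ge0 ?sqr_ge0.
Qed.

Lemma call_cost_le (eps rho : R) x nb : 0 < eps < 1 -> 1 <= rho ->
  obj pb x <= kf st -> enorm (con pb x) <= kc st ->
  least_nat (fun M => Nbar_bound pb st eps rho x <= M%:R) nb ->
  (batch_size pb st nb rho * natceil (nb%:R / (batch_size pb st nb rho)%:R : R))%:R
    <= 2 * calls_factor * rho ^+ 2 / eps ^+ 2.
Proof.
move=> e01 r1 hf hc [nb_ge nb_least].
have r0 : 0 < rho by exact: lt_le_trans r1.
have [e0 e1] := andP e01.
apply: (@le_trans _ _ (2 * nb)%:R); first by rewrite ler_nat (calls_le as1 hst r0 nb_ge).
have b0 : 0 <= Nbar_bound pb st eps rho x.
  by rewrite le_max invr_ge0 mulr_ge0 ?orbT ?sqr_ge0 // ltW.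
have h1 : (nb <= natceil (Nbar_bound pb st eps rho x))%N by apply: nb_least; exact: natceil_ge.
have h2 : nb%:R <= Nbar_bound pb st eps rho x + 1.
  by apply: le_trans (ltW (natceil_lt b0)); rewrite ler_nat.
have h3 := Nbar_bound_le e01 r1 hf hc.
have h4 : 1 <= rho ^+ 2 / eps ^+ 2.
  rewrite ler_pdivlMr ?exprn_gt0 // mul1r; apply: (@le_trans _ _ 1).
    by rewrite exprn_ile1 // ltW.
  by rewrite exprn_ege1.
rewrite natrM.
have -> : 2 * calls_factor * rho ^+ 2 / eps ^+ 2
   = 2 * ((calls_factor - 1) * rho ^+ 2 / eps ^+ 2 + rho ^+ 2 / eps ^+ 2) by ring.
by lra.
Qed.

(** Provides a threshold independent of eps for the complexity bounds. *)
Lemma Ctilde_le1 (eps : R) : eps <= 1 -> 0 < eps -> Ctilde pb st eps <= Ctilde pb st 1.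
Proof.
move=> e1 e0; have [s0 s1] : 0 < steer st /\ steer st < 1 by case: hst => /andP[].
have kk (a b : R) : 0 <= a -> a <= b -> Num.sqrt a <= Num.sqrt b.
  by move=> a0 ab; rewrite ler_sqrt // (le_trans a0).
have LJV : 0 <= (LJ pb)^-1 * kJ st.
  by rewrite mulr_ge0 ?invr_ge0 ?(ltW LJ0) //; case: hst => _ _ _ _ [_ _ _ [_ _ _ /ltW]].
have c0 (z : R) : 0 <= Cbar pb st z by rewrite addr_ge0 // mulr_ge0 ?sqrtr_ge0 // invr_ge0 ltW.
have cc : Cbar pb st eps <= Cbar pb st 1.
  rewrite /Cbar lerD2l ler_wpM2l ?invr_ge0 ?(ltW Lg0) //; apply: kk.
    by rewrite addr_ge0 ?sqr_ge0 // mulr_ge0 // ltW.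
  by rewrite lerD2l ler_wpM2l.
rewrite /Ctilde ge_max !le_max; apply/andP; split; apply/orP; [left|right].
  rewrite ler_wpM2r ?invr_ge0 ?sqr_ge0 // lerXn2r ?nnegrE ?addr_ge0 ?mulr_ge0 ?sqrtr_ge0 //.
  apply: lerD; first by rewrite ler_wpM2l.
  by rewrite ler_wpM2r ?sqrtr_ge0 //; apply: kk; rewrite ?mulr_ge0 // ler_wpM2l.
rewrite ler_wpM2r ?invr_ge0 ?subr_ge0 ?(ltW s1) //; apply: kk; last by rewrite lerD2l.
by rewrite addr_ge0 ?(ltW e0) // mulr_ge0 ?sqr_ge0.
Qed.

End CallCount.

(** * An explicit measurable penalty rule *)

Section PenaltyRule.
Variables (R : realType) (n q : nat) (dz : measure_display).
Variables (Z : measurableType dz) (pb : problem R n q Z) (st : settings R n).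
Hypothesis as1 : AS1 pb.
Hypothesis hst : settings_valid pb st.

Let phi_inf_le (rho : R) (g x s : 'cV[R]_n) : 0 <= rho -> enorm s <= 1 ->
  inf [set dotp g s + rho * enorm (con pb x + Jac (con pb) x *m s) | s in @unit_ball R n]
    <= dotp g s + rho * enorm (con pb x + Jac (con pb) x *m s).
Proof.
move=> r0 s1; apply: ge_inf; last by exists s.
exists (- enorm g) => _ [u u1 <-]; have := dotp_geN g u.
have : 0 <= rho * enorm (con pb x + Jac (con pb) x *m u) by rewrite mulr_ge0 ?enorm_ge0.
have : enorm g * enorm u <= enorm g by rewrite ler_piMr ?enorm_ge0.
by lra.
Qed.

Lemma phi_ge0 (rho : R) (g x : 'cV[R]_n) : 0 <= rho -> 0 <= phi pb rho g x.
Proof.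
move=> r0; rewrite /phi subr_ge0; apply: le_trans (@phi_inf_le _ _ _ 0 r0 _) _.
  by rewrite enorm0.
by rewrite dotp0r add0r mulmx0 addr0.
Qed.

(** On the unit ball g.s is at most |g|, so the gradient estimate lowers the predicted decrease by
    at most |g|. *)
Lemma phi_ge (rho : R) (g x : 'cV[R]_n) : 0 < rho ->
  rho * theta pb x - enorm g <= phi pb rho g x.
Proof.
move=> r0; rewrite /phi /theta.
set a := inf _; set b := inf _.
suff : (b - enorm g) / rho <= a by rewrite ler_pdivrMr // mulrBr; lra.
apply: lb_le_inf.
  by exists (enorm (con pb x + Jac (con pb) x *m 0)), 0 => //; rewrite /unit_ball/= enorm0.
move=> _ [s s1 <-]; rewrite ler_pdivrMr // lerBlDr.
apply: le_trans (phi_inf_le g x (ltW r0) s1) _; rewrite addrC mulrC lerD2l.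
by apply: (le_trans (dotp_le g s)); rewrite ler_piMr ?enorm_ge0.
Qed.

(* [phi >= rho theta - |g|], so the test holds once [(1 - steer) rho theta >= |g|];
   where [theta] vanishes the quotient is [0] and the test reads [phi >= 0]. *)
Definition floor_rule (b : R) (k : nat) (rho : R) (x g : 'cV[R]_n) : R :=
  Num.max (Num.max (rho + tau st) b) (enorm g / ((1 - steer st) * theta pb x)).

Lemma floor_rule_valid b : penalty_rule pb st (floor_rule b).
Proof.
have [/andP[s0 s1] _ r1 t0 _] := hst.
split=> [k rho x g hr|k d T rho x g mr mx mg]; last first.
  apply: measurable_maxr; first apply: measurable_maxr => //.
    exact: measurable_funD.
  apply: measurable_funM; first exact: measurable_enorm.
  by apply: measurable_fun_invr; apply: measurable_funM => //; exact: measurable_theta.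
set rho' := floor_rule _ _ _ _ _.
have h1 : rho + tau st <= rho' by rewrite /rho' /floor_rule !le_max lexx.
split => //; have r0 : 0 < rho'.
  by apply: lt_le_trans h1; apply: ltr_wpDl => //; apply: le_trans hr; lra.
have [->|th] := eqVneq (theta pb x) 0; first by rewrite mulr0 phi_ge0 // ltW.
have tp : 0 < theta pb x by rewrite lt_def th theta_ge0.
apply: le_trans (phi_ge g x r0).
have : enorm g / ((1 - steer st) * theta pb x) <= rho'.
  by rewrite /rho' /floor_rule le_max lexx orbT.
have c0 : 0 < (1 - steer st) * theta pb x by rewrite mulr_gt0 // subr_gt0.
rewrite (ler_pdivrMr _ _ c0) => h.
clearbody rho'; have E : rho' * ((1 - steer st) * theta pb x)
  = rho' * theta pb x - rho' * steer st * theta pb x by ring.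
by move: h; rewrite E; lra.
Qed.

End PenaltyRule.

(** * From the last call to the whole run *)

Section Outer.
Variables (R : realType) (n q : nat) (dz : measure_display).
Variables (Z : measurableType dz) (pb : problem R n q Z) (st : settings R n).
Hypothesis as1 : AS1 pb.
Hypothesis as5 : AS5 pb.
Hypothesis low : Phi_low_valid pb.
Hypothesis hst : settings_valid pb st.

Section Run.
Variables (d : measure_display) (Om : measurableType d) (P : probability Om R).
Variables (eps : R) (N : nat) (r : pz_data R n Z Om).
Hypothesis N2 : (2 <= N)%N.
Hypothesis eps01 : 0 < eps < 1.
Hypothesis adm : pz_admissible pb st P eps N r.

Let eps0 : 0 < eps. Proof. by case/andP: eps01. Qed.
Let NE : (N - 1).+1 = N. Proof. by rewrite subn1 prednK // ltnW. Qed.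
Let lastN : (1 <= N - 1 < N)%N. Proof. by rewrite subn_gt0 N2 ltn_subrL (ltnW N2). Qed.
Let run : pz_run pb st P N r. Proof. by case: adm. Qed.

Lemma last_near_stationary : near_stationary pb P eps (pz_x r N).
Proof. by rewrite -NE; apply: (output_near_stationary as1 as5 low hst eps0 adm lastN). Qed.

Lemma last_theta :
  ('E_P[fun w => theta pb (pz_x r N w)] <= (theta_bound pb st eps N)%:E)%E.
Proof.
have p0 : 0 < rho0 st + (N - 1)%N%:R * tau st.
  case: hst => _ _ h1 h2 _; apply: ltr_wpDr; last exact: lt_le_trans h1.
  by rewrite mulr_ge0 ?(ltW h2).
have rl w : rho0 st + (N - 1)%N%:R * tau st <= pz_rho r (N - 1) w.
  by apply: (rho_lower run); case/andP: lastN.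
have := output_theta as1 as5 low hst eps0 adm lastN p0 rl; rewrite NE => /le_trans; apply.
by rewrite lee_fin; exact: outer_theta_le.
Qed.

Lemma last_stoch_critical : enough_outer pb st eps N -> stoch_critical pb P eps (pz_x r N).
Proof.
move=> h; split; first exact: last_near_stationary.
apply: (le_trans last_theta); rewrite lee_fin; apply: theta_bound_le => //.
exact: ltnW.
Qed.

Hypothesis sm : smallest_nbar pb st eps N r.

Lemma run_call_cost k : (1 <= k < N)%N ->
  {ae P, forall w, (batch pb st r k w * Nin pb st r k w)%:R
    <= 2 * calls_factor pb st * pz_rho r k w ^+ 2 / eps ^+ 2}.
Proof.
move=> kN; have [_ _ /(_ k) ib _ _] := adm; have := ib _.
have -> : (1 <= k <= N)%N by case/andP: kN => -> /ltnW.
move=> /(_ isT); apply: filterS => w [hf hc _ _].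
apply: (call_cost_le as1 hst low eps01 _ hf hc); last exact: sm.
have kN' : (k < N)%N by case/andP: kN.
apply: le_trans (rho_lower run w kN'); case: hst => _ _ h1 h2 _.
by rewrite -[leLHS]addr0 lerD // mulr_ge0 // ltW.
Qed.

(** Penalties increase, so every call is charged at the last penalty; the cost estimates of all
    calls hold outside a single null set. *)
Lemma run_calls : {ae P, forall w, (calls pb st N r w)%:R
    <= (N - 1)%N%:R * (2 * calls_factor pb st * pz_rho r (N - 1) w ^+ 2 / eps ^+ 2)}.
Proof.
have : {ae P, forall w, forall k, (1 <= k < N)%N -> (batch pb st r k w * Nin pb st r k w)%:R
    <= 2 * calls_factor pb st * pz_rho r k w ^+ 2 / eps ^+ 2}.
  apply: ae_foralln => k; case: (boolP (1 <= k < N)%N) => kN; last exact: aeW.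
  by apply: filterS (run_call_cost kN) => w h _.
apply: filterS => w h; rewrite /calls natr_sum.
have rho_mono k : (k < N)%N -> pz_rho r k w <= pz_rho r (N - 1) w.
  move=> kN; have t0 : 0 < tau st by case: hst.
  have {kN} : (k <= N - 1)%N by rewrite -ltnS NE.
  have : (N - 1 < N)%N by case/andP: lastN.
  elim: (N - 1)%N => [_|m IH mN]; first by rewrite leqn0 => /eqP ->.
  rewrite leq_eqVlt => /predU1P[->//|km]; apply: (le_trans (IH (ltnW mN) km)).
  have [_ _ /(_ m.+1 mN)[_ /(_ w)[/= h1 _] _ _ _]] := run.
  by apply: le_trans h1; rewrite lerDl ltW.
apply: (@le_trans _ _ (\sum_(1 <= k < N)
    (2 * calls_factor pb st * pz_rho r (N - 1) w ^+ 2 / eps ^+ 2))).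
  apply: ler_sum_nat => k kN; apply: (le_trans (h k kN)).
  have kN' : (k < N)%N by case/andP: kN.
  rewrite ler_wpM2r ?invr_ge0 ?sqr_ge0 // ler_wpM2l //.
    by apply: mulr_ge0 => //; exact: le_trans (calls_factor_ge1 as1 hst).
  rewrite lerXn2r ?nnegrE ?(ltW (rho_gt0 hst run w _)) //; last by exact: rho_mono.
  by case/andP: lastN.
by rewrite sumr_const_nat -[leLHS]mulr_natl.
Qed.

End Run.

Lemma least_outer_penalty eps N : 0 < eps < 1 ->
  least_nat (fun M => (2 <= M)%N /\ enough_outer pb st eps M) N ->
  rho0 st + (N - 1)%N%:R * tau st
    <= (Ctilde pb st 1 + rho0 st + 2 * tau st) * (eps `^ (4^-1)) ^- 2.
Proof.
move=> e01 [[N2 _] least]; have [e0 e1] := andP e01.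
have r0 := root4_gt0 e01; have r1 := root4_le1 e01.
have ir : 1 <= (eps `^ (4^-1)) ^- 2 by rewrite invf_ge1 ?exprn_gt0 // exprn_ile1 // ltW.
have hC := Ctilde_le1 as1 hst (ltW e1) e0.
have t0 : 0 < tau st by case: hst.
have rho1 : 1 <= rho0 st by case: hst.
have C0 : 0 <= Ctilde pb st 1.
  rewrite /Ctilde le_max; apply/orP; left.
  by rewrite mulr_ge0 ?sqr_ge0 // invr_ge0 sqr_ge0.
(* N = 2 may be imposed by the side condition 2 <= N, and then rho0 + tau is what has to be bounded.
   For larger N, minimality says that N - 1 is not enough, which bounds N from above. *)
have [N3|N3] := leqP N 2.
  have -> : (N - 1 = 1)%N by lia.
  rewrite mul1r -[leLHS]mulr1; apply: ler_pM => //; last by lra.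
  by rewrite addr_ge0 ?(ltW t0) // (le_trans _ rho1).
have hN : ~ enough_outer pb st eps (N - 1).
  move=> h; have : (2 <= N - 1)%N /\ enough_outer pb st eps (N - 1) by split => //; lia.
  by move/least; lia.
have {hN} : (N - 1)%N%:R < (tau st)^-1 * Ctilde pb st eps * eps `^ (- 2^-1) - (tau st)^-1 * rho0 st + 1.
  by rewrite ltNge; apply/negP => h; apply: hN; rewrite /enough_outer ceil_le_int.
rewrite -(ltr_pM2l t0) powR_neg_half //.
have -> : tau st * ((tau st)^-1 * Ctilde pb st eps * (eps `^ 4^-1) ^- 2 - (tau st)^-1 * rho0 st + 1)
  = Ctilde pb st eps * (eps `^ 4^-1) ^- 2 - rho0 st + tau st.
  by move: (_ ^- 2) => z; field; rewrite gt_eqF.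
move: ((eps `^ 4^-1) ^- 2) ir => z z1 h.
have h1 : Ctilde pb st eps * z <= Ctilde pb st 1 * z by rewrite ler_wpM2r //; lra.
have h2 : rho0 st + 2 * tau st <= (rho0 st + 2 * tau st) * z by rewrite ler_peMr //; lra.
by rewrite -addrA mulrDl; lra.
Qed.

End Outer.

(** * Number of oracle calls *)

Section Complexity.
Variables (R : realType) (n q : nat) (dz : measure_display).
Variables (Z : measurableType dz) (pb : problem R n q Z) (st : settings R n).
Hypothesis as1 : AS1 pb.
Hypothesis as5 : AS5 pb.
Hypothesis low : Phi_low_valid pb.
Hypothesis hst : settings_valid pb st.
Local Notation cf := (calls_factor pb st).

Let cf0 : 0 < cf. Proof. exact: lt_le_trans (calls_factor_ge1 as1 hst). Qed.
Let t0 : 0 < tau st. Proof. by case: hst. Qed.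
Let rho1 : 1 <= rho0 st. Proof. by case: hst. Qed.

(** This is z = eps^(-1/2), in which N and rho are linear; eps^(-2) is z^4 and the target eps^(-7/2)
    is z^7. *)
Let root (eps : R) := (eps `^ (4^-1)) ^- 2.

Let root_ge1 (eps : R) : 0 < eps < 1 -> 1 <= root eps.
Proof.
move=> e01; rewrite invf_ge1 ?exprn_gt0 ?root4_gt0 // exprn_ile1 ?(root4_le1 e01) //.
exact: ltW (root4_gt0 e01).
Qed.

Let rootE (eps : R) : 0 < eps < 1 -> (eps ^+ 2)^-1 = root eps ^+ 4 /\ eps `^ (- (7 / 2)) = root eps ^+ 7.
Proof.
move=> e01; rewrite powR_neg_7half /root !exprVn -!exprM.
by split=> //; rewrite -[in LHS](root4_pow4 e01) -exprM.
Qed.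

(* [calls <= (N - 1) * O(rho^2 eps^-2)], where both [N] and [rho] are [O(eps^(-1/2))]. *)
Lemma complexity_least (kappa : R) : 1 <= kappa ->
   exists K eps0 : R, [/\ 0 < K, 0 < eps0 &
   forall (N : nat) (eps : R) (d : measure_display) (Om : measurableType d)
     (P : probability Om R) (r : pz_data R n Z Om),
     0 < eps < 1 -> eps <= eps0 ->
     least_nat (fun M => (2 <= M)%N /\ enough_outer pb st eps M) N ->
     pz_admissible pb st P eps N r -> smallest_nbar pb st eps N r ->
     stoch_critical pb P eps (pz_x r N) /\
     {ae P, forall w,
        pz_rho r (N - 1) w <= kappa * (rho0 st + (N - 1)%N%:R * tau st) ->
        (calls pb st N r w)%:R <= K * eps `^ (- (7 / 2))}].
Proof.
move=> k1; set p0 := Ctilde pb st 1 + rho0 st + 2 * tau st.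
have C0 : 0 <= Ctilde pb st 1.
  rewrite /Ctilde le_max; apply/orP; left.
  by rewrite mulr_ge0 ?sqr_ge0 // invr_ge0 sqr_ge0.
have r1 := rho1; have tp := t0; have p00 : 0 < p0 by rewrite /p0; lra.
have k0 : 0 < kappa by exact: lt_le_trans k1.
(* The product of N - 1 <= (p0/tau) z with the cost 2 cf rho^2 z^4 of a call, where rho <= kappa p0
   z. *)
exists (p0 / tau st * (2 * cf * (kappa * p0) ^+ 2)), 1; split => //.
  by rewrite mulr_gt0 ?divr_gt0 // mulr_gt0 ?exprn_gt0 ?mulr_gt0.
move=> N eps d Om P r e01 _ lN adm sm; have [[N2 hN] _] := lN.
split; first exact: (last_stoch_critical as1 as5 low hst N2 e01 adm hN).
have hp := least_outer_penalty as1 hst e01 lN.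
have [zE z7] := rootE e01; have z1 := root_ge1 e01.
rewrite -/(root eps) -/p0 in hp; rewrite z7; move: (root eps) zE z1 hp => z zE z1 hp {z7}.
have run : pz_run pb st P N r by case: adm.
apply: filterS (run_calls as1 low hst N2 e01 adm sm) => w hw hrho; apply: (le_trans hw).
have rp : 0 < pz_rho r (N - 1) w by apply: (rho_gt0 hst run); rewrite ltn_subrL (ltnW N2).
have hN1 : (N - 1)%N%:R <= p0 / tau st * z.
  by rewrite mulrAC ler_pdivlMr //; apply: le_trans hp; lra.
have hr : pz_rho r (N - 1) w <= kappa * p0 * z.
  by apply: (le_trans hrho); rewrite -mulrA ler_wpM2l // ltW.
have z0 : 0 <= z by lra.
have -> : p0 / tau st * (2 * cf * (kappa * p0) ^+ 2) * z ^+ 7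
   = p0 / tau st * z * (2 * cf * (kappa * p0 * z) ^+ 2 * z ^+ 4) by ring.
rewrite zE; have c2 : 0 <= 2 * cf by rewrite mulr_ge0 // ltW.
have z4 : 0 <= z ^+ 4 by exact: exprn_ge0.
apply: ler_pM => //; first exact: mulr_ge0 (mulr_ge0 c2 (sqr_ge0 _)) z4.
rewrite ler_wpM2r // ler_wpM2l // lerXn2r ?nnegrE ?(ltW rp) //.
exact: mulr_ge0 (mulr_ge0 (ltW k0) (ltW p00)) z0.
Qed.

(** At the first update x_1 and G^1 are data, so the quotient [t1] asked for by the steering test
    depends neither on eps nor on the outcome, and rho_1 is a deterministic O(eps^(-1/2)). The floor
    is the one of [large_penalty_theta]. The single call costs O(eps^(-3)), within the claim. *)
Lemma complexity_rule :
  exists K eps0 : R, [/\ 0 < K, 0 < eps0 &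
   forall eps : R, 0 < eps < 1 -> eps <= eps0 ->
   exists (N : nat) (rule : nat -> R -> 'cV[R]_n -> 'cV[R]_n -> R),
     [/\ (2 <= N)%N, penalty_rule pb st rule &
     forall (d : measure_display) (Om : measurableType d)
       (P : probability Om R) (r : pz_data R n Z Om),
       pz_admissible pb st P eps N r -> smallest_nbar pb st eps N r ->
       follows_rule N r rule ->
       stoch_critical pb P eps (pz_x r N) /\
       {ae P, forall w, (calls pb st N r w)%:R <= K * eps `^ (- (7 / 2))}]].
Proof.
pose C := kJ st / LJ pb + kg st / Lg pb; pose C3 := 4 * kg st + 4 * C + 32 * kJ st.
pose t1 := enorm (G1 st) / ((1 - steer st) * theta pb (x1 st)).
have [kg0 kJ0] : 0 < kg st /\ 0 < kJ st by case: hst => _ _ _ _ [_ _ _ []].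
have [Lg0 LJ0] : 0 < Lg pb /\ 0 < LJ pb by case: as1.
have C0 : 0 <= C by rewrite addr_ge0 // divr_ge0 // ltW.
have C30 : 0 < C3 by rewrite /C3; lra.
have t10 : 0 <= t1.
  rewrite divr_ge0 ?enorm_ge0 // mulr_ge0 ?theta_ge0 // subr_ge0 ltW //.
  by case: hst => /andP[].
have r1 := rho1; have tp := t0.
set p3 := rho0 st + tau st + C3 + t1; have p30 : 0 < p3 by rewrite /p3; lra.
exists (2 * cf * p3 ^+ 2), 1; split => //; first by rewrite mulr_gt0 ?exprn_gt0 ?mulr_gt0.
move=> eps e01 _; have [e0 e1] := andP e01.
have [zE z7] := rootE e01; have z1 := root_ge1 e01.
exists 2%N, (floor_rule pb st (C3 * root eps)); split => //; first exact: floor_rule_valid.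
move=> d Om P r adm sm fr; have run : pz_run pb st P 2 r by case: adm.
have rhoE w : pz_rho r 1 w = Num.max (Num.max (rho0 st + tau st) (C3 * root eps)) t1.
  by rewrite (fr 1%N w isT); case: run => _ /(_ w)[-> -> -> _] _.
have rl w : C3 * root eps <= pz_rho r 1 w by rewrite rhoE !le_max lexx orbT.
have rl0 : 0 < C3 * root eps by rewrite mulr_gt0 //; lra.
split.
  split; first exact: (output_near_stationary as1 as5 low hst e0 adm (k := 1)).
  have := output_theta as1 as5 low hst e0 adm (k := 1) isT rl0 rl => /le_trans; apply.
  by rewrite lee_fin; exact: large_penalty_theta.
have := run_calls as1 low hst (N := 2) isT e01 adm sm; apply: filterS => w hw; apply: (le_trans hw).
rewrite mul1r z7 zE; move: (root eps) z1 rhoE => z z1 rhoE.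
have z0 : 0 <= z by lra.
have hr : pz_rho r 1 w <= p3 * z.
  have m (a : R) : 0 <= a -> a <= a * z by move=> a0; rewrite ler_peMr.
  have h1 := m _ t10; have h2 := m _ (ltW (lt_le_trans ltr01 rho1)); have h3 := m _ (ltW t0).
  have h4 : 0 <= C3 * z by rewrite mulr_ge0 // ltW.
  have h5 : 0 <= t1 * z by rewrite mulr_ge0.
  have h6 : 0 <= rho0 st * z by rewrite mulr_ge0 //; lra.
  have h7 : 0 <= tau st * z by rewrite mulr_ge0 // ltW.
  clearbody C3 t1; rewrite rhoE !ge_max /p3 !mulrDl.
  move: (C3 * z) (t1 * z) (rho0 st * z) (tau st * z) h1 h2 h3 h4 h5 h6 h7 => a b c e.
  by move=> *; apply/andP; split; [apply/andP; split|]; lra.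
have rp : 0 < pz_rho r 1 w by exact: (rho_gt0 hst run).
have c2 : 0 <= 2 * cf by rewrite mulr_ge0 // ltW.
have h : 2 * cf * p3 ^+ 2 * z ^+ 6 = 2 * cf * (p3 * z) ^+ 2 * z ^+ 4 by ring.
apply: (@le_trans _ _ (2 * cf * p3 ^+ 2 * z ^+ 6)); last first.
  by rewrite ler_wpM2l ?(mulr_ge0 c2 (sqr_ge0 _)) // [leRHS]exprS ler_peMl // exprn_ge0.
rewrite h ler_wpM2r ?exprn_ge0 // ler_wpM2l // lerXn2r ?nnegrE ?(ltW rp) //.
exact: mulr_ge0 (ltW p30) z0.
Qed.

End Complexity.

Theorem theorem4p3 (R : realType) (n q : nat) (dz : measure_display)
    (Z : measurableType dz) (pb : problem R n q Z) (st : settings R n)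
    (hn : (0 < n)%N) (hq : (0 < q)%N)
    (h1 : AS1 pb) (h5 : AS5 pb) (hlow : Phi_low_valid pb)
    (hst : settings_valid pb st) :
  (forall (N : nat) (eps : R) (d : measure_display) (Om : measurableType d)
     (P : probability Om R) (r : pz_data R n Z Om),
     (2 <= N)%N -> 0 < eps < 1 -> pz_admissible pb st P eps N r ->
     (stoch_critical pb P eps (pz_x r N) \/
      (('E_P[fun w => theta pb (pz_x r N w)] <= (theta_bound pb st eps N)%:E)%E
       /\ near_stationary pb P eps (pz_x r N)))
     /\ (enough_outer pb st eps N -> stoch_critical pb P eps (pz_x r N)))
  /\
  (forall kappa : R, 1 <= kappa ->
   exists K eps0 : R, [/\ 0 < K, 0 < eps0 &
   forall (N : nat) (eps : R) (d : measure_display) (Om : measurableType d)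
     (P : probability Om R) (r : pz_data R n Z Om),
     0 < eps < 1 -> eps <= eps0 ->
     least_nat (fun M => (2 <= M)%N /\ enough_outer pb st eps M) N ->
     pz_admissible pb st P eps N r -> smallest_nbar pb st eps N r ->
     stoch_critical pb P eps (pz_x r N) /\
     {ae P, forall w,
        pz_rho r (N - 1) w <= kappa * (rho0 st + (N - 1)%N%:R * tau st) ->
        (calls pb st N r w)%:R <= K * eps `^ (- (7 / 2))}])
  /\
  (exists K eps0 : R, [/\ 0 < K, 0 < eps0 &
   forall eps : R, 0 < eps < 1 -> eps <= eps0 ->
   exists (N : nat) (rule : nat -> R -> 'cV[R]_n -> 'cV[R]_n -> R),
     [/\ (2 <= N)%N, penalty_rule pb st rule &
     forall (d : measure_display) (Om : measurableType d)
       (P : probability Om R) (r : pz_data R n Z Om),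
       pz_admissible pb st P eps N r -> smallest_nbar pb st eps N r ->
       follows_rule N r rule ->
       stoch_critical pb P eps (pz_x r N) /\
       {ae P, forall w, (calls pb st N r w)%:R <= K * eps `^ (- (7 / 2))}]]).
Proof.
split=> [N eps d Om P r N2 e01 adm|].
  have ns := last_near_stationary h1 h5 hlow hst N2 e01 adm.
  split; last exact: (last_stoch_critical h1 h5 hlow hst N2 e01 adm).
  by right; split => //; exact: (last_theta h1 h5 hlow hst N2 e01 adm).
split; first exact: (complexity_least h1 h5 hlow hst).
exact: (complexity_rule h1 h5 hlow hst).
Qed.
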